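(* For any pattern $\sigma\in S_4$, the number $\#\sigma(\pi)$ of occurrences of $\sigma$ in a given permutation $\pi\in S_n$ can be computed in $\tilde{O}(n^{5/3})$ time and $\tilde{O}(n)$ space.
   Context: A pattern $\sigma\in S_k$ occurs in $\pi\in S_n$ at positions $i_1<\dots<i_k$ if for all $j\neq j'$, $\pi(i_j)<\pi(i_{j'})$ exactly when $\sigma(j)<\sigma(j')$; $\#\sigma(\pi)$ is the number of such occurrences. $\tilde{O}(g(n))$ means $O(g(n)\log^c n)$ for some constant $c$. *)

(* Defs.v *)
From mathcomp Require Import all_boot all_order all_algebra all_fingroup.
From mathcomp Require Import all_classical all_reals all_analysis.

Set Implicit Arguments.
Unset Strict Implicit.
Unset Printing Implicit Defensive.

Import Order.TTheory GRing.Theory Num.Theory.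

Local Open Scope nat_scope.

(* Positions and values are numbered from 0, as in 'S_n. *)
Definition occurs_at (k n : nat) (sigma : 'S_k) (p : 'S_n)
    (i : {ffun 'I_k -> 'I_n}) : bool :=
  [forall j : 'I_k, forall j' : 'I_k, (j < j') ==> (i j < i j')] &&
  [forall j : 'I_k, forall j' : 'I_k,
     (j != j') ==> ((p (i j) < p (i j')) == (sigma j < sigma j'))].

Definition pattern_count (k n : nat) (sigma : 'S_k) (p : 'S_n) : nat :=
  #|[set i : {ffun 'I_k -> 'I_n} | occurs_at sigma p i]|.

(* The model of computation is the word RAM, with structured control flow in
   place of jumps.  Registers and memory cells are both indexed by nat; a
   program mentions finitely many registers, so these take constant space.  In
   cmd the arguments x, y, z name registers and v is a literal; Sub truncates
   at 0 and division by 0 gives 0. *)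
Inductive binop := Add | Sub | Mul | Div.

Definition eval_binop (o : binop) : nat -> nat -> nat :=
  match o with Add => addn | Sub => subn | Mul => muln | Div => divn end.

Inductive cmd :=
| Skip
| Const (x v : nat)              (* x := v *)
| Op (o : binop) (x y z : nat)   (* x := y o z *)
| Fetch (x y : nat)              (* x := cell at address y *)
| Store (x y : nat)              (* cell at address x := y *)
| Seq (c1 c2 : cmd)
| If (x : nat) (c1 c2 : cmd)     (* c1 if x is nonzero, c2 otherwise *)
| While (x : nat) (c : cmd).     (* repeat c as long as x is nonzero *)

Record state := State { regs : nat -> nat; cells : nat -> nat }.

Definition upd (f : nat -> nat) (x v : nat) : nat -> nat :=
  fun y => if y == x then v else f y.

Definition set_reg (s : state) (x v : nat) : state :=
  State (upd (regs s) x v) (cells s).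

Definition set_mem (s : state) (a v : nat) : state :=
  State (regs s) (upd (cells s) a v).

(* [exec w m c s t s']: on a machine with w-bit words and m memory cells, c
   started in s halts in s' after t unit-cost instructions.  There is no rule
   for an operation whose result overflows a word or for an access outside the
   memory, so a run that does either is stuck: a derivation certifies the word
   size and the space as well as the time. *)
Inductive exec (w m : nat) : cmd -> state -> nat -> state -> Prop :=
| exec_skip s : exec w m Skip s 1 s
| exec_const x v s :
    v < 2 ^ w -> exec w m (Const x v) s 1 (set_reg s x v)
| exec_op o x y z s :
    eval_binop o (regs s y) (regs s z) < 2 ^ w ->
    exec w m (Op o x y z) s 1
      (set_reg s x (eval_binop o (regs s y) (regs s z)))
| exec_fetch x y s :
    regs s y < m -> exec w m (Fetch x y) s 1 (set_reg s x (cells s (regs s y)))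
| exec_store x y s :
    regs s x < m -> exec w m (Store x y) s 1 (set_mem s (regs s x) (regs s y))
| exec_seq c1 c2 s t1 s1 t2 s2 :
    exec w m c1 s t1 s1 -> exec w m c2 s1 t2 s2 ->
    exec w m (Seq c1 c2) s (t1 + t2) s2
| exec_if x c1 c2 s t s' :
    exec w m (if regs s x != 0 then c1 else c2) s t s' ->
    exec w m (If x c1 c2) s t.+1 s'
| exec_while_stop x c s :
    regs s x = 0 -> exec w m (While x c) s 1 s
| exec_while_step x c s t1 s1 t2 s2 :
    regs s x <> 0 -> exec w m c s t1 s1 -> exec w m (While x c) s1 t2 s2 ->
    exec w m (While x c) s (t1 + t2).+1 s2.

(* Register 0 holds n and cells 0, ..., n-1 hold p(0), ..., p(n-1). *)
Definition init_state (n : nat) (p : 'S_n) : state :=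
  State (fun x => if x == 0 then n else 0)
        (fun a => if insub a is Some i then val (p i) else 0).

(* One program serves all n.  Words have O(log n) bits, the constant b being
   independent of n; 0 < b makes every input value fit in a word, and
   n <= space n makes the input fit in memory, so that it is counted in the
   space.  The output is left in register 0. *)
Definition computes_in (c : cmd) (b : nat) (F : forall n : nat, 'S_n -> nat)
    (time space : nat -> nat) : Prop :=
  0 < b /\
  forall (n : nat) (p : 'S_n), n <= space n /\
    exists (t : nat) (s' : state),
      [/\ exec (b * (trunc_log 2 n).+1) (space n) c (init_state p) t s',
          t <= time n & regs s' 0 = F n p].

Local Open Scope classical_set_scope.
Local Open Scope ring_scope.

Definition softO (R : realType) (f : nat -> nat) (g : nat -> R) : Prop :=
  exists (C : R) (c : nat),
    \forall n \near \oo, (f n)%:R <= C * (g n * ln (n%:R : R) ^+ c).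

(* Main.v *)
(* Every #sigma with sigma in S_4 is, up to the factor 12, an integer combination
   of tree counts, i.e. numbers of quadruples of points whose consecutive members
   along a tree on four vertices lie in prescribed quadrants of one another, and
   of one cycle count: the number of (a, b, c, d) with a left of b, c below b, c
   left of d and a below d.  Cut positions and values into strips of size
   s ~ n^(1/3).  A tree count is a sequence of weighted quadrant sums, each
   taking n/s scans for the pairs in different strips and n s steps for the
   others.  For the cycle count, if some edge joins different strips, fixing the
   strip of one of its ends makes the two ends independent and leaves linear
   scans, n/s of them; if all four edges are inside strips, then for each a the
   s^2 candidates for (b, c) and for (d, c) are enumerated.  All in all O(n^(5/3))
   steps and O(n) cells. *)

Require Import Defs.
From mathcomp Require Import all_boot all_order all_algebra all_fingroup.
From mathcomp Require Import all_classical all_reals all_analysis.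
From mathcomp Require Import zify ring.

Set Implicit Arguments.
Unset Strict Implicit.
Unset Printing Implicit Defensive.

Import Order.TTheory GRing.Theory Num.Theory.

Local Open Scope nat_scope.

(** * A loop language and its compilation *)

(** A tree count prescribes relations along the edges only, so its other vertices may coincide. The
    identities between counts must therefore hold for quadruples with repetitions as well; trees
    with an edge marked as equality supply the corrections. After summation over the 24 orderings of
    a quadruple, such an identity depends on the order type alone. There are 1 + 3·2 + 3·6 + 24 = 49
    of these (points with multiplicities), so it is settled by a finite computation.

    The choice of s balances n/s scans of length n against the n s^2 candidates of the local search
    for the cycle: the two agree when s^3 = n.

    On the machine side, programs do not branch on data: comparisons are arithmetic on 0 and 1. The
    running time is then a function of three loop bounds, and cost can be treated apart from
    correctness and absence of overflow, in a small loop language whose compilation is verified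
    once. As subtraction truncates, positive and negative coefficients are accumulated separately
    and subtracted only at the end, before the division by 12. *)

Lemma leq_sum_ord (F : nat -> nat) i n :
  i <= n -> \sum_(j < i) F j <= \sum_(j < n) F j.
Proof.
move=> /subnKC <-; rewrite big_split_ord /=; exact: leq_addr.
Qed.

(** Sums are expressions, evaluated without change of state, so that nested searches need no
    accumulator variable and no loop invariant of their own. *)
Inductive expr :=
| EVar (x : nat)
| ENum (v : nat)
| EBin (o : binop) (e1 e2 : expr)
| EGet (r : nat) (e : expr)
| ESum (x g : nat) (e : expr).

Inductive prog :=
| PSet (x : nat) (e : expr)
| PPut (r : nat) (e1 e2 : expr)
| PSeq (c1 c2 : prog)
| PFor (x g : nat) (c : prog).

Record pstate := PState { vars : nat -> nat; arrs : nat -> nat -> nat }.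

Definition setv (s : pstate) (x v : nat) : pstate :=
  PState (upd (vars s) x v) (arrs s).

Definition seta (s : pstate) (r i v : nat) : pstate :=
  PState (vars s) (fun r' => if r' == r then upd (arrs s r) i v else arrs s r').

Fixpoint eval (e : expr) (s : pstate) : nat :=
  match e with
  | EVar x => vars s x
  | ENum v => v
  | EBin o e1 e2 => eval_binop o (eval e1 s) (eval e2 s)
  | EGet r e => arrs s r (eval e s)
  | ESum x g e => \sum_(i < vars s g) eval e (setv s x i)
  end.

Fixpoint run (c : prog) (s : pstate) : pstate :=
  match c with
  | PSet x e => setv s x (eval e s)
  | PPut r e1 e2 => seta s r (eval e1 s) (eval e2 s)
  | PSeq c1 c2 => run c2 (run c1 s)
  | PFor x g c => iteri (vars s g) (fun i s' => run c (setv s' x i)) s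
  end.

(* [W] bounds the words and [Z] the array indices. *)
Fixpoint esafe (W Z : nat) (e : expr) (s : pstate) : Prop :=
  match e with
  | EVar x => True
  | ENum v => v < W
  | EBin o e1 e2 =>
      [/\ esafe W Z e1 s, esafe W Z e2 s &
          match o with
          | Add | Mul => eval_binop o (eval e1 s) (eval e2 s) < W
          | _ => True
          end]
  | EGet r e => esafe W Z e s /\ eval e s < Z
  | ESum x g e =>
      (forall i, i < vars s g -> esafe W Z e (setv s x i)) /\
      \sum_(i < vars s g) eval e (setv s x i) < W
  end.

Fixpoint safe (W Z : nat) (c : prog) (s : pstate) : Prop :=
  match c with
  | PSet x e => esafe W Z e s
  | PPut r e1 e2 => [/\ esafe W Z e1 s, esafe W Z e2 s & eval e1 s < Z]
  | PSeq c1 c2 => safe W Z c1 s /\ safe W Z c2 (run c1 s)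
  | PFor x g c =>
      forall i, i < vars s g ->
        safe W Z c (setv (iteri i (fun i s' => run c (setv s' x i)) s) x i)
  end.

(* Variables 0, 1 and 2 serve as loop bounds and are constant inside loops, so
   that the running time is a function of their values. *)
Definition nbounds := 3.

Fixpoint ewf (R : nat) (e : expr) : bool :=
  match e with
  | EVar _ | ENum _ => true
  | EBin _ e1 e2 => ewf R e1 && ewf R e2
  | EGet r e => (r < R) && ewf R e
  | ESum x g e => [&& nbounds <= x, g < nbounds & ewf R e]
  end.

Fixpoint wf (R : nat) (inloop : bool) (c : prog) : bool :=
  match c with
  | PSet x e => (inloop ==> (nbounds <= x)) && ewf R e
  | PPut r e1 e2 => [&& r < R, ewf R e1 & ewf R e2]
  | PSeq c1 c2 => wf R inloop c1 && wf R inloop c2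
  | PFor x g c => [&& nbounds <= x, g < nbounds & wf R true c]
  end.

(** Exact instruction counts of the compiled code. A lookup adds [Const], [Mul], [Add] and [Fetch].
    A sum pays four instructions of loop control and one addition per round; the 7 is three
    instructions to save, clear and restore, and four to enter and leave the loop. *)
Fixpoint ecost (e : expr) (f : nat -> nat) : nat :=
  match e with
  | EVar _ | ENum _ => 1
  | EBin _ e1 e2 => ecost e1 f + ecost e2 f + 1
  | EGet r e => ecost e f + 4
  | ESum x g e => f g * (ecost e f + 5) + 7
  end.

(** Every round of a loop is charged at the state before the loop. This is exact for well-formed
    programs, since cost depends on the loop bounds only and no loop body changes them. *)
Fixpoint cost (c : prog) (s : pstate) : nat :=
  match c with
  | PSet x e => ecost e (vars s) + 1
  | PPut r e1 e2 => ecost e1 (vars s) + ecost e2 (vars s) + 4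
  | PSeq c1 c2 => cost c1 s + cost c2 (run c1 s)
  | PFor x g c => vars s g * (cost c s + 4) + 4
  end.

Fixpoint wvar (c : prog) (x : nat) : bool :=
  match c with
  | PSet y _ => y == x
  | PPut _ _ _ => false
  | PSeq c1 c2 => wvar c1 x || wvar c2 x
  | PFor y _ c => (y == x) || wvar c x
  end.

Fixpoint warr (c : prog) (r : nat) : bool :=
  match c with
  | PSet _ _ => false
  | PPut r' _ _ => r' == r
  | PSeq c1 c2 => warr c1 r || warr c2 r
  | PFor _ _ c => warr c r
  end.

Lemma upd_same f x v : upd f x v x = v.
Proof. by rewrite /upd eqxx. Qed.

Lemma upd_other f x v y : y != x -> upd f x v y = f y.
Proof. by rewrite /upd => /negbTE ->. Qed.

Lemma run_vars c s x : ~~ wvar c x -> vars (run c s) x = vars s x.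
Proof.
elim: c s => [y e|r e1 e2|c1 IH1 c2 IH2|y g c IH] s //=.
- by move=> nyx; rewrite upd_other // eq_sym.
- by rewrite negb_or => /andP[/IH1 h1 /IH2 h2]; rewrite h2 h1.
rewrite negb_or => /andP[nyx /IH h].
elim: (vars s g) => [//|k IHk]; rewrite iteriS h /= upd_other ?IHk //.
by rewrite eq_sym.
Qed.

Lemma run_arrs c s r : ~~ warr c r -> arrs (run c s) r = arrs s r.
Proof.
elim: c s => [y e|r' e1 e2|c1 IH1 c2 IH2|y g c IH] s //=.
- by rewrite eq_sym => /negbTE ->.
- by rewrite negb_or => /andP[/IH1 h1 /IH2 h2]; rewrite h2 h1.
by move=> /IH h; elim: (vars s g) => [//|k IHk]; rewrite iteriS h /= IHk.
Qed.

Lemma wf_wvar R c x : wf R true c -> x < nbounds -> ~~ wvar c x.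
Proof.
move=> + xn; elim: c => [y e|r e1 e2|c1 IH1 c2 IH2|y g c IH] //=.
- by case/andP=> [ny _]; rewrite gtn_eqF // (leq_trans xn).
- by case/andP=> [/IH1 h1 /IH2 h2]; rewrite negb_or h1.
case/and3P=> [ny _ /IH h]; rewrite negb_or h andbT.
by rewrite gtn_eqF // (leq_trans xn).
Qed.

Lemma wf_weaken R c : wf R true c -> wf R false c.
Proof.
elim: c => [y e|r e1 e2|c1 IH1 c2 IH2|y g c IH] //=.
  by case/andP.
by case/andP=> [/IH1 -> /IH2 ->].
Qed.

Lemma ecost_ext R e f f' :
  ewf R e -> (forall x, x < nbounds -> f x = f' x) -> ecost e f = ecost e f'.
Proof.
move=> + ff'; elim: e => [x|v|o e1 IH1 e2 IH2|r e IH|x g e IH] //=.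
- by case/andP=> [/IH1 -> /IH2 ->].
- by case/andP=> [_ /IH ->].
by case/and3P=> [_ /ff' -> /IH ->].
Qed.

Lemma cost_ext R c s s' : wf R true c ->
  (forall x, x < nbounds -> vars s x = vars s' x) -> cost c s = cost c s'.
Proof.
elim: c s s' => [y e|r e1 e2|c1 IH1 c2 IH2|y g c IH] s s' /=.
- by case/andP=> [_ we] ss'; rewrite (ecost_ext we ss').
- by case/and3P=> [_ w1 w2] ss'; rewrite (ecost_ext w1 ss') (ecost_ext w2 ss').
- case/andP=> [w1 w2] ss'; rewrite (IH1 _ _ w1 ss'); congr (_ + _).
  apply: IH2 => // x xn; rewrite !run_vars ?(wf_wvar w1) //; exact: ss'.
by case/and3P=> [_ gn w1] ss'; rewrite ss' // (IH _ _ w1 ss').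
Qed.

Definition bnd (W : nat) (s : pstate) : Prop :=
  (forall x, vars s x < W) /\ (forall r i, arrs s r i < W).

Lemma bnd_setv W s x v : bnd W s -> v < W -> bnd W (setv s x v).
Proof. by case=> h1 h2 vW; split=> // y; rewrite /= /upd; case: eqP. Qed.

Lemma bnd_seta W s r i v : bnd W s -> v < W -> bnd W (seta s r i v).
Proof.
by case=> h1 h2 vW; split=> //= r' j; case: eqP => // _; rewrite /upd; case: eqP.
Qed.

(** Truncated subtraction and division never exceed their left operand, so only sums and products
    carry a word-size condition in [esafe]. *)
Lemma eval_lt W Z e s : bnd W s -> esafe W Z e s -> eval e s < W.
Proof.
move=> b; elim: e => [x|v|o e1 IH1 e2 IH2|r e IH|x g e IH] //=.
- by move=> _; exact: b.1.
- case=> /IH1 h1 _; case: o => //= _; apply: leq_ltn_trans h1.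
    exact: leq_subr.
  exact: leq_div.
- by move=> _; exact: b.2.
by case.
Qed.

Lemma run_bnd W Z c s : bnd W s -> safe W Z c s -> bnd W (run c s).
Proof.
elim: c s => [y e|r e1 e2|c1 IH1 c2 IH2|y g c IH] s b /=.
- by move=> h; apply: bnd_setv => //; apply: eval_lt h.
- by case=> _ h _; apply: bnd_seta => //; apply: eval_lt h.
- by case=> h1 h2; apply: IH2 => //; apply: IH1.
move=> h; have gW := b.1 g.
suff: forall k, k <= vars s g ->
  bnd W (iteri k (fun i s' => run c (setv s' y i)) s) by apply.
elim=> [//|k IHk] kg; rewrite iteriS; apply: IH; last exact: h.
apply: bnd_setv; first by apply: IHk; exact: ltnW.
exact: ltn_trans gW.
Qed.

(* Machine registers: variable [x] lives in register [2 x]; the odd registers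
   hold temporaries, of which the first three are constant: the stride [Z] of
   the arrays, 0 and 1. *)
Definition var (x : nat) := x.*2.
Definition tmp (d : nat) := d.*2.+1.

(** The counter is a temporary, copied to the loop variable in each round, so the body may overwrite
    that variable. The tested register holds the number of rounds left, since [While] can only test
    for zero. Adding [tmp 1], which is 0, serves as the register move that the machine lacks. *)
Definition loop (d x g : nat) (body : cmd) : cmd :=
  Seq (Op Add (tmp d) (var g) (tmp 1))
  (Seq (Const (tmp d.+1) 0)
  (Seq (Op Defs.Sub (tmp d.+2) (tmp d) (tmp d.+1))
  (While (tmp d.+2)
    (Seq (Op Add (var x) (tmp d.+1) (tmp 1))
    (Seq body
    (Seq (Op Add (tmp d.+1) (tmp d.+1) (tmp 2))
         (Op Defs.Sub (tmp d.+2) (tmp d) (tmp d.+1)))))))).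

Fixpoint ecompile (d : nat) (e : expr) : cmd :=
  match e with
  | EVar x => Op Add (tmp d) (var x) (tmp 1)
  | ENum v => Const (tmp d) v
  | EBin o e1 e2 =>
      Seq (ecompile d e1)
      (Seq (ecompile d.+1 e2) (Op o (tmp d) (tmp d) (tmp d.+1)))
  | EGet r e =>
      Seq (ecompile d e)
      (Seq (Const (tmp d.+1) r)
      (Seq (Op Mul (tmp d.+1) (tmp d.+1) (tmp 0))
      (Seq (Op Add (tmp d) (tmp d) (tmp d.+1)) (Fetch (tmp d) (tmp d)))))
  | ESum x g e =>
      Seq (Op Add (tmp d.+1) (var x) (tmp 1))
      (Seq (Const (tmp d) 0)
      (Seq (loop d.+2 x g
             (Seq (ecompile d.+4.+1 e) (Op Add (tmp d) (tmp d) (tmp d.+4.+1))))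
      (Op Add (var x) (tmp d.+1) (tmp 1))))
  end.

Fixpoint compile (d : nat) (c : prog) : cmd :=
  match c with
  | PSet x e => Seq (ecompile d e) (Op Add (var x) (tmp d) (tmp 1))
  | PPut r e1 e2 =>
      Seq (ecompile d e1)
      (Seq (ecompile d.+1 e2)
      (Seq (Const (tmp d.+2) r)
      (Seq (Op Mul (tmp d.+2) (tmp d.+2) (tmp 0))
      (Seq (Op Add (tmp d) (tmp d) (tmp d.+2)) (Store (tmp d) (tmp d.+1))))))
  | PSeq c1 c2 => Seq (compile d c1) (compile d c2)
  | PFor x g c => loop d x g (compile d.+3 c)
  end.

(** The predicate [ok] selects the variables that must agree: during a compiled sum the summation
    variable is exempt, because it holds an index instead of its value in [s]. *)
Definition simx (Z R : nat) (ok : nat -> bool) (s : pstate) (ms : state) : Prop :=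
  [/\ forall y, ok y -> regs ms (var y) = vars s y,
      regs ms (tmp 0) = Z, regs ms (tmp 1) = 0, regs ms (tmp 2) = 1 &
      forall r i, r < R -> i < Z -> cells ms (r * Z + i) = arrs s r i].

Notation sim Z R := (simx Z R xpredT).

Lemma var_tmp x d : (var x == tmp d) = false.
Proof. by apply/negbTE; rewrite /var /tmp; lia. Qed.

Lemma tmp_var x d : (tmp d == var x) = false.
Proof. by rewrite eq_sym var_tmp. Qed.

Lemma var_var x y : (var x == var y) = (x == y).
Proof. by rewrite /var; lia. Qed.

Lemma tmp_tmp x y : (tmp x == tmp y) = (x == y).
Proof. by rewrite /tmp; lia. Qed.

Definition regE := (var_tmp, tmp_var, var_var, tmp_tmp).

Ltac reg_simpl :=
  rewrite /= /upd ?regE;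
  repeat match goal with
  | |- context [if ?a == ?b then _ else _] =>
      first [ have -> : (a == b) = false by lia
            | have -> : (a == b) = true by lia ]
  end.

Lemma simx_tmp Z R ok s ms d v :
  3 <= d -> simx Z R ok s ms -> simx Z R ok s (set_reg ms (tmp d) v).
Proof.
move=> d3 [h1 h2 h3 h4 h5]; split=> //=; rewrite /upd.
- by move=> y oky; rewrite regE h1.
- by rewrite regE; case: eqP => // ?; lia.
- by rewrite regE; case: eqP => // ?; lia.
by rewrite regE; case: eqP => // ?; lia.
Qed.

Lemma simx_var Z R x s ms v : simx Z R (fun y => y != x) s ms ->
  sim Z R (setv s x v) (set_reg ms (var x) v).
Proof.
case=> h1 h2 h3 h4 h5; split=> //=; rewrite /upd ?regE //.
by move=> y _; rewrite regE; case: eqP => // /eqP; exact: h1.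
Qed.

Lemma simx_sub Z R ok s ms : sim Z R s ms -> simx Z R ok s ms.
Proof. by case=> h1 h2 h3 h4 h5; split=> // y _; exact: h1. Qed.

(** * Correctness and exact cost of the compiled code *)

Section Simulation.

Variables (w m Z R : nat).
Hypothesis (RZm : R * Z <= m).
Hypothesis (RZw : R * Z < 2 ^ w).
Hypothesis (Rw : R < 2 ^ w).

Local Notation W := (2 ^ w).

Let W_gt0 : 0 < W. Proof. by rewrite expn_gt0. Qed.

(** The invariant has to survive writes to the three control registers, which change between rounds.
    The body takes the same time [tb] in every round, which makes the total exact. *)
Lemma loopP d x g body (J : nat -> state -> Prop) N tb ms :
    3 <= d -> N < W -> regs ms (var g) = N ->
    (forall i ms, J i ms -> regs ms (tmp 1) = 0 /\ regs ms (tmp 2) = 1) ->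
    (forall i ms k v, J i ms -> d <= k <= d.+2 -> J i (set_reg ms (tmp k) v)) ->
    (forall i ms, i < N -> J i ms -> exists ms',
       [/\ exec w m body (set_reg ms (var x) i) tb ms', J i.+1 ms',
           regs ms' (tmp d) = regs ms (tmp d) &
           regs ms' (tmp d.+1) = regs ms (tmp d.+1)]) ->
    J 0 ms ->
  exists ms', exec w m (loop d x g body) ms (N * (tb + 4) + 4) ms' /\ J N ms'.
Proof.
move=> d3 NW gN J12 Jt Jstep J0.
rewrite /loop; set wh := While _ _.
suff while k i ms1 : i + k = N -> J i ms1 -> regs ms1 (tmp d) = N ->
    regs ms1 (tmp d.+1) = i -> regs ms1 (tmp d.+2) = k ->
    exists ms', exec w m wh ms1 (k * (tb + 4) + 1) ms' /\ J N ms'.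
  have [z1 z2] := J12 _ _ J0.
  pose ms1 := set_reg ms (tmp d) N; pose ms2 := set_reg ms1 (tmp d.+1) 0.
  have J2 : J 0 ms2 by do 2![apply: (Jt); last by lia].
  have [|||||ms' [ex JN]] := while N 0 (set_reg ms2 (tmp d.+2) N).
  - by [].
  - by apply: (Jt); last by lia.
  - by reg_simpl.
  - by reg_simpl.
  - by rewrite /= upd_same.
  exists ms'; split=> //.
  have -> : N * (tb + 4) + 4 = 1 + (1 + (1 + (N * (tb + 4) + 1))) by lia.
  have e1 : exec w m (Op Add (tmp d) (var g) (tmp 1)) ms 1 ms1.
    have := @exec_op w m Add (tmp d) (var g) (tmp 1) ms.
    by rewrite /= z1 gN addn0; apply.
  apply: (exec_seq e1); have e2 := @exec_const w m (tmp d.+1) 0 ms1 W_gt0.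
  apply: (exec_seq e2); apply: exec_seq ex.
  have := @exec_op w m Defs.Sub (tmp d.+2) (tmp d) (tmp d.+1) ms2.
  by reg_simpl; rewrite subn0; apply.
elim: k i ms1 => [|k IH] i ms1 iN Ji r0 r1 r2.
  exists ms1; split; last by rewrite -iN addn0.
  exact: exec_while_stop.
have [|ms2 [ex2 J2 k0 k1]] := Jstep i ms1 _ Ji; first by lia.
have [z1 z2] := J12 _ _ J2.
pose ms3 := set_reg ms2 (tmp d.+1) i.+1.
have J3 : J i.+1 ms3 by apply: (Jt); last by lia.
have r03 : regs ms3 (tmp d) = N.
  by reg_simpl; rewrite k0.
have [|||||ms' [ex JN]] := IH i.+1 (set_reg ms3 (tmp d.+2) k).
- by lia.
- by apply: (Jt); last by lia.
- by reg_simpl; rewrite k0.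
- by reg_simpl.
- by rewrite /= upd_same.
exists ms'; split=> //.
have -> : k.+1 * (tb + 4) + 1 = ((1 + (tb + (1 + 1))) + (k * (tb + 4) + 1)).+1.
  by lia.
apply: exec_while_step ex; first by rewrite r2.
apply: (@exec_seq _ _ _ _ _ _ (set_reg ms1 (var x) i)).
  have := @exec_op w m Add (var x) (tmp d.+1) (tmp 1) ms1.
  have [y1 _] := J12 _ _ Ji.
  by rewrite /= y1 r1 addn0; apply; lia.
apply: (exec_seq ex2); apply: (@exec_seq _ _ _ _ _ _ ms3).
  have := @exec_op w m Add (tmp d.+1) (tmp d.+1) (tmp 2) ms2.
  by rewrite /= z2 k1 r1 addn1; apply; lia.
have := @exec_op w m Defs.Sub (tmp d.+2) (tmp d) (tmp d.+1) ms3.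
rewrite r03 /= upd_same.
have -> : N - i.+1 = k by lia.
by apply; lia.
Qed.

(** Code compiled at depth d writes temporaries from d on only; this is what keeps a left operand
    alive while the right one is computed. *)
Definition frame (d : nat) (ms ms' : state) : Prop :=
  forall k, k < d -> regs ms' (tmp k) = regs ms (tmp k).

Lemma frame_trans d ms1 ms2 ms3 :
  frame d ms1 ms2 -> frame d ms2 ms3 -> frame d ms1 ms3.
Proof. by move=> h1 h2 k kd; rewrite h2 // h1. Qed.

Lemma frame_le d d' ms ms' : d <= d' -> frame d' ms ms' -> frame d ms ms'.
Proof. by move=> dd' h k kd; apply: h; exact: leq_trans dd'. Qed.

Lemma frame_tmp d k ms v : d <= k -> frame d ms (set_reg ms (tmp k) v).
Proof.
by move=> dk j jd; rewrite /= /upd regE; case: eqP => // jk; lia.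
Qed.

Lemma frame_var d x ms v : frame d ms (set_reg ms (var x) v).
Proof. by move=> j jd; rewrite /= /upd regE. Qed.

Lemma ecompileP d e s ms :
    3 <= d -> sim Z R s ms -> bnd W s -> ewf R e -> esafe W Z e s ->
  exists ms', [/\ exec w m (ecompile d e) ms (ecost e (vars s)) ms',
    sim Z R s ms', regs ms' (tmp d) = eval e s & frame d ms ms'].
Proof.
elim: e d s ms => [x|v|o e1 IH1 e2 IH2|r e IH|x g e IH] d s ms d3 S b we sf.
- exists (set_reg ms (tmp d) (vars s x)); split.
  + have [h1 _ h3 _ _] := S.
    have := @exec_op w m Add (tmp d) (var x) (tmp 1) ms.
    by rewrite /= h3 h1 // addn0; apply; exact: b.1.
  + exact: simx_tmp.
  + by rewrite /= upd_same.
  + exact: frame_tmp.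
- exists (set_reg ms (tmp d) v); split.
  + exact: exec_const.
  + exact: simx_tmp.
  + by rewrite /= upd_same.
  + exact: frame_tmp.
- case/andP: we => we1 we2; have lt := eval_lt b sf; case: sf => sf1 sf2 _.
  have [ms1 [ex1 S1 v1 f1]] := IH1 d s ms d3 S b we1 sf1.
  have [ms2 [ex2 S2 v2 f2]] := IH2 d.+1 s ms1 (leqW d3) S1 b we2 sf2.
  exists (set_reg ms2 (tmp d) (eval (EBin o e1 e2) s)); split.
  + rewrite /= -addnA; apply: (exec_seq ex1); apply: (exec_seq ex2).
    have := @exec_op w m o (tmp d) (tmp d) (tmp d.+1) ms2.
    by rewrite v2 f2 // v1; apply.
  + exact: simx_tmp.
  + by rewrite /= upd_same.
  + apply: (frame_trans f1); apply: frame_trans (frame_tmp _ _ _) => //.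
    exact: frame_le f2.
- case/andP: we => rR we; case: sf => sf ltZ.
  have [ms1 [ex1 S1 v1 f1]] := IH d s ms d3 S b we sf.
  have [_ h2 _ _ h5] := S1.
  have addr : r * Z + eval e s < R * Z by nia.
  pose ms2 := set_reg ms1 (tmp d.+1) r.
  pose ms3 := set_reg ms2 (tmp d.+1) (r * Z).
  pose ms4 := set_reg ms3 (tmp d) (r * Z + eval e s).
  have S4 : sim Z R s ms4 by do 3![apply: simx_tmp; first by lia].
  exists (set_reg ms4 (tmp d) (arrs s r (eval e s))); split.
  + have -> : ecost (EGet r e) (vars s) =
        ecost e (vars s) + (1 + (1 + (1 + 1))) by rewrite /=; lia.
    apply: (exec_seq ex1); apply: (@exec_seq _ _ _ _ _ _ ms2).
      by apply: exec_const; lia.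
    apply: (@exec_seq _ _ _ _ _ _ ms3).
      have := @exec_op w m Mul (tmp d.+1) (tmp d.+1) (tmp 0) ms2.
      rewrite /= upd_same /upd regE /= h2; apply; nia.
    apply: (@exec_seq _ _ _ _ _ _ ms4).
      have := @exec_op w m Add (tmp d) (tmp d) (tmp d.+1) ms3.
      by reg_simpl; rewrite v1 addnC; apply; lia.
    have := @exec_fetch w m (tmp d) (tmp d) ms4.
    have [_ _ _ _ h5'] := S4.
    by rewrite /= upd_same h5; [apply; lia|..].
  + exact: simx_tmp.
  + by rewrite /= upd_same.
  + apply: (frame_trans f1).
    by do 4! [apply: frame_trans; last by apply: frame_tmp; lia].
case/and3P: we => xn gn we; case: sf => sf lt.
have [h1 _ h3 _ _] := S.
pose ms1 := set_reg ms (tmp d.+1) (vars s x).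
pose ms2 := set_reg ms1 (tmp d) 0.
have S2 : sim Z R s ms2 by do 2![apply: simx_tmp; first by lia].
have gx : g != x by apply/eqP => gx; move: gn xn; rewrite gx; lia.
(* The partial sum sits in [tmp d] and the saved value of [x] in [tmp d.+1], both below the control
   registers of the loop and the temporaries of its body. *)
pose J i (ms' : state) :=
  [/\ simx Z R (fun y => y != x) s ms',
      regs ms' (tmp d) = \sum_(j < i) eval e (setv s x j),
      regs ms' (tmp d.+1) = vars s x & frame d ms2 ms'].
have [|||||||ms3 [ex3 [S3 a3 v3 f3]]] := @loopP d.+2 x g
    (Seq (ecompile d.+4.+1 e) (Op Add (tmp d) (tmp d) (tmp d.+4.+1))) J (vars s g)
    (ecost e (vars s) + 1) ms2.
- by lia.
- exact: b.1.
- by have [-> //] := S2.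
- by move=> i ms' [[]].
- move=> i ms' k v [S' a' v' f'] kd; split.
  + by apply: simx_tmp S'; lia.
  + by rewrite /= upd_other // regE; lia.
  + by rewrite /= upd_other // regE; lia.
  + by apply: (frame_trans f'); apply: frame_tmp; lia.
- move=> i ms' ig [S' a' v' f'].
  have Sx : sim Z R (setv s x i) (set_reg ms' (var x) i) by exact: simx_var.
  have bx : bnd W (setv s x i).
    by apply: bnd_setv => //; apply: ltn_trans ig _; exact: b.1.
  have [||ms3 [ex3 S3 v3 f3]] := IH d.+4.+1 _ _ _ Sx bx we; first by lia.
    exact: sf.
  have c3 : ecost e (vars s) = ecost e (vars (setv s x i)).
    apply: ecost_ext we _ => y yn /=; rewrite upd_other //.
    by apply/eqP => yx; move: yn xn; rewrite yx; lia.
  exists (set_reg ms3 (tmp d) (\sum_(j < i.+1) eval e (setv s x j))).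
  have fd k : k < d.+4.+1 -> regs ms3 (tmp k) = regs ms' (tmp k).
    by move=> kd; rewrite f3 // /= upd_other // regE.
  split.
  + rewrite c3; apply: (exec_seq ex3).
    have := @exec_op w m Add (tmp d) (tmp d) (tmp d.+4.+1) ms3.
    rewrite /= v3 fd ?a'; last by lia.
    rewrite big_ord_recr /=; apply; apply: leq_ltn_trans lt.
    have := @leq_sum_ord (fun j => eval e (setv s x j)) i.+1 _ ig.
    by rewrite big_ord_recr.
  + split.
    * apply: simx_tmp => //; case: S3 => g1 g2 g3 g4 g5; split=> // y yx.
      by rewrite g1 //= upd_other.
    * by rewrite /= upd_same.
    * by rewrite /= upd_other ?fd ?regE //; lia.
    * apply: (frame_trans f') => k kd /=; rewrite upd_other ?fd ?regE //; lia.
  + by rewrite /= upd_other ?fd ?regE //; lia.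
  + by rewrite /= upd_other ?fd ?regE //; lia.
- split.
  + exact: simx_sub.
  + by rewrite /= upd_same big_ord0.
  + by rewrite /= upd_other ?upd_same // regE; lia.
  + by [].
exists (set_reg ms3 (var x) (vars s x)); split.
- have -> : ecost (ESum x g e) (vars s) =
      1 + (1 + (vars s g * (ecost e (vars s) + 1 + 4) + 4 + 1)).
    by rewrite /= -addnA; lia.
  apply: (@exec_seq _ _ _ _ _ _ ms1).
    have := @exec_op w m Add (tmp d.+1) (var x) (tmp 1) ms.
    by rewrite /= h1 // h3 addn0; apply; exact: b.1.
  apply: (@exec_seq _ _ _ _ _ _ ms2); first exact: exec_const.
  apply: (exec_seq ex3).
  have := @exec_op w m Add (var x) (tmp d.+1) (tmp 1) ms3.
  have [_ _ z3 _ _] := S3.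
  by rewrite /= v3 z3 addn0; apply; exact: b.1.
- have [g1 g2 g3 g4 g5] := simx_var (vars s x) S3; split=> // y _.
  by rewrite g1 //= /upd; case: eqP => // ->.
- by rewrite /= upd_other ?regE.
- by move=> k kd; rewrite /= upd_other ?regE // f3 //; reg_simpl.
Qed.

Lemma compileP d il c s ms :
    3 <= d -> sim Z R s ms -> bnd W s -> wf R il c -> safe W Z c s ->
  exists ms', [/\ exec w m (compile d c) ms (cost c s) ms',
    sim Z R (run c s) ms' & frame d ms ms'].
Proof.
elim: c d il s ms => [x e|r e1 e2|c1 IH1 c2 IH2|x g c IH] d il s ms d3 S b wc sf.
- case/andP: wc => _ we.
  have [ms1 [ex1 S1 v1 f1]] := ecompileP d3 S b we sf.
  exists (set_reg ms1 (var x) (eval e s)); split.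
  + apply: (exec_seq ex1).
    have := @exec_op w m Add (var x) (tmp d) (tmp 1) ms1.
    have [_ _ z1 _ _] := S1.
    by rewrite /= v1 z1 addn0; apply; exact: eval_lt sf.
  + by apply: simx_var; exact: simx_sub.
  + by apply: (frame_trans f1); exact: frame_var.
- case/and3P: wc => rR we1 we2; case: sf => sf1 sf2 ltZ.
  have [ms1 [ex1 S1 v1 f1]] := ecompileP d3 S b we1 sf1.
  have [ms2 [ex2 S2 v2 f2]] := ecompileP (leqW d3) S1 b we2 sf2.
  have addr : r * Z + eval e1 s < R * Z by nia.
  pose ms3 := set_reg ms2 (tmp d.+2) r.
  pose ms4 := set_reg ms3 (tmp d.+2) (r * Z).
  pose ms5 := set_reg ms4 (tmp d) (r * Z + eval e1 s).
  have [_ h2 _ _ _] := S2.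
  have S5 : sim Z R s ms5 by do 3![apply: simx_tmp; first by lia].
  exists (Defs.set_mem ms5 (r * Z + eval e1 s) (eval e2 s)); split.
  + have -> : cost (PPut r e1 e2) s = ecost e1 (vars s) +
        (ecost e2 (vars s) + (1 + (1 + (1 + 1)))) by rewrite /=; lia.
    apply: (exec_seq ex1); apply: (exec_seq ex2).
    apply: (@exec_seq _ _ _ _ _ _ ms3); first by apply: exec_const; lia.
    apply: (@exec_seq _ _ _ _ _ _ ms4).
      have := @exec_op w m Mul (tmp d.+2) (tmp d.+2) (tmp 0) ms3.
      rewrite /= upd_same /upd regE /= h2; apply; nia.
    apply: (@exec_seq _ _ _ _ _ _ ms5).
      have := @exec_op w m Add (tmp d) (tmp d) (tmp d.+2) ms4.
      by reg_simpl; rewrite f2 // v1 addnC; apply; lia.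
    have := @exec_store w m (tmp d) (tmp d.+1) ms5.
    by reg_simpl; rewrite v2; apply; lia.
  + case: S5 => g1 g2 g3 g4 g5; split=> // r' i r'R iZ /=; rewrite /upd.
    case: eqP => [eqa|neqa].
      (* Both indices are below the stride, so equal addresses have equal quotients by Z: distinct
         arrays do not overlap. *)
      have r'r : r' = r.
        have Z0 : 0 < Z by exact: leq_ltn_trans iZ.
        move: (congr1 (divn^~ Z) eqa).
        by rewrite !divnMDl // (divn_small iZ) (divn_small ltZ) !addn0.
      move: eqa; rewrite r'r => /eqP; rewrite eqn_add2l => /eqP ->.
      by rewrite !eqxx.
    case: (eqVneq r' r) => [r'r|_]; last by rewrite -g5.
    have -> : (i == eval e1 s) = false.
      by apply/eqP => ie; apply: neqa; rewrite r'r ie.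
    by rewrite -r'r -g5.
  + apply: (frame_trans f1); apply: frame_trans (frame_le (leqnSn d) f2) _.
    by move=> k kd; reg_simpl.
- case/andP: wc => wc1 wc2; case: sf => sf1 sf2.
  have [ms1 [ex1 S1 f1]] := IH1 _ _ _ _ d3 S b wc1 sf1.
  have [ms2 [ex2 S2 f2]] := IH2 _ _ _ _ d3 S1 (run_bnd b sf1) wc2 sf2.
  exists ms2; split=> //; last exact: frame_trans f2.
  exact: exec_seq ex2.
case/and3P: wc => xn gn wc.
set st := fun i s' => run c (setv s' x i).
pose J i (ms' : state) := sim Z R (iteri i st s) ms' /\ frame d ms ms'.
have bi i : i <= vars s g -> bnd W (iteri i st s).
  elim: i => [//|i IHi] ig; rewrite iteriS; apply: run_bnd; last exact: sf.
  apply: bnd_setv; first by apply: IHi; exact: ltnW.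
  by apply: ltn_trans ig _; exact: b.1.
have pres i y : y < nbounds -> vars (iteri i st s) y = vars s y.
  move=> yn; elim: i => [//|i IHi]; rewrite iteriS run_vars ?(wf_wvar wc) //=.
  rewrite upd_other ?IHi //; apply/eqP => yx; move: yn xn; rewrite yx; lia.
have [||||||ms3 [ex3 [S3 f3]]] := @loopP d x g (compile d.+3 c) J (vars s g)
    (cost c s) ms d3.
- exact: b.1.
- by have [-> //] := S.
- by move=> i ms' [[]].
- move=> i ms' k v [S' f'] kd; split; first by apply: simx_tmp S'; lia.
  by apply: (frame_trans f'); apply: frame_tmp; lia.
- move=> i ms' ig [S' f'].
  have Sx : sim Z R (setv (iteri i st s) x i) (set_reg ms' (var x) i).
    by apply: simx_var; exact: simx_sub.
  have [|||ms3 [ex3 S3 f3]] := IH d.+3 _ _ _ _ Sx _ wc; first by lia.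
  + apply: bnd_setv; first by apply: bi; exact: ltnW.
    by apply: ltn_trans ig _; exact: b.1.
  + exact: sf.
  have fd k : k < d.+3 -> regs ms3 (tmp k) = regs ms' (tmp k).
    by move=> kd; rewrite f3 // /= upd_other // regE.
  exists ms3; split.
  + rewrite (_ : cost c s = cost c (setv (iteri i st s) x i)) //.
    apply: cost_ext wc _ => y yn /=; rewrite upd_other ?pres //.
    by apply/eqP => yx; move: yn xn; rewrite yx; lia.
  + split=> //; apply: (frame_trans f') => k kd; apply: fd; lia.
  + by apply: fd; lia.
  + by apply: fd; lia.
- by [].
by exists ms3; split.
Qed.

End Simulation.

(** * Specifications of programs *)

(** Truncated subtraction makes 1 - (1 - x) the indicator of x > 0, so a comparison takes no
    branch. *)
Definition ELt (e1 e2 : expr) : expr :=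
  EBin Defs.Sub (ENum 1) (EBin Defs.Sub (ENum 1) (EBin Defs.Sub e2 e1)).

Definition EEq (e1 e2 : expr) : expr :=
  EBin Mul (EBin Defs.Sub (ENum 1) (EBin Defs.Sub e1 e2))
           (EBin Defs.Sub (ENum 1) (EBin Defs.Sub e2 e1)).

(** The second argument is evaluated even when the first is 0: a guard does not protect an array
    access behind it. *)
Definition ESel (e1 e2 : expr) : expr :=
  EBin Mul (ELt (ENum 0) e1) e2.

Definition EFlr (e1 e2 : expr) : expr := EBin Mul (EBin Div e1 e2) e2.

Lemma eval_Get r e s : eval (EGet r e) s = arrs s r (eval e s).
Proof. by []. Qed.

Lemma eval_Var x s : eval (EVar x) s = vars s x.
Proof. by []. Qed.

Lemma eval_Bin o e1 e2 s :
  eval (EBin o e1 e2) s = eval_binop o (eval e1 s) (eval e2 s).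
Proof. by []. Qed.

Lemma eval_Lt e1 e2 s : eval (ELt e1 e2) s = (eval e1 s < eval e2 s).
Proof. by rewrite /ELt [LHS]/=; case: ltnP => ?; lia. Qed.

Lemma eval_Eq e1 e2 s : eval (EEq e1 e2) s = (eval e1 s == eval e2 s).
Proof.
rewrite /EEq [LHS]/=; case: ltngtP => [h|h|->]; last by rewrite subnn.
  by rewrite [X in _ * (1 - X)](_ : _ = (eval e2 s - eval e1 s).-1.+1) ?muln0 //; lia.
by rewrite [X in (1 - X) * _](_ : _ = (eval e1 s - eval e2 s).-1.+1) ?mul0n //; lia.
Qed.

Lemma eval_Sel e1 e2 s : eval (ESel e1 e2) s = (0 < eval e1 s) * eval e2 s.
Proof. by rewrite -[X in _ = X * _](eval_Lt (ENum 0)). Qed.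

Lemma eval_Flr e1 e2 s : eval (EFlr e1 e2) s = eval e1 s %/ eval e2 s * eval e2 s.
Proof. by []. Qed.

Section SafeExpr.

Variables (W Z : nat) (s : pstate).
Hypotheses (W1 : 1 < W) (b : bnd W s).

Lemma esafe_Lt e1 e2 : esafe W Z e1 s -> esafe W Z e2 s -> esafe W Z (ELt e1 e2) s.
Proof. by []. Qed.

Lemma esafe_Eq e1 e2 : esafe W Z e1 s -> esafe W Z e2 s -> esafe W Z (EEq e1 e2) s.
Proof.
move=> h1 h2; split=> //.
rewrite -[X in X < W]/(eval (EEq e1 e2) s) eval_Eq.
by apply: leq_ltn_trans W1; case: eqP.
Qed.

Lemma esafe_Sel e1 e2 : esafe W Z e1 s -> esafe W Z e2 s -> esafe W Z (ESel e1 e2) s.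
Proof.
move=> h1 h2; split=> //; first by apply: esafe_Lt => //=; lia.
rewrite -[X in X < W]/(eval (ESel e1 e2) s) eval_Sel.
by case: (0 < _); rewrite ?mul0n ?mul1n; [exact: eval_lt h2|lia].
Qed.

Lemma esafe_Flr e1 e2 : esafe W Z e1 s -> esafe W Z e2 s -> esafe W Z (EFlr e1 e2) s.
Proof.
move=> h1 h2; split=> //; apply: leq_ltn_trans (eval_lt b h1).
exact: leq_trunc_div.
Qed.

End SafeExpr.

Arguments ELt : simpl never.
Arguments EEq : simpl never.
Arguments ESel : simpl never.
Arguments EFlr : simpl never.

(** * Total-correctness triples for the loop language *)

Definition frame_of (c : prog) (s s' : pstate) : Prop :=
  (forall x, ~~ wvar c x -> vars s' x = vars s x) /\
  (forall r, ~~ warr c r -> arrs s' r = arrs s r).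

Lemma frame_run c s : frame_of c s (run c s).
Proof. by split=> [x|r]; [exact: run_vars|exact: run_arrs]. Qed.

(** The initial state is a parameter, so postconditions can refer to initial values directly.
    Boundedness is a premise because every safe run preserves it. *)
Definition triple (W Z : nat) (c : prog) (s : pstate) (Q : pstate -> Prop) :=
  bnd W s -> safe W Z c s /\ Q (run c s).

Section Triples.

Variables (W Z : nat).
Local Notation triple := (triple W Z).

(** The syntactic frame comes for free, so specifications only mention what a program changes. *)
Lemma triple_weaken c s (Q Q' : pstate -> Prop) :
  triple c s Q' -> (forall s', Q' s' -> frame_of c s s' -> Q s') -> triple c s Q.
Proof.
move=> h hQ b; have [sf q] := h b.
by split=> //; apply: hQ => //; exact: frame_run.
Qed.

Lemma triple_step c1 c2 s Q :
  triple c1 s (fun s1 => triple c2 s1 Q) -> triple (PSeq c1 c2) s Q.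
Proof. by move=> h b; have [sf1 /(_ (run_bnd b sf1)) [sf2 q]] := h b. Qed.

Lemma triple_seq c1 c2 s Q1 Q :
  triple c1 s Q1 ->
  (forall s1, Q1 s1 -> frame_of c1 s s1 -> triple c2 s1 Q) ->
  triple (PSeq c1 c2) s Q.
Proof. by move=> h1 h2; apply: triple_step; apply: triple_weaken h1 h2. Qed.

Lemma triple_set x e s (Q : pstate -> Prop) :
  (bnd W s -> esafe W Z e s) -> Q (setv s x (eval e s)) -> triple (PSet x e) s Q.
Proof. by move=> sf q b; split=> //; exact: sf. Qed.

Lemma triple_put r e1 e2 s (Q : pstate -> Prop) :
  (bnd W s -> [/\ esafe W Z e1 s, esafe W Z e2 s & eval e1 s < Z]) ->
  Q (seta s r (eval e1 s) (eval e2 s)) -> triple (PPut r e1 e2) s Q.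
Proof. by move=> sf q b; split=> //; exact: sf. Qed.

Lemma triple_for x g c s (P : nat -> pstate -> Prop) N :
    vars s g = N -> P 0 s ->
    (forall i s1, i < N -> P i s1 -> frame_of (PFor x g c) s s1 ->
       triple c (setv s1 x i) (P i.+1)) ->
  triple (PFor x g c) s (P N).
Proof.
move=> gN P0 step b; rewrite /= gN.
set st := fun i s' => run c (setv s' x i).
have NW : N < W by rewrite -gN; exact: b.1.
have fr k : frame_of (PFor x g c) s (iteri k st s).
  split=> [y|r] /=; elim: k => [//|k IHk]; rewrite iteriS.
    rewrite negb_or => /andP[xy wy].
    by rewrite run_vars //= upd_other ?IHk ?negb_or ?xy // eq_sym.
  by move=> wr; rewrite run_arrs //= IHk.
have main k : k <= N -> [/\ P k (iteri k st s), bnd W (iteri k st s) &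
    forall i, i < k -> safe W Z c (setv (iteri i st s) x i)].
  elim: k => [//|k IHk] kN; have [Pk bk sk] := IHk (ltnW kN).
  have bk' : bnd W (setv (iteri k st s) x k).
    by apply: bnd_setv => //; exact: ltn_trans NW.
  have [sf Pk'] := step k _ kN Pk (fr k) bk'.
  split=> //; first by rewrite iteriS; exact: run_bnd sf.
  by move=> i; rewrite ltnS leq_eqVlt => /predU1P[->//|]; exact: sk.
by have [PN _ sf] := main N (leqnn N).
Qed.

End Triples.

(** * Finite sums over permuted ranges and over strips *)

Lemma sum_reindex n (z ix : nat -> nat) :
  (forall v, v < n -> z v < n /\ ix (z v) = v) ->
  forall F : nat -> nat, \sum_(v < n) F (z v) = \sum_(y < n) F y.
Proof.
case: n => [|n] zP F; first by rewrite !big_ord0.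
have inj : injective (fun v : 'I_n.+1 => inord (z v) : 'I_n.+1).
  move=> v v' /(congr1 val); rewrite /= !inordK; last 2 first.
  - exact: (zP _ (ltn_ord v')).1.
  - exact: (zP _ (ltn_ord v)).1.
  move=> e; apply: val_inj; rewrite /= -(zP _ (ltn_ord v)).2 e.
  exact: (zP _ (ltn_ord v')).2.
rewrite [RHS](reindex_inj inj); apply: eq_bigr => v _.
by rewrite inordK //; exact: (zP _ (ltn_ord v)).1.
Qed.

Lemma sum_below n v (F : nat -> nat) : v <= n ->
  \sum_(i < v) F i = \sum_(i < n) (i < v) * F i.
Proof.
move=> vn; rewrite (big_ord_widen n F vn) big_mkcond.
by apply: eq_bigr => i _; case: (i < v); rewrite ?mul1n.
Qed.

Lemma sum_pick n x (F : nat -> nat) : x < n ->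
  \sum_(i < n) (i == x :> nat) * F i = F x.
Proof.
move=> xn; rewrite (bigD1 (Ordinal xn)) //= eqxx mul1n big1 ?addn0 // => i.
by rewrite -val_eqE /= => /negbTE ->.
Qed.

Lemma sum_strip n t a (F : nat -> nat) : 0 < t ->
  \sum_(j < t) (a * t + j < n) * F (a * t + j) = \sum_(y < n) (y %/ t == a) * F y.
Proof.
(* M is large enough for both n and the end (a + 1) t of the strip, so the extended range splits
   into what precedes the strip, the strip, and the rest. *)
move=> t0; pose M := n + a.+1 * t.
have -> : \sum_(y < n) (y %/ t == a) * F y =
    \sum_(y < M) (y < n) * ((y %/ t == a) * F y).
  by apply: (@sum_below M n (fun y => (y %/ t == a) * F y)); exact: leq_addr.
have M1 : M = a * t + (t + n) by rewrite /M mulSn; lia.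
rewrite M1 big_split_ord /= [X in _ = X + _]big1 ?add0n; last first.
  move=> [i /= it] _; rewrite (_ : (i %/ t == a) = false) ?mul0n ?muln0 //.
  by apply/negbTE; rewrite neq_ltn ltn_divLR // it.
rewrite big_split_ord /= [X in _ = _ + X]big1 ?addn0; last first.
  move=> i _; rewrite (_ : (_ %/ t == a) = false) ?mul0n ?muln0 //.
  apply/negbTE; rewrite neq_ltn; apply/orP; right.
  by rewrite leq_divRL // mulSn; lia.
apply: eq_bigr => j _; rewrite divnMDl // divn_small // addn0 eqxx mul1n //.
Qed.

Definition dlt (up : bool) (a b : nat) : bool := if up then a < b else b < a.

Definition EDlt (up : bool) (e1 e2 : expr) : expr :=
  if up then ELt e1 e2 else ELt e2 e1.

Lemma eval_Dlt up e1 e2 s : eval (EDlt up e1 e2) s = dlt up (eval e1 s) (eval e2 s).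
Proof. by case: up; rewrite /EDlt eval_Lt. Qed.

Lemma esafe_Dlt W Z s up e1 e2 : 1 < W ->
  esafe W Z e1 s -> esafe W Z e2 s -> esafe W Z (EDlt up e1 e2) s.
Proof. by move=> W1 h1 h2; case: up; apply: esafe_Lt. Qed.

Ltac esafe_tac :=
  repeat match goal with
  | H : esafe ?W ?Z ?e ?s |- esafe ?W ?Z ?e ?s => exact: H
  | |- esafe _ _ (ESel _ _) _ => apply: esafe_Sel
  | |- esafe _ _ (ELt _ _) _ => apply: esafe_Lt
  | |- esafe _ _ (EEq _ _) _ => apply: esafe_Eq
  | |- esafe _ _ (EDlt _ _ _) _ => apply: esafe_Dlt
  | |- esafe _ _ (EFlr _ _) _ => apply: esafe_Flr
  | |- esafe _ _ (EGet _ _) _ => split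
  | |- esafe _ _ (EVar _) _ => exact: I
  | |- esafe _ _ (EBin Div _ _) _ => split
  | |- esafe _ _ (EBin Defs.Sub _ _) _ => split
  | |- True => exact: I
  | |- bnd _ _ => assumption
  | H : is_true (1 < ?W) |- is_true (1 < ?W) => exact: H
  end.

Definition evalE := (eval_Lt, eval_Eq, eval_Sel, eval_Flr, eval_Dlt, lt0b,
  eval_Get, eval_Var).

(* Running sums along an order, restarted whenever the strip number [g]
   changes: the strips met earlier never come back. *)
Lemma strip_sum_step n (g h : nat -> nat) v :
    (forall i j k, i <= j <= k -> k < n -> g i = g k -> g j = g k) -> v.+1 < n ->
  \sum_(i < v.+1) (g i == g v.+1) * h i =
  (g v.+1 == g v) * (\sum_(i < v) (g i == g v) * h i + h v).
Proof.
move=> mono vn; rewrite big_ord_recr /= eq_sym.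
case: eqP => [->|ne]; first by rewrite !mul1n.
rewrite !mul0n addn0 big1 // => i _; case: eqP => [e|_]; last by rewrite mul0n.
case: ne; symmetry; apply: (mono i v v.+1) => //.
by rewrite (ltnW (ltn_ord i)) leqnSn.
Qed.

(* Variable 0 holds n, 1 the strip size and 2 the number of strips.  The arrays
   [aP], [aQ], [aI], [aOne] hold p, its inverse, the identity and ones. *)
Notation vacc := 3 (only parsing).
Notation vv := 4 (only parsing).
Notation vu := 5 (only parsing).
Notation vcur := 6 (only parsing).
Notation vprev := 7 (only parsing).
Notation vy := 8 (only parsing).
Notation vx := 9 (only parsing).
Notation vk := 10 (only parsing).
Notation vj := 11 (only parsing).
Notation vi := 12 (only parsing).
Notation vres := 13 (only parsing).
Notation vpos := 14 (only parsing).
Notation vneg := 15 (only parsing).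
Notation va := 16 (only parsing).

Notation aP := 0 (only parsing).
Notation aQ := 1 (only parsing).
Notation aI := 2 (only parsing).
Notation aOne := 3 (only parsing).
Notation aS := 4 (only parsing).
Notation aT := 5 (only parsing).
Notation aF1 := 6 (only parsing).
Notation aF2 := 7 (only parsing).
Notation aF3 := 8 (only parsing).
Notation aC := 9 (only parsing).
Notation aD := 10 (only parsing).
Notation narrs := 11 (only parsing).

Notation EAdd := (EBin Add).
Notation ESub := (EBin Defs.Sub).
Notation EMul := (EBin Mul).
Notation EDiv := (EBin Div).
Notation "c1 ;; c2" := (PSeq c1 c2) (at level 80, right associativity).

(** * Prefix sums within strips *)

Definition fill (dst : nat) (e : expr) : prog :=
  PFor vx 0 (PPut dst (EVar vx) e).

(** One pass gives each point the sum of [src] over the points visited earlier in its strip. The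
    strip length is the value of variable [t]: variable 1 gives genuine strips, while variable 0,
    which holds n, gives a single strip and hence plain prefix sums. *)
Definition scan (o : nat) (up : bool) (t src dst : nat) : prog :=
  PSet vacc (ENum 0) ;;
  PFor vv 0
    (PSet vu (if up then EVar vv else ESub (ESub (EVar 0) (ENum 1)) (EVar vv)) ;;
     PSet vcur (EDiv (EVar vu) (EVar t)) ;;
     PSet vacc (ESel (EEq (EVar vcur) (EVar vprev)) (EVar vacc)) ;;
     PSet vprev (EVar vcur) ;;
     PSet vy (EGet o (EVar vu)) ;;
     PPut dst (EVar vy) (EVar vacc) ;;
     PSet vacc (EAdd (EVar vacc) (EGet src (EVar vy)))).

Section Scans.

Variables (W n S K : nat) (p q : nat -> nat).
Local Notation Z := (n.*2.+2).
Local Notation triple := (triple W Z).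
Local Notation bnd := (bnd W).
Local Notation esafe := (esafe W Z).

Hypothesis (W1 : 1 < W).

Record env (s : pstate) : Prop := Env {
  env_n : vars s 0 = n;
  env_S : vars s 1 = S;
  env_K : vars s 2 = K;
  env_p : forall i, arrs s aP i = p i;
  env_q : forall i, arrs s aQ i = q i;
  env_I : forall i, i < n -> arrs s aI i = i;
  env_1 : forall i, i < n -> arrs s aOne i = 1 }.

Definition keeps (c : prog) : bool :=
  ~~ [|| wvar c 0, wvar c 1, wvar c 2, warr c aP, warr c aQ, warr c aI | warr c aOne].

Lemma env_frame c s s' : keeps c -> env s -> frame_of c s s' -> env s'.
Proof.
rewrite /keeps !negb_or => /and5P[k0 k1 k2 kP /and3P[kQ kI k1']].
case=> e0 e1 e2 eP eQ eI e1' [fv fa].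
by split; rewrite ?fv ?fa.
Qed.

Lemma fillP dst e (F : nat -> nat) s :
    vars s 0 = n ->
    (forall i s', i < n -> vars s' vx = i -> bnd s' ->
       frame_of (fill dst e) s s' -> arrs s' dst i = arrs s dst i ->
       esafe e s' /\ eval e s' = F i) ->
  triple (fill dst e) s (fun s' => forall i, i < n -> arrs s' dst i = F i).
Proof.
move=> s0 eP.
pose P k s' := (forall i, i < k -> arrs s' dst i = F i) /\
               (forall i, k <= i -> arrs s' dst i = arrs s dst i).
apply: (@triple_weaken _ _ _ _ _ (P n)); last by move=> s' [h _] _.
apply: triple_for => // i s1 iN [h1 h2] fr.
have fr' : frame_of (fill dst e) s (setv s1 vx i).
  case: fr => fv fa; split=> // y wy /=; rewrite upd_other ?fv //.
  by move: wy; rewrite /= orbF eq_sym.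
have get : bnd (setv s1 vx i) -> esafe e (setv s1 vx i) /\ eval e (setv s1 vx i) = F i.
  by move=> b; apply: eP => //=; rewrite ?upd_same ?h2.
move=> b; have [sf ev] := get b; move: b.
apply: triple_put.
  by move=> b; split=> //=; rewrite upd_same; lia.
rewrite ev; split=> j; rewrite /= eqxx upd_same /upd.
  by rewrite ltnS leq_eqVlt; case: eqP => [->//|_] /=; exact: h1.
by case: eqP => [->|_ /ltnW]; [rewrite ltnn|exact: h2].
Qed.

Lemma scanP (o : nat) up (t src dst : nat) (rk f : nat -> nat) s :
    vars s 0 = n -> t < nbounds -> src != dst -> o != dst ->
    (forall v, v < n -> arrs s o v < n /\ rk (arrs s o v) = v) ->
    (forall x, x < n -> rk x < n /\ arrs s o (rk x) = x) ->
    (forall y, y < n -> arrs s src y = f y) -> \sum_(y < n) f y < W ->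
  triple (scan o up t src dst) s (fun s' => forall x, x < n -> arrs s' dst x =
    \sum_(y < n) (dlt up (rk y) (rk x) &&
                  (rk y %/ vars s t == rk x %/ vars s t)) * f y).
Proof.
move=> s0 tn sd od oP rkP srcP fW.
(* [u v] is the rank visited at time v; it is its own inverse, so a downward pass is an upward one
   with ranks reversed. [B v] below is what the accumulator must hold on arrival at the point
   [z v]. *)
pose u v := if up then v else n - 1 - v.
have uu v : v < n -> u (u v) = v by rewrite /u; case: (up); lia.
have un v : v < n -> u v < n by rewrite /u; case: (up); lia.
pose g v := u v %/ vars s t.
pose z v := arrs s o (u v).
pose B v := \sum_(i < v) (g i == g v) * f (z i).
pose ix x := u (rk x).
have zP v : v < n -> z v < n /\ ix (z v) = v.
  by move=> vn; have [] := oP (u v) (un v vn); rewrite /ix => ? ->; rewrite uu.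
have zix x : x < n -> ix x < n /\ z (ix x) = x.
  by move=> xn; have [h1 h2] := rkP x xn; rewrite /ix /z uu // un.
have mono i j k : i <= j <= k -> k < n -> g i = g k -> g j = g k.
  move=> /andP[ij jk] kn e; apply/eqP; rewrite eqn_leq; move: e; rewrite /g /u.
  case: (up) => e; apply/andP; split.
  - exact: leq_div2r.
  - by rewrite -e; exact: leq_div2r.
  - by rewrite -e; apply: leq_div2r; lia.
  - by apply: leq_div2r; lia.
have BW v : v < n -> B v + f (z v) < W.
  move=> vn; apply: leq_ltn_trans fW; rewrite -(sum_reindex zP).
  apply: leq_trans (@leq_sum_ord (fun v => f (z v)) v.+1 n vn).
  rewrite big_ord_recr leq_add2r /=; apply: leq_sum => i _.
  by case: eqP; rewrite ?mul1n.
(* Before the first round [vprev] is arbitrary; as the accumulator is 0, the outcome of the strip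
   comparison is then immaterial. *)
pose P v s1 := [/\ v = 0 -> vars s1 vacc = 0,
  forall v0, v = v0.+1 -> vars s1 vprev = g v0 /\ vars s1 vacc = B v0 + f (z v0) &
  forall i, i < v -> arrs s1 dst (z i) = B i].
apply: triple_step; apply: triple_set; first by move=> _ /=; lia.
apply: (@triple_weaken _ _ _ _ _ (P n)); last first.
  move=> s' [_ _ h] _ x xn; have [ixn zx] := zix x xn.
  rewrite -{1}zx h // /B.
  rewrite (@sum_below n (ix x) (fun i => (g i == g (ix x)) * f (z i)) (ltnW ixn)).
  rewrite -(sum_reindex zP (fun y => (dlt up (rk y) (rk x) &&
    (rk y %/ vars s t == rk x %/ vars s t)) * f y)).
  apply: eq_bigr => v _; have [h1 h2] := zP v (ltn_ord v).
  have rkz : rk (z v) = u v by have [] := oP (u v) (un v (ltn_ord v)).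
  rewrite mulnA mulnb rkz; congr (_ && _ * _).
    rewrite /ix -{1}(uu v) //; have [rn _] := rkP x xn.
    have := un v (ltn_ord v); rewrite /u /dlt; case: (up) => //=; lia.
  by rewrite /g /ix uu //; have [] := rkP x xn.
apply: triple_for; [exact: s0|by split|].
move=> v s1 vn [h0 hS hB] [fv fa].
have src1 : arrs s1 src = arrs s src by apply: fa; rewrite /= orbF eq_sym.
have o1 : arrs s1 o = arrs s o by apply: fa; rewrite /= orbF eq_sym.
have t1 : vars s1 t = vars s t by rewrite fv; case: (t) tn => [|[|[|]]].
have n1 : vars s1 0 = n by rewrite fv.
have acc : (g v == vars s1 vprev) * vars s1 vacc = B v.
  case: (v) vn h0 hS => [|v0] vn h0 hS; first by rewrite h0 // muln0 /B big_ord0.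
  by have [-> ->] := hS v0 erefl; rewrite /B (@strip_sum_step n g (fun i => f (z i))).
have eu : eval (if up then EVar vv else ESub (ESub (EVar 0) (ENum 1)) (EVar vv))
    (setv s1 vv v) = u v.
  by rewrite /u; case: (up); rewrite /= /upd //= n1.
apply: triple_step; apply: triple_set; first by case: (up) => //= _; split=> //; lia.
rewrite eu.
apply: triple_step; apply: triple_set; first by [].
have -> : eval (EDiv (EVar vu) (EVar t)) (setv (setv s1 vv v) vu (u v)) = g v.
  by move: tn; rewrite /nbounds => tn; reg_simpl; rewrite t1.
apply: triple_step; apply: triple_set.
  by move=> b; apply: esafe_Sel => //; apply: esafe_Eq.
set e := ESel _ _; set st := setv _ vcur _.
have -> : eval e st = B v by rewrite /e !evalE -acc.
apply: triple_step; apply: triple_set; first by [].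
apply: triple_step; apply: triple_set.
  by move=> b /=; split=> //; rewrite /upd /=; have := un v vn; lia.
set st1 := setv _ vprev _.
have -> : eval (EGet o (EVar vu)) st1 = z v by rewrite /= o1.
apply: triple_step; apply: triple_put.
  by move=> b; split=> //=; rewrite /upd /=; have [] := zP v vn; lia.
set st2 := seta _ _ _ _.
have ad : eval (EAdd (EVar vacc) (EGet src (EVar vy))) st2 = B v + f (z v).
  rewrite /= (negbTE sd) src1 srcP /upd //=; exact: (zP v vn).1.
apply: triple_set.
  move=> b; split; [by []| |by have := BW v vn; rewrite -ad].
  by split=> //=; rewrite /upd /=; have [] := zP v vn; lia.
rewrite ad; split=> //.
  by move=> v0 [<-].
move=> i; rewrite /= eqxx /upd /= => iv; case: eqP => [e1|ne].
  have : ix (z i) = ix (z v) by rewrite e1.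
  by have [_ ->] := zP v vn; have [_ ->] := zP i (leq_trans iv vn) => ->.
by apply: hB; move: iv; rewrite ltnS leq_eqVlt => /predU1P[iv|//]; rewrite iv in ne.
Qed.

End Scans.

(** * Quadrant sums *)

Definition strip_elt : expr := EAdd (EFlr (EVar vx) (EVar 1)) (EVar vj).

(* The points of the strip of [x] are tried one by one; those of the other
   strips are collected by one scan per strip. *)
Definition quad (bp bv : bool) (f dst : nat) : prog :=
  fill dst (ESum vj 1
    (ESel (ELt strip_elt (EVar 0)) (ESel (EDlt bp strip_elt (EVar vx))
      (ESel (EDlt bv (EGet aP strip_elt) (EGet aP (EVar vx))) (EGet f strip_elt))))) ;;
  PFor vk 2
    (fill aS (ESel (EDlt bp (EDiv (EVar vx) (EVar 1)) (EVar vk)) (EGet f (EVar vx))) ;;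
     scan aQ bv 0 aS aT ;;
     fill dst (EAdd (EGet dst (EVar vx))
       (ESel (EEq (EDiv (EVar vx) (EVar 1)) (EVar vk)) (EGet aT (EVar vx))))).

(** Division is monotone, so points of different strips compare as their strips do; points of one
    strip are left to the second summand. *)
Lemma dlt_strip bp t y x :
  dlt bp y x = dlt bp (y %/ t) (x %/ t) + ((y %/ t == x %/ t) && dlt bp y x) :> nat.
Proof.
have m a b : a %/ t < b %/ t -> a < b.
  by move=> h; rewrite ltnNge; apply/negP => /(leq_div2r t); rewrite leqNgt h.
rewrite /dlt; case: bp; case: (ltngtP (y %/ t) (x %/ t)) => h.
- by rewrite (m _ _ h).
- by rewrite ltnNge (ltnW (m _ _ h)).
- by rewrite add0n.
- by rewrite ltnNge (ltnW (m _ _ h)).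
- by rewrite (m _ _ h).
by rewrite add0n.
Qed.

Lemma sum_boolM n (b : nat -> bool) (F : nat -> nat) :
  \sum_(y < n) b y * F y <= \sum_(y < n) F y.
Proof. by apply: leq_sum => y _; case: (b y); rewrite ?mul1n. Qed.

(** Guards do not prevent evaluation, so lookups must be legal for candidates past the last point
    too. A strip starts at or before x < n and has length at most n + 1, which is why arrays get 2n
    + 2 cells. *)
Lemma flr_lt n t x j : t <= n.+1 -> x < n -> j < t -> x %/ t * t + j < n.*2.+2.
Proof. by move=> tn xn jt; have := leq_trunc_div x t; lia. Qed.

Lemma env_setv n t K p q s x v :
  nbounds <= x -> env n t K p q s -> env n t K p q (setv s x v).
Proof.
move=> xn [e0 e1 e2 eP eQ eI e1']; split=> //=; rewrite upd_other //;
  by move: xn; rewrite /nbounds; lia.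
Qed.

Section QuadrantSums.

Variables (W n S K : nat) (p q : nat -> nat).
Local Notation Z := (n.*2.+2).
Local Notation triple := (triple W Z).
Local Notation bnd := (bnd W).
Local Notation esafe := (esafe W Z).
Local Notation env := (env n S K p q).

Hypothesis (nW : 4096 * n.+1 ^ 6 <= W).
Hypothesis (S_gt0 : 0 < S).
Hypothesis (S_le : S <= n.+1).
Hypothesis (KE : K = (n %/ S).+1).
Hypothesis (p_lt : forall i, i < n -> p i < n).
Hypothesis (q_lt : forall i, i < n -> q i < n).
Hypothesis (pK : forall i, i < n -> q (p i) = i).
Hypothesis (qK : forall i, i < n -> p (q i) = i).
Hypothesis (p_out : forall i, n <= i -> p i = 0).
Hypothesis (q_out : forall i, n <= i -> q i = 0).

Let W1 : 1 < W.
Proof. by apply: leq_trans nW; rewrite (@leq_mul 2 1) // expn_gt0. Qed.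

Let n2W : n.*2.+2 < W.
Proof.
apply: leq_trans nW; have : n.+1 <= n.+1 ^ 6 by rewrite -{1}[n.+1]expn1 leq_pexp2l.
lia.
Qed.

Lemma strip_eltP s x j : env s -> vars s vx = x -> vars s vj = j -> x < n -> j < S ->
  bnd s -> esafe strip_elt s /\ eval strip_elt s = x %/ S * S + j.
Proof.
move=> [_ e1 _ _ _ _ _] sx sj xn jS b.
have ev : eval strip_elt s = x %/ S * S + j by rewrite /= sx sj e1.
split=> //; split=> //; first by apply: esafe_Flr.
have : eval strip_elt s < W by rewrite ev; have := flr_lt S_le xn jS; lia.
by [].
Qed.

Lemma quadP bp bv (f dst : nat) (F : nat -> nat) s :
    env s -> 5 < dst -> f != dst -> f != aS -> f != aT ->
    (forall y, y < n -> arrs s f y = F y) -> \sum_(y < n) F y < W ->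
  triple (quad bp bv f dst) s (fun s' => forall x, x < n ->
    arrs s' dst x = \sum_(y < n) (dlt bp y x && dlt bv (p y) (p x)) * F y).
Proof.
move=> es d5 fd fS fT fP FW.
have dS : dst != aS by lia.
have dT : dst != aT by lia.
have keep_d e : keeps (fill dst e) by rewrite /keeps /=; lia.
(* The sum splits by whether y shares the strip of x. In [far] the positions enter through their
   strip numbers only, so one scan by value serves all x of a strip. *)
pose near x := \sum_(y < n) (y %/ S == x %/ S) *
  ((dlt bp y x && dlt bv (p y) (p x)) * F y).
pose far x := \sum_(y < n) (dlt bp (y %/ S) (x %/ S) && dlt bv (p y) (p x)) * F y.
have tot x : near x + far x = \sum_(y < n) (dlt bp y x && dlt bv (p y) (p x)) * F y.
  rewrite -big_split; apply: eq_bigr => y _ /=; rewrite -!mulnb !mulnA -!mulnDl.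
  by rewrite [in RHS](dlt_strip bp S) -mulnb addnC.
have totW x : near x + far x < W.
  rewrite tot; apply: leq_ltn_trans FW.
  exact: (@sum_boolM n (fun y => dlt bp y x && dlt bv (p y) (p x))).
apply: triple_seq.
  apply: (@fillP W n W1 _ _ near); first exact: env_n es.
  move=> x s' xn sx b fr _.
  have es' := env_frame (keep_d _) es fr.
  have f' : arrs s' f = arrs s f by apply: fr.2; rewrite /= eq_sym.
  set e := ESel _ _.
  have eP j : j < S -> esafe e (setv s' vj j) /\
      eval e (setv s' vj j) = (x %/ S * S + j < n) *
      ((dlt bp (x %/ S * S + j) x && dlt bv (p (x %/ S * S + j)) (p x)) *
        F (x %/ S * S + j)).
    move=> jS; set s2 := setv s' vj j.
    have b2 : bnd s2 by apply: bnd_setv => //; lia.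
    have es2 : env s2 by apply: env_setv.
    have [sf ev] := @strip_eltP s2 x j es2 sx erefl xn jS b2.
    have Zlt := flr_lt S_le xn jS.
    split.
      rewrite /e; esafe_tac; rewrite ?ev //.
      by rewrite -[eval _ _]/(vars s' vx) sx; lia.
    rewrite /e !evalE ev !(env_p es2) -[vars s2 vx]/(vars s' vx) sx (env_n es2).
    rewrite -[arrs s2 f]/(arrs s' f) f' -mulnb -!mulnA.
    by case: ltnP => // h; rewrite fP.
  have S' : vars s' 1 = S by exact: env_S es'.
  have sumE : \sum_(i < vars s' 1) eval e (setv s' vj i) = near x.
    rewrite S' /near -(sum_strip _ _ (fun y => (dlt bp y x && dlt bv (p y) (p x)) * F y)) //.
    by apply: eq_bigr => j _; have [_ ->] := eP j (ltn_ord j).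
  split; last exact: sumE.
  split; last by rewrite sumE; apply: leq_ltn_trans (totW x); exact: leq_addr.
  by move=> j; rewrite S' => /eP [].
move=> s1 near1 fr1; have es1 := env_frame (keep_d _) es fr1.
have f1 : arrs s1 f = arrs s f by apply: fr1.2; rewrite /= eq_sym.
(* Round k completes the points of strip k and leaves all others alone. *)
pose P k s2 := forall x, x < n -> arrs s2 dst x = near x + (x %/ S < k) * far x.
apply: (@triple_weaken _ _ _ _ _ (P K)); last first.
  move=> s2 h _ x xn; rewrite h // -tot KE ltnS.
  by rewrite leq_div2r ?mul1n // ltnW.
apply: triple_for.
- exact: env_K es1.
- by move=> x xn; rewrite near1 // mul0n addn0.
move=> k s2 kK h2 fr2; have fr2a := fr2.2.
have es2 : env s2 by apply: env_frame es1 fr2; rewrite /keeps /=; lia.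
have f2 : arrs s2 f = arrs s f.
  by rewrite -f1; apply: fr2a; rewrite /= !negb_or !andbT; lia.
set s3 := setv s2 vk k; have es3 : env s3 by apply: env_setv.
apply: triple_seq.
  apply: (@fillP W n W1 _ _ (fun y => dlt bp (y %/ S) k * F y)); first exact: env_n es3.
  move=> y s' yn sy b fr _.
  have es' : env s' by apply: env_frame es3 fr.
  have f' : arrs s' f = arrs s f by rewrite fr.2 //= eq_sym.
  have k' : vars s' vk = k by rewrite fr.1.
  split.
    by esafe_tac; rewrite /= sy; lia.
  by rewrite !evalE /= sy k' (env_S es') f' fP.
move=> s4 src4 fr4; have es4 : env s4 by apply: env_frame es3 fr4.
apply: triple_seq.
  apply: (@scanP W n W1 aQ bv 0 aS aT p (fun y => dlt bp (y %/ S) k * F y)) => //.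
  - exact: env_n es4.
  - by move=> v vn; rewrite !(env_q es4) qK // q_lt.
  - by move=> x xn; rewrite !(env_q es4) pK // p_lt.
  - apply: leq_ltn_trans FW.
    exact: (@sum_boolM n (fun y => dlt bp (y %/ S) k)).
move=> s5 tmp5 fr5; have es5 : env s5 by apply: env_frame es4 fr5.
have d5' : arrs s5 dst = arrs s2 dst.
  by rewrite fr5.2 ?fr4.2 //= ?orbF eq_sym.
apply: triple_weaken.
  apply: (@fillP W n W1 _ _ (fun x => near x + (x %/ S < k.+1) * far x));
    first exact: env_n es5.
  move=> x s' xn sx b fr dx.
  have es' : env s' by exact: env_frame (keep_d _) es5 fr.
  have k' : vars s' vk = k by rewrite fr.1 // fr5.1 // fr4.1.
  have T' : arrs s' aT = arrs s5 aT by rewrite fr.2 //= ; lia.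
  set e := EAdd _ _.
  have ev : eval e s' = near x + (x %/ S < k.+1) * far x.
    rewrite /e eval_Bin !evalE /= sx dx d5' h2 // k' (env_S es') -addnA; congr (_ + _).
    rewrite T' tmp5 // ltnS; case: (ltngtP (x %/ S) k) => // [|xk]; first by rewrite addn0.
    rewrite add0n !mul1n; apply: eq_bigr => y _.
    (* The scan took its strip length from variable 0, so all values lie in the one strip. *)
    rewrite (env_n es4) (divn_small (p_lt (ltn_ord y))) (divn_small (p_lt xn)).
    rewrite eqxx andbT mulnA mulnb xk.
    by rewrite andbC.
  split=> //; split.
  - by split=> //; rewrite /= sx; lia.
  - by esafe_tac; rewrite /= sx; lia.
  - have : eval e s' < W; last by [].
    rewrite ev; apply: leq_ltn_trans (totW x); rewrite leq_add2l.
    by case: (_ < _); rewrite ?mul1n.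
by move=> s6 h6 _ x xn; rewrite h6.
Qed.

End QuadrantSums.

(** * Counting cycles *)

Definition near (t x y : nat) : bool := (x < y) && (x %/ t == y %/ t).

(** Here the edge ab joins different strips of the coordinate [ra]. Fixing the strip k of b splits
    this edge into a condition on a and one on b, and the cycle opens into the path b, c, d, a: [aC]
    collects b at c, [aT] collects c at d, [aD] collects a at d. The parameters [t2], [t3], [t4]
    give the strip lengths for the edges cb, cd, ad; variable 0 leaves an edge unrestricted,
    variable 1 keeps it inside a strip. *)
Definition qfar (ra oa ob t2 t3 t4 : nat) : prog :=
  PFor vk 2
    (fill aS (EEq (EDiv (EGet ra (EVar vx)) (EVar 1)) (EVar vk)) ;;
     scan ob false t2 aS aC ;;
     fill aS (ELt (EDiv (EGet ra (EVar vx)) (EVar 1)) (EVar vk)) ;;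
     scan ob true t4 aS aD ;;
     scan oa true t3 aC aT ;;
     PSet vres (EAdd (EVar vres)
       (ESum vx 0 (EMul (EGet aT (EVar vx)) (EGet aD (EVar vx)))))).

(** The candidates for b share the position strip of a, and [near_v] runs through the value strip of
    b; c is the point with that value. Candidates past n or on the wrong side are not skipped but
    get weight 0 from [near_w]. *)
Definition near_b : expr := EAdd (EFlr (EVar va) (EVar 1)) (EVar vj).
Definition near_v : expr := EAdd (EFlr (EGet aP near_b) (EVar 1)) (EVar vi).
Definition near_w : expr :=
  ESel (ELt near_b (EVar 0)) (ESel (ELt (EVar va) near_b)
    (ESel (ELt near_v (EVar 0)) (ELt near_v (EGet aP near_b)))).

Definition scatter (o : binop) : prog :=
  PFor vj 1 (PFor vi 1
    (PPut aC (EGet aQ near_v) (EBin o (EGet aC (EGet aQ near_v)) near_w))).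

(** The other half of the cycle: the value of d is sought in the value strip of a, then c in the
    position strip of d. *)
Definition near_u : expr := EAdd (EFlr (EGet aP (EVar va)) (EVar 1)) (EVar vj).
Definition near_c : expr := EAdd (EFlr (EGet aQ near_u) (EVar 1)) (EVar vi).

Definition collect : expr :=
  ESum vj 1 (ESum vi 1 (ESel (ELt near_u (EVar 0))
    (ESel (ELt (EGet aP (EVar va)) near_u)
      (ESel (ELt near_c (EGet aQ near_u)) (EGet aC near_c))))).

(* For each [a], [aC] counts for every [c] the [b] that are near [a] and [c];
   the second scatter undoes the first, so that clearing is cheap. *)
Definition qnear : prog :=
  fill aC (ENum 0) ;;
  PFor va 0 (scatter Add ;; PSet vres (EAdd (EVar vres) collect) ;; scatter Defs.Sub).

(** Summing out k restores the edge that fixing the strip had cut: the only k with [B b == k] turns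
    [B a < k] into a comparison of two strips. *)
Lemma far_sum n K (B : nat -> nat) (n2 n3 n4 : nat -> nat -> nat) :
    (forall b, b < n -> B b < K) ->
  \sum_(k < K) \sum_(d < n)
    (\sum_(c < n) n3 c d * \sum_(b < n) n2 b c * (B b == k)) *
    (\sum_(a < n) n4 a d * (B a < k)) =
  \sum_(d < n) \sum_(c < n) \sum_(b < n) \sum_(a < n)
    n3 c d * n2 b c * n4 a d * (B a < B b).
Proof.
move=> BK; rewrite exchange_big /=; apply: eq_bigr => d _.
transitivity (\sum_(k < K) \sum_(c < n) \sum_(b < n) \sum_(a < n)
    n3 c d * n2 b c * n4 a d * ((k == B b :> nat) * (B a < k))).
  apply: eq_bigr => k _; rewrite big_distrl; apply: eq_bigr => c _ /=.
  rewrite [X in X * _]big_distrr big_distrl /=; apply: eq_bigr => b _.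
  rewrite big_distrr /=; apply: eq_bigr => a _.
  by rewrite [B b == k]eq_sym; lia.
rewrite exchange_big /=; apply: eq_bigr => c _.
rewrite exchange_big /=; apply: eq_bigr => b _.
rewrite exchange_big /=; apply: eq_bigr => a _.
rewrite -big_distrr /=; congr (_ * _).
by rewrite (@sum_pick K (B b) (fun k => B a < k)) // BK.
Qed.

Definition ordered (n : nat) (s : pstate) (o : nat) (rk : nat -> nat) : Prop :=
  (forall v, v < n -> arrs s o v < n /\ rk (arrs s o v) = v) /\
  (forall x, x < n -> rk x < n /\ arrs s o (rk x) = x).

Lemma ordered_ext n s s' o rk :
  arrs s' o = arrs s o -> ordered n s o rk -> ordered n s' o rk.
Proof. by rewrite /ordered => ->. Qed.

(** * Cycles with an edge between different strips *)

Section FarCycles.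

Variables (W n S K : nat) (p q : nat -> nat).
Local Notation Z := (n.*2.+2).
Local Notation triple := (triple W Z).
Local Notation bnd := (bnd W).
Local Notation esafe := (esafe W Z).
Local Notation env := (env n S K p q).

Hypothesis (nW : 4096 * n.+1 ^ 6 <= W).
Hypothesis (S_gt0 : 0 < S).
Hypothesis (S_le : S <= n.+1).
Hypothesis (KE : K = (n %/ S).+1).
Hypothesis (p_lt : forall i, i < n -> p i < n).
Hypothesis (q_lt : forall i, i < n -> q i < n).
Hypothesis (pK : forall i, i < n -> q (p i) = i).
Hypothesis (qK : forall i, i < n -> p (q i) = i).
Hypothesis (p_out : forall i, n <= i -> p i = 0).
Hypothesis (q_out : forall i, n <= i -> q i = 0).

Let W1 : 1 < W.
Proof. by apply: leq_trans nW; rewrite (@leq_mul 2 1) // expn_gt0. Qed.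

Let n2W : n.*2.+2 < W.
Proof.
apply: leq_trans nW; have : n.+1 <= n.+1 ^ 6 by rewrite -{1}[n.+1]expn1 leq_pexp2l.
lia.
Qed.

Let n2W' : n.+1 * n.+1 + n.+1 * n.+1 < W.
Proof.
apply: leq_trans nW; have : n.+1 ^ 2 <= n.+1 ^ 6 by rewrite leq_pexp2l.
rewrite -mulnn; set m := _ * _; have : 0 < m by rewrite muln_gt0.
lia.
Qed.

Lemma ordered_p s : env s -> ordered n s aQ p.
Proof.
move=> es; split=> i iN; rewrite !(env_q es) ?qK ?pK //.
  by rewrite q_lt.
by rewrite p_lt.
Qed.

Lemma ordered_id s : env s -> ordered n s aI id.
Proof. by move=> es; split=> i iN; rewrite !(env_I es). Qed.

Definition qfar_count (al be : nat -> nat) (t2 t3 t4 : nat) : nat :=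
  \sum_(d < n) \sum_(c < n) \sum_(b < n) \sum_(a < n)
    near t3 (al c) (al d) * near t2 (be c) (be b) * near t4 (be a) (be d) *
    (al a %/ S < al b %/ S).

Lemma qfarP ra oa ob (t2 t3 t4 : nat) al be s :
    env s -> ra < 4 -> oa < 4 -> ob < 4 ->
    t2 < nbounds -> t3 < nbounds -> t4 < nbounds ->
    (forall x, x < n -> arrs s ra x = al x) -> ordered n s oa al -> ordered n s ob be ->
    vars s vres + qfar_count al be (vars s t2) (vars s t3) (vars s t4) < W ->
  triple (qfar ra oa ob t2 t3 t4) s (fun s' => vars s' vres =
    vars s vres + qfar_count al be (vars s t2) (vars s t3) (vars s t4)).
Proof.
move=> es ra4 oa4 ob4 t2n t3n t4n raP oaP obP totW.
pose n2 b c := (dlt false (be b) (be c) && (be b %/ vars s t2 == be c %/ vars s t2)) : nat.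
pose n3 c d := near (vars s t3) (al c) (al d) : nat.
pose n4 a d := near (vars s t4) (be a) (be d) : nat.
pose B a := al a %/ S.
pose C k c := \sum_(b < n) n2 b c * (B b == k).
pose D k d := \sum_(a < n) n4 a d * (B a < k).
pose T k d := \sum_(c < n) n3 c d * C k c.
pose G k := \sum_(d < n) T k d * D k d.
have al_lt x : x < n -> al x < n by move=> /oaP.2 [].
have BK b : b < n -> B b < K.
  by move=> bn; rewrite KE ltnS /B leq_div2r // ltnW // al_lt.
have totE : qfar_count al be (vars s t2) (vars s t3) (vars s t4) = \sum_(k < K) G k.
  rewrite far_sum //; do 4!apply: eq_bigr => ? _.
  by rewrite /n2 /dlt /near [in X in _ * X * _ * _]eq_sym.
rewrite totE in totW *.
have CW k : k < K -> \sum_(c < n) C k c < W.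
  move=> kK; apply: leq_ltn_trans (leq_trans n2W' _) => //.
  apply: (@leq_trans (n.+1 * n.+1)); last by lia.
  apply: (@leq_trans (\sum_(c < n) n)).
    apply: leq_sum => c _; rewrite -[X in _ <= X]card_ord -sum1_card /C.
    by apply: leq_sum => b _; rewrite /n2 mulnb leq_b1.
  by rewrite sum_nat_const card_ord; lia.
apply: (@triple_weaken _ _ _ _ _
  (fun s' => vars s' vres = vars s vres + \sum_(k < K) G k)); last by [].
apply: (@triple_for _ _ _ _ _ _ (fun k s' => vars s' vres = vars s vres + \sum_(i < k) G i)).
- exact: env_K es.
- by rewrite big_ord0 addn0.
move=> k s1 kK r1 fr1.
have es1 : env s1 by apply: env_frame es fr1.
have ar x s' (h : forall r, r < 4 -> arrs s' r = arrs s r) : x < n -> arrs s' ra x = al x.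
  by move=> xn; rewrite h // raP.
have h1 r : r < 4 -> arrs s1 r = arrs s r by move=> r4; apply: fr1.2; rewrite /=; lia.
set s2 := setv s1 vk k; have es2 : env s2 by apply: env_setv.
have tv t : t < nbounds -> vars s2 t = vars s t.
  move=> tn; rewrite -fr1.1; last by case: (t) tn => [|[|[|]]].
  by rewrite /= upd_other //; move: tn; rewrite /nbounds; lia.
apply: triple_seq.
  apply: (@fillP W n W1 _ _ (fun x => B x == k)); first exact: env_n es2.
  move=> x s' xn sx b fr _.
  have es' : env s' by apply: env_frame es2 fr.
  have k' : vars s' vk = k by rewrite fr.1.
  have r' : arrs s' ra x = al x.
    by rewrite fr.2 /= -?h1 ?ar //; case: (ra) ra4 => [|[|[|[|]]]].
  split; first by esafe_tac; rewrite /= sx; lia.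
  by rewrite !evalE /= sx k' (env_S es') r'.
move=> s3 S3 fr3; have es3 : env s3 by apply: env_frame es2 fr3.
have h3 r : r < 4 -> arrs s3 r = arrs s r by move=> r4; rewrite fr3.2 -?h1 //=; lia.
have tv3 t : t < nbounds -> vars s3 t = vars s t.
  by move=> tn; rewrite fr3.1 ?tv //; case: (t) tn => [|[|[|]]].
apply: triple_seq.
  have [ob1 ob2] := ordered_ext (h3 _ ob4) obP.
  apply: (@scanP W n W1 ob false t2 aS aC be (fun x => B x == k)) => //.
  - exact: env_n es3.
  - by lia.
  - apply: (@leq_ltn_trans (\sum_(y < n) 1)).
      by apply: leq_sum => y _; rewrite leq_b1.
    by rewrite sum1_card card_ord; lia.
move=> s4 C4 fr4; have es4 : env s4 by apply: env_frame es3 fr4.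
have h4 r : r < 4 -> arrs s4 r = arrs s r by move=> r4; rewrite fr4.2 -?h3 //=; lia.
have tv4 t : t < nbounds -> vars s4 t = vars s t.
  by move=> tn; rewrite fr4.1 ?tv3 //; case: (t) tn => [|[|[|]]].
have {}C4 c : c < n -> arrs s4 aC c = C k c by move=> cn; rewrite C4 // tv3.
apply: triple_seq.
  apply: (@fillP W n W1 _ _ (fun x => B x < k)); first exact: env_n es4.
  move=> x s' xn sx b fr _.
  have es' : env s' by apply: env_frame es4 fr.
  have k' : vars s' vk = k by rewrite fr.1 // fr4.1 // fr3.1.
  have r' : arrs s' ra x = al x.
    by rewrite fr.2 /= -?h4 ?ar //; case: (ra) ra4 => [|[|[|[|]]]].
  split; first by esafe_tac; rewrite /= sx; lia.
  by rewrite !evalE /= sx k' (env_S es') r'.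
move=> s5 S5 fr5; have es5 : env s5 by apply: env_frame es4 fr5.
have h5 r : r < 4 -> arrs s5 r = arrs s r by move=> r4; rewrite fr5.2 -?h4 //=; lia.
have tv5 t : t < nbounds -> vars s5 t = vars s t.
  by move=> tn; rewrite fr5.1 ?tv4 //; case: (t) tn => [|[|[|]]].
apply: triple_seq.
  have [ob1 ob2] := ordered_ext (h5 _ ob4) obP.
  apply: (@scanP W n W1 ob true t4 aS aD be (fun x => B x < k)) => //.
  - exact: env_n es5.
  - by lia.
  - apply: (@leq_ltn_trans (\sum_(y < n) 1)).
      by apply: leq_sum => y _; rewrite leq_b1.
    by rewrite sum1_card card_ord; lia.
move=> s6 D6 fr6; have es6 : env s6 by apply: env_frame es5 fr6.
have h6 r : r < 4 -> arrs s6 r = arrs s r by move=> r4; rewrite fr6.2 -?h5 //=; lia.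
have tv6 t : t < nbounds -> vars s6 t = vars s t.
  by move=> tn; rewrite fr6.1 ?tv5 //; case: (t) tn => [|[|[|]]].
have {}D6 d : d < n -> arrs s6 aD d = D k d by move=> dn; rewrite D6 // tv5.
apply: triple_seq.
  have [oa1 oa2] := ordered_ext (h6 _ oa4) oaP.
  apply: (@scanP W n W1 oa true t3 aC aT al (C k)) => //.
  - exact: env_n es6.
  - by lia.
  - by move=> c cn; rewrite fr6.2 // fr5.2 // C4.
  - exact: CW.
move=> s7 T7 fr7; have es7 : env s7 by apply: env_frame es6 fr7.
have {}T7 d : d < n -> arrs s7 aT d = T k d by move=> dn; rewrite T7 // tv6.
have D7 d : d < n -> arrs s7 aD d = D k d by move=> dn; rewrite fr7.2 // D6.
have r7 : vars s7 vres = vars s vres + \sum_(i < k) G i.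
  by rewrite fr7.1 // fr6.1 // fr5.1 // fr4.1 // fr3.1.
have sumE : \sum_(i < vars s7 0) eval (EMul (EGet aT (EVar vx)) (EGet aD (EVar vx)))
    (setv s7 vx i) = G k.
  rewrite (env_n es7) /G; apply: eq_bigr => d _ /=.
  by rewrite /upd /= T7 // D7.
(* Every intermediate total is part of the count bounded by [totW], so no word overflows. *)
have Gle : vars s vres + \sum_(i < k.+1) G i < W.
  by apply: leq_ltn_trans totW; rewrite leq_add2l (leq_sum_ord G).
have GW : G k < W by apply: leq_ltn_trans Gle; rewrite big_ord_recr /=; lia.
set e := ESum _ _ _.
have ev : eval (EAdd (EVar vres) e) s7 = vars s vres + \sum_(i < k.+1) G i.
  by rewrite eval_Bin [eval e s7]sumE /= r7 big_ord_recr /= addnA.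
apply: triple_set; last by rewrite ev.
move=> b; split=> //; last by move: Gle; rewrite -ev.
split; last by rewrite sumE.
move=> d; rewrite (env_n es7) => dn; split.
- by split=> //=; rewrite /upd /=; lia.
- by split=> //=; rewrite /upd /=; lia.
rewrite /= /upd /= T7 // D7 //; apply: leq_ltn_trans GW.
by rewrite /G (bigD1 (Ordinal dn)) //= leq_addr.
Qed.

End FarCycles.

(** * Cycles with all four edges inside strips *)

Section NearCycles.

Variables (W n S K : nat) (p q : nat -> nat).
Local Notation Z := (n.*2.+2).
Local Notation triple := (triple W Z).
Local Notation bnd := (bnd W).
Local Notation esafe := (esafe W Z).
Local Notation env := (env n S K p q).

Hypothesis (nW : 4096 * n.+1 ^ 6 <= W).
Hypothesis (S_gt0 : 0 < S).
Hypothesis (S_le : S <= n.+1).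
Hypothesis (KE : K = (n %/ S).+1).
Hypothesis (p_lt : forall i, i < n -> p i < n).
Hypothesis (q_lt : forall i, i < n -> q i < n).
Hypothesis (pK : forall i, i < n -> q (p i) = i).
Hypothesis (qK : forall i, i < n -> p (q i) = i).
Hypothesis (p_out : forall i, n <= i -> p i = 0).
Hypothesis (q_out : forall i, n <= i -> q i = 0).

Let W1 : 1 < W.
Proof. by apply: leq_trans nW; rewrite (@leq_mul 2 1) // expn_gt0. Qed.

Let n2W : n.*2.+2 < W.
Proof.
apply: leq_trans nW; have : n.+1 <= n.+1 ^ 6 by rewrite -{1}[n.+1]expn1 leq_pexp2l.
lia.
Qed.

Let n2W' : n.+1 * n.+1 + n.+1 * n.+1 < W.
Proof.
apply: leq_trans nW; have : n.+1 ^ 2 <= n.+1 ^ 6 by rewrite leq_pexp2l.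
rewrite -mulnn; set m := _ * _; have : 0 < m by rewrite muln_gt0.
lia.
Qed.

Lemma p_lt_gen x : 0 < n -> p x < n.
Proof. by move=> n0; case: (ltnP x n) => [/p_lt//|/p_out ->]. Qed.

Lemma q_lt_gen x : 0 < n -> q x < n.
Proof. by move=> n0; case: (ltnP x n) => [/q_lt//|/q_out ->]. Qed.

Definition nb a j := a %/ S * S + j.
Definition nv a j i := p (nb a j) %/ S * S + i.
Definition nw a j i := [&& nb a j < n, a < nb a j, nv a j i < n & nv a j i < p (nb a j)].

Lemma addS_safe e x j s : env s -> esafe e s -> eval e s = x -> vars s j < S ->
  x < n -> bnd s ->
  esafe (EAdd (EFlr e (EVar 1)) (EVar j)) s /\
  eval (EAdd (EFlr e (EVar 1)) (EVar j)) s = x %/ S * S + vars s j.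
Proof.
move=> es se ex jS xn b.
have ev : eval (EAdd (EFlr e (EVar 1)) (EVar j)) s = x %/ S * S + vars s j.
  by rewrite eval_Bin !evalE ex (env_S es).
split=> //; split=> //; first by esafe_tac.
have := flr_lt S_le xn jS; move: ev; rewrite eval_Bin => ->; lia.
Qed.

Lemma near_vP s a j i :
    env s -> bnd s -> vars s va = a -> vars s vj = j -> vars s vi = i ->
    a < n -> j < S -> i < S ->
  [/\ esafe (EGet aQ near_v) s, eval (EGet aQ near_v) s = q (nv a j i),
      esafe near_w s & eval near_w s = nw a j i].
Proof.
move=> es b sa sj si an jS iS; have n0 : 0 < n by exact: leq_ltn_trans an.
have [sb eb] : esafe near_b s /\ eval near_b s = nb a j.
  by have := @addS_safe (EVar va) a vj s es I sa; rewrite sj; apply.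
have sP : esafe (EGet aP near_b) s by split=> //; rewrite eb; exact: flr_lt.
have eP : eval (EGet aP near_b) s = p (nb a j) by rewrite eval_Get eb (env_p es).
have [sv ev] : esafe near_v s /\ eval near_v s = nv a j i.
  have := @addS_safe (EGet aP near_b) (p (nb a j)) vi s es sP eP.
  by rewrite si; apply=> //; exact: p_lt_gen.
split.
- by split=> //; rewrite ev; apply: flr_lt => //; exact: p_lt_gen.
- by rewrite eval_Get ev (env_q es).
- by rewrite /near_w; esafe_tac.
rewrite /near_w !evalE eb ev (env_p es) (env_n es) sa /nw -!mulnb.
by [].
Qed.

Definition nsum a x := \sum_(j < S) \sum_(i < S) (q (nv a j i) == x) * nw a j i.

(** Adding and subtracting in instalments obey the same law [o x (y + z) = o (o x y) z], so one
    proof covers the scatter and its undoing. *)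
Lemma scatterP o a (C0 : nat -> nat) s :
    (forall x y z, eval_binop o x (y + z) = eval_binop o (eval_binop o x y) z) ->
    (forall x, eval_binop o x 0 = x) ->
    (forall x y, eval_binop o x y <= x + y) ->
    env s -> vars s va = a -> a < n ->
    (forall x, x < n -> arrs s aC x = C0 x) ->
    (forall x, x < n -> C0 x + nsum a x < W) ->
  triple (scatter o) s (fun s' => forall x, x < n ->
    arrs s' aC x = eval_binop o (C0 x) (nsum a x)).
Proof.
move=> oD o0 ole es sa an C0P C0W; have n0 : 0 < n by exact: leq_ltn_trans an.
pose row x j m := \sum_(i < m) (q (nv a j i) == x) * nw a j i.
pose P j s' := forall x, x < n ->
  arrs s' aC x = eval_binop o (C0 x) (\sum_(j' < j) row x j' S).
apply: (@triple_for _ _ _ _ _ _ P); first exact: env_S es.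
  by move=> x xn; rewrite big_ord0 o0 C0P.
move=> j s1 jS P1 fr1; have es1 : env s1 by apply: env_frame es fr1.
set s2 := setv s1 vj j; have es2 : env s2 by apply: env_setv.
pose P' m s' := forall x, x < n ->
  arrs s' aC x = eval_binop o (C0 x) (\sum_(j' < j) row x j' S + row x j m).
apply: (@triple_weaken _ _ _ _ _ (P' S)); last first.
  by move=> s' h _ x xn; rewrite h // big_ord_recr.
apply: (@triple_for _ _ _ _ _ _ P'); first exact: env_S es2.
  by move=> x xn; rewrite /row big_ord0 addn0 P1.
move=> i s3 iS P3 fr3; have es3 : env s3 by apply: env_frame es2 fr3.
set s4 := setv s3 vi i; have es4 : env s4 by apply: env_setv.
have sa4 : vars s4 va = a by rewrite -[LHS]/(vars s3 va) fr3.1 // -[LHS]/(vars s1 va) fr1.1.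
have sj4 : vars s4 vj = j by rewrite -[LHS]/(vars s3 vj) fr3.1.
have up x : \sum_(j' < j) row x j' S + row x j i +
    (q (nv a j i) == x) * nw a j i <= nsum a x.
  have -> : \sum_(j' < j) row x j' S + row x j i + (q (nv a j i) == x) * nw a j i
      = \sum_(j' < j) row x j' S + row x j i.+1 by rewrite /row big_ord_recr addnA.
  have := @leq_sum_ord (fun j => row x j S) j.+1 S jS.
  rewrite big_ord_recr /=; apply: leq_trans; rewrite leq_add2l.
  exact: (@leq_sum_ord (fun i => (q (nv a j i) == x) * nw a j i)).
pose x0 := q (nv a j i); have x0n : x0 < n by exact: q_lt_gen.
move=> b; have [sc ec sw ew] := @near_vP s4 a j i es4 b sa4 sj4 erefl an jS iS; move: b.
set e := EBin o _ _.
have ev : eval e s4 = eval_binop o (C0 x0)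
    (\sum_(j' < j) row x0 j' S + row x0 j i + nw a j i).
  by rewrite /e eval_Bin oD ew eval_Get ec -[arrs s4 aC]/(arrs s3 aC) P3.
have evW : eval e s4 < W.
  rewrite ev; apply: leq_ltn_trans (ole _ _) _; apply: leq_ltn_trans (C0W x0 x0n).
  by rewrite leq_add2l; have := up x0; rewrite eqxx mul1n.
apply: triple_put.
  move=> b; split=> //; last by rewrite ec -/x0; lia.
  split=> //; first by split=> //; rewrite ec -/x0; lia.
  by move: evW; rewrite /e eval_Bin; case: (o).
rewrite ev ec => x xn /=; rewrite /upd.
case: (eqVneq x x0) => [->|ne].
  by rewrite /row big_ord_recr /= eqxx mul1n addnA.
rewrite P3 // /row big_ord_recr /= -/x0 eq_sym (negbTE ne) mul0n addn0.
by [].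
Qed.

Lemma nsumE a x : a < n -> x < n ->
  nsum a x = \sum_(b < n) near S a b * near S (p x) (p b).
Proof.
move=> an xn; have n0 : 0 < n by exact: leq_ltn_trans an.
pose F b := (a < b) * \sum_(i < S) (p b %/ S * S + i < n) *
  ((p b %/ S * S + i < p b) * (q (p b %/ S * S + i) == x)).
transitivity (\sum_(j < S) (nb a j < n) * F (nb a j)).
  apply: eq_bigr => j _; rewrite /F !big_distrr /=; apply: eq_bigr => i _.
  by rewrite /nw !mulnb andbC -!andbA.
rewrite /nb (sum_strip _ _ F) //; apply: eq_bigr => b _.
rewrite /F (sum_strip _ _ (fun v => (v < p b) * (q v == x))) //.
(* As q inverts p, the condition [q y == x] selects the single value p x, which removes the inner
   sum. *)
have -> : \sum_(y < n) (y %/ S == p b %/ S) * ((y < p b) * (q y == x)) =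
    \sum_(y < n) (y == p x :> nat) * ((y %/ S == p b %/ S) * (y < p b)).
  apply: eq_bigr => y _; have -> : (q y == x) = (y == p x :> nat).
    by apply/eqP/eqP => [<-|->]; rewrite ?qK ?pK.
  by lia.
rewrite (@sum_pick n (p x) (fun y => (y %/ S == p b %/ S) * (y < p b))) ?p_lt //.
by rewrite /near -!mulnb [b %/ S == _]eq_sym; lia.
Qed.

Definition csum (C : nat -> nat) a := \sum_(d < n) \sum_(c < n)
  near S (p a) (p d) * near S c d * C c.

Lemma collectP s a (C : nat -> nat) :
    env s -> bnd s -> vars s va = a -> a < n ->
    (forall x, x < n -> arrs s aC x = C x) -> csum C a < W ->
  esafe collect s /\ eval collect s = csum C a.
Proof.
move=> es b sa an CP CW; have n0 : 0 < n by exact: leq_ltn_trans an.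
set e2 := ESel (ELt near_u (EVar 0)) (ESel (ELt (EGet aP (EVar va)) near_u)
      (ESel (ELt near_c (EGet aQ near_u)) (EGet aC near_c))).
pose F v := (p a < v) * \sum_(i < S) (q v %/ S * S + i < n) *
  ((q v %/ S * S + i < q v) * C (q v %/ S * S + i)).
pose u j := p a %/ S * S + j.
pose t j i := (u j < n) * ((p a < u j) * ((q (u j) %/ S * S + i < n) *
  ((q (u j) %/ S * S + i < q (u j)) * C (q (u j) %/ S * S + i)))).
have e2P j i : j < S -> i < S -> let s' := setv (setv s vj j) vi i in
    esafe e2 s' /\ eval e2 s' = t j i.
  move=> jS iS s'.
  have b' : bnd s' by do 2![apply: bnd_setv; last by lia].
  have es' : env s' by do 2!apply: env_setv => //.
  have sP : esafe (EGet aP (EVar va)) s' by split=> //=; rewrite /upd /= sa; lia.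
  have eP : eval (EGet aP (EVar va)) s' = p a by rewrite eval_Get (env_p es') /= /upd /= sa.
  have [su eu] : esafe near_u s' /\ eval near_u s' = u j.
    by have := @addS_safe (EGet aP (EVar va)) (p a) vj s' es' sP eP; apply=> //; exact: p_lt.
  have sQ : esafe (EGet aQ near_u) s'.
    by split=> //; rewrite eu; apply: flr_lt => //; exact: p_lt.
  have eQ : eval (EGet aQ near_u) s' = q (u j) by rewrite eval_Get eu (env_q es').
  have [sc ec] : esafe near_c s' /\ eval near_c s' = q (u j) %/ S * S + i.
    have := @addS_safe (EGet aQ near_u) (q (u j)) vi s' es' sQ eQ.
    by apply=> //; exact: q_lt_gen.
  split.
    rewrite /e2; esafe_tac; rewrite ?ec; apply: flr_lt => //; exact: q_lt_gen.
  rewrite /e2 eval_Sel eval_Lt eval_Sel eval_Lt eval_Sel eval_Lt eQ eP eu.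
  rewrite eval_Get ec !lt0b eval_Var (env_n es') /t.
  (* The guard c < n in [t], absent from the code but required by [sum_strip], follows from c < q (u
     j); it also puts c where [C] describes the array. *)
  congr (_ * (_ * _)); case: ltnP => h2; last by rewrite !mul0n muln0.
  have c0 : q (u j) %/ S * S + i < n by apply: ltn_trans h2 _; exact: q_lt_gen.
  by rewrite c0 !mul1n -[arrs s' aC]/(arrs s aC) CP.
have tE : \sum_(j < S) \sum_(i < S) t j i = csum C a.
  transitivity (\sum_(j < S) (u j < n) * F (u j)).
    by apply: eq_bigr => j _; rewrite /F !big_distrr.
  rewrite /u (sum_strip _ _ F) //.
  have qP v : v < n -> q v < n /\ p (q v) = v by move=> vn; rewrite qK // q_lt.
  rewrite /csum -(sum_reindex qP (fun d =>
    \sum_(c < n) near S (p a) (p d) * near S c d * C c)).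
  apply: eq_bigr => v _; rewrite /F.
  rewrite (sum_strip _ _ (fun c => (c < q v) * C c)) // !big_distrr /=.
  apply: eq_bigr => c _; rewrite qK // /near -!mulnb eq_sym.
  by lia.
have inner j : j < S -> \sum_(i < vars (setv s vj j) 1)
    eval e2 (setv (setv s vj j) vi i) = \sum_(i < S) t j i.
  move=> jS; rewrite [vars _ _](env_S es); apply: eq_bigr => i _.
  by have [_ ->] := e2P j i jS (ltn_ord i).
have outer : \sum_(j < vars s 1) eval (ESum vi 1 e2) (setv s vj j) = csum C a.
  rewrite (env_S es) -tE; apply: eq_bigr => j _; exact: inner.
split; last exact: outer.
split; last by rewrite outer.
move=> j; rewrite (env_S es) => jS; split.
  by move=> i; rewrite [vars _ _](env_S es) => iS; have [] := e2P j i jS iS.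
rewrite inner //; apply: leq_ltn_trans CW; rewrite -tE.
by rewrite [X in _ <= X](bigD1 (Ordinal jS)) //= leq_addr.
Qed.

Definition qnear_count : nat :=
  \sum_(a < n) csum (nsum a) a.

Lemma qnearP s : env s -> vars s vres + qnear_count < W ->
  triple qnear s (fun s' => vars s' vres = vars s vres + qnear_count).
Proof.
move=> es totW; apply: triple_seq.
  apply: (@fillP W n W1 _ _ (fun=> 0)); first exact: env_n es.
  by move=> i s' iN _ _ _ _; split=> //=; lia.
move=> s1 C1 fr1; have es1 : env s1 by apply: env_frame es fr1.
pose P k s' := vars s' vres = vars s vres + \sum_(a < k) csum (nsum a) a /\
  (forall x, x < n -> arrs s' aC x = 0).
apply: (@triple_weaken _ _ _ _ _ (P n)); last by move=> s' [].
apply: (@triple_for _ _ _ _ _ _ P); first exact: env_n es1.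
  by split=> //; rewrite big_ord0 addn0 fr1.1.
move=> a s2 an [r2 C2] fr2; have es2 : env s2 by apply: env_frame es1 fr2.
set s3 := setv s2 va a; have es3 : env s3 by apply: env_setv.
have nsW x : nsum a x <= n.+1 * n.+1.
  apply: (@leq_trans (\sum_(j < S) \sum_(i < S) 1)).
    by apply: leq_sum => j _; apply: leq_sum => i _; rewrite mulnb leq_b1.
  by rewrite !sum_nat_const !card_ord muln1; exact: leq_mul.
apply: triple_seq.
  apply: (@scatterP Add a (fun=> 0)) => //=.
  - by move=> x y z; rewrite addnA.
  - by move=> x; rewrite addn0.
  - by move=> x _; have := nsW x; lia.
move=> s4 C4 fr4; have es4 : env s4 by apply: env_frame es3 fr4.
have sa4 : vars s4 va = a by rewrite fr4.1.
have r4 : vars s4 vres = vars s vres + \sum_(i < a) csum (nsum i) i by rewrite fr4.1.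
have tot : vars s vres + \sum_(i < a.+1) csum (nsum i) i < W.
  apply: leq_ltn_trans totW; rewrite leq_add2l.
  exact: (@leq_sum_ord (fun i => csum (nsum i) i)).
have cW : csum (nsum a) a < W.
  by apply: leq_ltn_trans tot; rewrite big_ord_recr /=; lia.
have cP b := @collectP s4 a (nsum a) es4 b sa4 an C4 cW.
apply: triple_step => b4.
have [sc ec] := cP b4.
have ev : eval (EAdd (EVar vres) collect) s4 =
    vars s vres + \sum_(i < a.+1) csum (nsum i) i.
  by rewrite eval_Bin ec evalE r4 big_ord_recr /= addnA.
move: b4; apply: (@triple_set W Z vres (EAdd (EVar vres) collect) s4
  (fun s' => triple (scatter Defs.Sub) s' (P a.+1))).
  by move=> b; split=> //; move: tot; rewrite -ev.
rewrite ev; set s5 := setv _ _ _; have es5 : env s5 by apply: env_setv.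
apply: triple_weaken.
  apply: (@scatterP Defs.Sub a (nsum a)) => //=.
  - by move=> x y z; rewrite subnDA.
  - by move=> x; rewrite subn0.
  - by move=> x y; lia.
  - by move=> x xn; have := nsW x; lia.
move=> s6 C6 fr6; split; first by rewrite fr6.1.
by move=> x xn; rewrite C6 //= subnn.
Qed.

End NearCycles.

(** * Tree and cycle counts *)

Definition sum4 (n : nat) (F : nat -> nat -> nat -> nat -> nat) : nat :=
  \sum_(a < n) \sum_(b < n) \sum_(c < n) \sum_(d < n) F a b c d.

Lemma eq_sum4 n F G :
  (forall a b c d, a < n -> b < n -> c < n -> d < n -> F a b c d = G a b c d) ->
  sum4 n F = sum4 n G.
Proof. by move=> FG; do 4!apply: eq_bigr => ? _; exact: FG. Qed.

Lemma leq_sum4 n F G :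
  (forall a b c d, F a b c d <= G a b c d) -> sum4 n F <= sum4 n G.
Proof. by move=> FG; do 4!apply: leq_sum => ? _; exact: FG. Qed.

Lemma sum4_add n F G :
  sum4 n (fun a b c d => F a b c d + G a b c d) = sum4 n F + sum4 n G.
Proof.
rewrite /sum4 -big_split; apply: eq_bigr => a _ /=.
rewrite -big_split; apply: eq_bigr => b _ /=.
rewrite -big_split; apply: eq_bigr => c _ /=.
by rewrite -big_split.
Qed.

Lemma sum4_mull n k F : sum4 n (fun a b c d => k * F a b c d) = k * sum4 n F.
Proof.
rewrite /sum4 big_distrr; apply: eq_bigr => a _ /=.
rewrite big_distrr; apply: eq_bigr => b _ /=.
rewrite big_distrr; apply: eq_bigr => c _ /=.
by rewrite big_distrr.
Qed.

Lemma sum4_const n k : sum4 n (fun _ _ _ _ => k) = n ^ 4 * k.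
Proof. by rewrite /sum4 !sum_nat_const !card_ord !expnS expn0; lia. Qed.

Lemma sum4_01 n F : sum4 n F = sum4 n (fun a b c d => F b a c d).
Proof. by rewrite /sum4 exchange_big. Qed.

Lemma sum4_12 n F : sum4 n F = sum4 n (fun a b c d => F a c b d).
Proof. by apply: eq_bigr => a _; rewrite exchange_big. Qed.

Lemma sum4_23 n F : sum4 n F = sum4 n (fun a b c d => F a b d c).
Proof. by do 2!apply: eq_bigr => ? _; rewrite exchange_big. Qed.

Lemma sum4_rev n F : sum4 n F = sum4 n (fun a b c d => F d c b a).
Proof. by rewrite sum4_01 sum4_12 sum4_23 sum4_01 sum4_12 sum4_01. Qed.

Definition point := (nat * nat)%type.

Definition pt (p : nat -> nat) (x : nat) : point := (x, p x).

(** Two points of a permutation stand in exactly one of these five relations, and equality of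
    positions is equality of points. [REq] expresses trees with coinciding vertices. *)
Inductive rel5 := REq | RDir (bp bv : bool).

Definition rholds (r : rel5) (y x : point) : bool :=
  match r with
  | REq => y.1 == x.1
  | RDir bp bv => dlt bp y.1 x.1 && dlt bv y.2 x.2
  end.

(** The path and the star are the only trees on four vertices; the star has its centre at the last
    one. *)
Inductive term :=
| TPath (r1 r2 r3 : rel5)
| TStar (r1 r2 r3 : rel5)
| TCycle.

Definition tholds (t : term) (x0 x1 x2 x3 : point) : bool :=
  match t with
  | TPath r1 r2 r3 => [&& rholds r1 x0 x1, rholds r2 x1 x2 & rholds r3 x2 x3]
  | TStar r1 r2 r3 => [&& rholds r1 x0 x3, rholds r2 x1 x3 & rholds r3 x2 x3]
  | TCycle => [&& x0.1 < x1.1, x2.2 < x1.2, x2.1 < x3.1 & x0.2 < x3.2]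
  end.

Definition tcount (n : nat) (p : nat -> nat) (t : term) : nat :=
  sum4 n (fun a b c d => tholds t (pt p a) (pt p b) (pt p c) (pt p d)).

Lemma tcount_le n p t : tcount n p t <= n ^ 4.
Proof.
rewrite -[n ^ 4]muln1 -sum4_const; apply: leq_sum4 => *; exact: leq_b1.
Qed.

Definition rstep (r : rel5) (f dst : nat) : prog :=
  match r with
  | REq => fill dst (EGet f (EVar vx))
  | RDir bp bv => quad bp bv f dst
  end.

(** A path is summed edge by edge, a star is a product at its centre. The cycle is unchanged when
    (a, b) and (c, d) are exchanged, and exchanging b and d trades position edges for value edges;
    so all four choices of the first edge between strips are instances of [qfar]. *)
Definition tprog (t : term) : prog :=
  match t with
  | TPath r1 r2 r3 =>
      rstep r1 aOne aF1 ;; rstep r2 aF1 aF2 ;; rstep r3 aF2 aF3 ;;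
      PSet vres (ESum vx 0 (EGet aF3 (EVar vx)))
  | TStar r1 r2 r3 =>
      rstep r1 aOne aF1 ;; rstep r2 aOne aF2 ;; rstep r3 aOne aF3 ;;
      PSet vres (ESum vx 0
        (EMul (EMul (EGet aF1 (EVar vx)) (EGet aF2 (EVar vx))) (EGet aF3 (EVar vx))))
  | TCycle =>
      PSet vres (ENum 0) ;;
      qfar aI aI aQ 0 0 0 ;; qfar aI aI aQ 0 1 0 ;;
      qfar aP aQ aI 1 0 1 ;; qfar aP aQ aI 1 1 1 ;; qnear
  end.

(* An entry [(negative, k, t)] stands for the coefficient [k] or [- k] of [t]. *)
Definition combination := seq (bool * nat * term).

Definition csumof (n : nat) (p : nat -> nat) (neg : bool) (l : combination) : nat :=
  \sum_(x <- l | x.1.1 == neg) x.1.2 * tcount n p x.2.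

Fixpoint cprog (l : combination) : prog :=
  match l with
  | [::] => PSet vacc (ENum 0)
  | (neg, k, t) :: l =>
      let v := if neg then vneg else vpos in
      tprog t ;; PSet v (EAdd (EVar v) (EMul (ENum k) (EVar vres))) ;; cprog l
  end.

(** As each count is at most n^4, [weight l * n ^ 4] bounds both accumulators throughout. *)
Definition weight (l : combination) : nat := sumn [seq x.1.2 | x <- l].

Lemma weight_cons b k t l : weight ((b, k, t) :: l) = k + weight l.
Proof. by []. Qed.

Lemma near_all n x y : x < n -> y < n -> near n x y = (x < y).
Proof. by move=> xn yn; rewrite /near !divn_small // eqxx andbT. Qed.

Lemma qfar_countE n t al be t2 t3 t4 : qfar_count n t al be t2 t3 t4 =
  sum4 n (fun d c b a => near t3 (al c) (al d) * near t2 (be c) (be b) *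
    near t4 (be a) (be d) * (al a %/ t < al b %/ t)).
Proof. by []. Qed.

Section TermPrograms.

Variables (W n S K : nat) (p q : nat -> nat).
Local Notation Z := (n.*2.+2).
Local Notation triple := (triple W Z).
Local Notation bnd := (bnd W).
Local Notation esafe := (esafe W Z).
Local Notation env := (env n S K p q).

Hypothesis (nW : 4096 * n.+1 ^ 6 <= W).
Hypothesis (S_gt0 : 0 < S).
Hypothesis (S_le : S <= n.+1).
Hypothesis (KE : K = (n %/ S).+1).
Hypothesis (p_lt : forall i, i < n -> p i < n).
Hypothesis (q_lt : forall i, i < n -> q i < n).
Hypothesis (pK : forall i, i < n -> q (p i) = i).
Hypothesis (qK : forall i, i < n -> p (q i) = i).
Hypothesis (p_out : forall i, n <= i -> p i = 0).
Hypothesis (q_out : forall i, n <= i -> q i = 0).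

Let W1 : 1 < W.
Proof. by apply: leq_trans nW; rewrite (@leq_mul 2 1) // expn_gt0. Qed.

Let nkW k c : k <= 6 -> c < 4096 -> c * n ^ k < W.
Proof.
move=> k6 c4; apply: leq_trans nW.
have h : n ^ k <= n.+1 ^ 6.
  apply: (@leq_trans (n.+1 ^ k)); last exact: leq_pexp2l.
  by case: (k) => // j; rewrite leq_exp2r.
by apply: (@leq_ltn_trans (c * n.+1 ^ 6)); rewrite ?leq_mul ?ltn_mul2r ?expn_gt0.
Qed.

Let n2W : n.*2.+2 < W.
Proof.
apply: leq_trans nW; have : n.+1 <= n.+1 ^ 6 by rewrite -{1}[n.+1]expn1 leq_pexp2l.
lia.
Qed.

(* The four edges of the cycle are compared in the order ab, cd, ad, cb; each
   summand collects the cycles by the first edge between different strips. *)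
Lemma cycleE : qfar_count n S id p n n n + qfar_count n S id p n S n +
  qfar_count n S p id S n S + qfar_count n S p id S S S + qnear_count n S p q =
  tcount n p TCycle.
Proof.
have far_near x y : (x < y) = (x %/ S < y %/ S) + near S x y :> nat.
  by rewrite -[x < y]/(dlt true x y) (dlt_strip true S) /near andbC.
pose f x y : nat := x %/ S < y %/ S.
pose g x y : nat := near S x y.
pose l x y : nat := x < y.
have e1 : qfar_count n S id p n n n =
    sum4 n (fun a b c d => f a b * l c d * l (p a) (p d) * l (p c) (p b)).
  rewrite qfar_countE sum4_rev; apply: eq_sum4 => d c b a dn cn bn an.
  by rewrite !(@near_all n) ?p_lt // /f /l; lia.
have e2 : qfar_count n S id p n S n =
    sum4 n (fun a b c d => g a b * f c d * l (p a) (p d) * l (p c) (p b)).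
  rewrite qfar_countE [RHS]sum4_01 [RHS]sum4_23.
  apply: eq_sum4 => d c b a dn cn bn an.
  by rewrite !(@near_all n) ?p_lt // /f /l /g; lia.
have e3 : qfar_count n S p id S n S =
    sum4 n (fun a b c d => g a b * g c d * f (p a) (p d) * l (p c) (p b)).
  have -> : qfar_count n S p id S n S = sum4 n (fun b c d a =>
      g a b * g c d * f (p a) (p d) * l (p c) (p b)).
    rewrite qfar_countE; apply: eq_sum4 => d c b a dn cn bn an.
    by rewrite !(@near_all n) ?p_lt // /f /l /g; lia.
  by rewrite sum4_23 sum4_12 sum4_01.
have e4 : qfar_count n S p id S S S =
    sum4 n (fun a b c d => g a b * g c d * g (p a) (p d) * f (p c) (p b)).
  have -> : qfar_count n S p id S S S = sum4 n (fun d a b c =>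
      g a b * g c d * g (p a) (p d) * f (p c) (p b)).
    rewrite qfar_countE; apply: eq_sum4 => d c b a dn cn bn an.
    by rewrite /f /l /g; lia.
  by rewrite sum4_01 sum4_12 sum4_23.
have e5 : qnear_count n S p q =
    sum4 n (fun a b c d => g a b * g c d * g (p a) (p d) * g (p c) (p b)).
  have -> : qnear_count n S p q = sum4 n (fun a d c b =>
      g a b * g c d * g (p a) (p d) * g (p c) (p b)).
    apply: eq_bigr => a _; apply: eq_bigr => d _; apply: eq_bigr => c _.
    rewrite (@nsumE W n S K) // big_distrr /=; apply: eq_bigr => b _.
    by rewrite /g; lia.
  by rewrite sum4_12 sum4_23 sum4_12.
rewrite e1 e2 e3 e4 e5 -!sum4_add; apply: eq_sum4 => a b c d an bn cn dn /=.
rewrite -!mulnb (far_near a b) (far_near c d) (far_near (p a)) (far_near (p c)).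
have lE x y : l x y = f x y + g x y by exact: far_near.
rewrite !lE -/(f a b) -/(f c d) -/(f (p a) (p d)) -/(f (p c) (p b)).
rewrite -/(g a b) -/(g c d) -/(g (p a) (p d)) -/(g (p c) (p b)).
(* What is left is the expansion of the product of four factors f + g by the first factor that
   contributes its f, the product of all g coming last. *)
move: (f a b) (f c d) (f (p a) (p d)) (f (p c) (p b)) => f1 f2 f3 f4.
move: (g a b) (g c d) (g (p a) (p d)) (g (p c) (p b)) => g1 g2 g3 g4.
by nia.
Qed.

Lemma rstepP r (f dst : nat) (F : nat -> nat) s :
    env s -> 5 < dst -> f != dst -> f != aS -> f != aT ->
    (forall y, y < n -> arrs s f y = F y) -> \sum_(y < n) F y < W ->
  triple (rstep r f dst) s (fun s' => forall x, x < n ->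
    arrs s' dst x = \sum_(y < n) rholds r (pt p y) (pt p x) * F y).
Proof.
case: r => [|bp bv] es d5 fd fS fT fP FW; last exact: (@quadP W n S K p q).
apply: (@fillP W n W1); first exact: env_n es.
move=> x s' xn sx b fr _; have f' : arrs s' f = arrs s f by apply: fr.2; rewrite /= eq_sym.
split; first by split=> //=; rewrite sx; lia.
by rewrite /= sx f' fP //= (@sum_pick n x F).
Qed.

Lemma sum_le_const m (F : nat -> nat) B : (forall x, x < m -> F x <= B) ->
  \sum_(x < m) F x <= m * B.
Proof.
move=> FB; apply: (@leq_trans (\sum_(x < m) B)).
  by apply: leq_sum => x _; exact: FB.
by rewrite sum_nat_const card_ord.
Qed.

Lemma rsum_le r (F : nat -> nat) x B : (forall y, y < n -> F y <= B) ->
  \sum_(y < n) rholds r (pt p y) (pt p x) * F y <= n * B.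
Proof.
move=> FB; apply: (@sum_le_const n (fun y => rholds r (pt p y) (pt p x) * F y)).
by move=> y yn; case: (rholds _ _ _); rewrite ?mul1n ?FB.
Qed.

Lemma sum_expr (e : expr) (F : nat -> nat) s :
    env s -> \sum_(x < n) F x < W ->
    (forall x, x < n -> esafe e (setv s vx x) /\ eval e (setv s vx x) = F x) ->
  esafe (ESum vx 0 e) s /\ eval (ESum vx 0 e) s = \sum_(x < n) F x.
Proof.
move=> es FW eP.
have sE : eval (ESum vx 0 e) s = \sum_(x < n) F x.
  by rewrite /= (env_n es); apply: eq_bigr => x _; have [_ ->] := eP x (ltn_ord x).
split=> //; split; last by move: FW; rewrite -sE.
by move=> x; rewrite (env_n es) => /eP [].
Qed.

Lemma keeps_rstep r f dst : 5 < dst -> keeps (rstep r f dst).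
Proof. by case: r => [|bp bv] d5; rewrite /keeps /=; lia. Qed.

Lemma rstep_frame r (f dst r' : nat) s s' : 5 < dst -> 5 < r' -> r' != dst ->
  frame_of (rstep r f dst) s s' -> arrs s' r' = arrs s r'.
Proof. by case: r => [|bp bv] d5 r5 rd [_]; apply; rewrite /=; lia. Qed.

Lemma tprogP t s : env s ->
  triple (tprog t) s (fun s' => vars s' vres = tcount n p t).
Proof.
move=> es.
have oneW : \sum_(y < n) 1 < W.
  by rewrite sum1_card card_ord; have := nkW (isT : 1 <= 6) (isT : 1 < 4096); lia.
case: t => [r1 r2 r3|r1 r2 r3|]; rewrite /tprog.
- pose F1 x := \sum_(y < n) rholds r1 (pt p y) (pt p x) * 1.
  pose F2 x := \sum_(y < n) rholds r2 (pt p y) (pt p x) * F1 y.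
  pose F3 x := \sum_(y < n) rholds r3 (pt p y) (pt p x) * F2 y.
  have B1 x : x < n -> F1 x <= n.
    by move=> xn; have := @rsum_le r1 (fun=> 1) x 1 (fun _ _ => isT); rewrite muln1.
  have B2 x : x < n -> F2 x <= n * n by move=> xn; exact: (@rsum_le r2 F1).
  have B3 x : x < n -> F3 x <= n * (n * n) by move=> xn; exact: (@rsum_le r3 F2).
  apply: triple_seq.
    apply: (@rstepP _ _ _ (fun=> 1)) => //.
    by move=> y yn; rewrite (env_1 es).
  move=> s1 h1 fr1; have es1 := env_frame (keeps_rstep _ _ (isT : 5 < aF1)) es fr1.
  apply: triple_seq.
    apply: (@rstepP _ _ _ F1) => //.
    by apply: leq_ltn_trans (sum_le_const B1) _; have := @nkW 2 1 isT isT; rewrite -mulnn; lia.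
  move=> s2 h2 fr2; have es2 := env_frame (keeps_rstep _ _ (isT : 5 < aF2)) es1 fr2.
  apply: triple_seq.
    apply: (@rstepP _ _ _ F2) => //.
    apply: leq_ltn_trans (sum_le_const B2) _.
    by have := @nkW 3 1 isT isT; rewrite !expnS expn0; lia.
  move=> s3 h3 fr3; have es3 := env_frame (keeps_rstep _ _ (isT : 5 < aF3)) es2 fr3.
  have FW : \sum_(x < n) F3 x < W.
    apply: leq_ltn_trans (sum_le_const B3) _.
    by have := @nkW 4 1 isT isT; rewrite !expnS expn0; lia.
  have [|sf ev] := @sum_expr (EGet aF3 (EVar vx)) F3 s3 es3 FW.
    by move=> x xn; split=> //=; rewrite /upd /= ?h3 //; split=> //; lia.
  apply: triple_set => //; rewrite ev /= upd_same /tcount sum4_rev.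
  apply: eq_bigr => x3 _; rewrite /F3; apply: eq_bigr => x2 _.
  rewrite /F2 big_distrr /=; apply: eq_bigr => x1 _.
  rewrite /F1 !big_distrr /=; apply: eq_bigr => x0 _.
  by rewrite muln1 !mulnb; do 3!case: rholds.
- pose F r x := \sum_(y < n) rholds r (pt p y) (pt p x) * 1.
  have B1 r x : F r x <= n.
    by have := @rsum_le r (fun=> 1) x 1 (fun _ _ => isT); rewrite muln1.
  apply: triple_seq.
    apply: (@rstepP _ _ _ (fun=> 1)) => //.
    by move=> y yn; rewrite (env_1 es).
  move=> s1 h1 fr1; have es1 := env_frame (keeps_rstep _ _ (isT : 5 < aF1)) es fr1.
  apply: triple_seq.
    apply: (@rstepP _ _ _ (fun=> 1)) => //.
    by move=> y yn; rewrite (env_1 es1).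
  move=> s2 h2 fr2; have es2 := env_frame (keeps_rstep _ _ (isT : 5 < aF2)) es1 fr2.
  apply: triple_seq.
    apply: (@rstepP _ _ _ (fun=> 1)) => //.
    by move=> y yn; rewrite (env_1 es2).
  move=> s3 h3 fr3; have es3 := env_frame (keeps_rstep _ _ (isT : 5 < aF3)) es2 fr3.
  have a3 x : x < n ->
      [/\ arrs s3 aF1 x = F r1 x, arrs s3 aF2 x = F r2 x & arrs s3 aF3 x = F r3 x].
    move=> xn; rewrite h3 //.
    rewrite (rstep_frame (r' := aF2) _ _ _ fr3) // h2 //.
    rewrite (rstep_frame (r' := aF1) _ _ _ fr3) //.
    by rewrite (rstep_frame (r' := aF1) _ _ _ fr2) // h1.
  have P2 x : F r1 x * F r2 x <= n * n by exact: leq_mul.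
  have P3 x : F r1 x * F r2 x * F r3 x <= n * n * n by exact: leq_mul.
  have n2 : n * n < W by have := @nkW 2 1 isT isT; rewrite -mulnn; lia.
  have n3 : n * n * n < W by have := @nkW 3 1 isT isT; rewrite !expnS expn0; lia.
  have FW : \sum_(x < n) F r1 x * F r2 x * F r3 x < W.
    apply: leq_ltn_trans (@sum_le_const n (fun x => F r1 x * F r2 x * F r3 x)
      (n * n * n) (fun x _ => P3 x)) _.
    by have := @nkW 4 1 isT isT; rewrite !expnS expn0; lia.
  have [|sf ev] := @sum_expr (EMul (EMul (EGet aF1 (EVar vx)) (EGet aF2 (EVar vx)))
    (EGet aF3 (EVar vx))) (fun x => F r1 x * F r2 x * F r3 x) s3 es3 FW.
    move=> x xn; have [a1 a2 a3'] := a3 x xn.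
    rewrite /= /upd /= a1 a2 a3'; split=> //.
    split; last by apply: leq_ltn_trans (P3 x) _.
      split; [by split=> //; lia|by split=> //; lia|exact: leq_ltn_trans (P2 x) _].
    by split=> //; lia.
  apply: triple_set => //; rewrite ev /= upd_same /tcount.
  rewrite sum4_23 sum4_12 sum4_01; apply: eq_bigr => x3 _.
  rewrite /F -mulnA big_distrl; apply: eq_bigr => x0 _ /=.
  rewrite big_distrl big_distrr; apply: eq_bigr => x1 _ /=.
  rewrite !big_distrr; apply: eq_bigr => x2 _ /=.
  by rewrite !muln1 !mulnb.
apply: triple_step; apply: triple_set; first by move=> _ /=; lia.
set s0 := setv _ _ _; have es0 : env s0 by apply: env_setv.
have tW : tcount n p TCycle < W.
  by apply: leq_ltn_trans (tcount_le _ _ _) _; have := @nkW 4 1 isT isT; lia.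
have E := cycleE; have r0 : vars s0 vres = 0 by [].
apply: triple_seq.
  apply: (@qfarP W n S K p q nW S_gt0 S_le KE aI aI aQ 0 0 0 id p) => //.
  - by move=> x xn; rewrite (env_I es0).
  - exact: ordered_id es0.
  - exact: (ordered_p p_lt q_lt pK qK es0).
  - by rewrite !(env_n es0) r0; move: tW; rewrite -E; lia.
move=> s1 h1 fr1; have es1 : env s1 by apply: env_frame es0 fr1.
move: h1; rewrite !(env_n es0) r0 add0n => h1.
apply: triple_seq.
  apply: (@qfarP W n S K p q nW S_gt0 S_le KE aI aI aQ 0 1 0 id p) => //.
  - by move=> x xn; rewrite (env_I es1).
  - exact: ordered_id es1.
  - exact: (ordered_p p_lt q_lt pK qK es1).
  - by rewrite !(env_n es1) !(env_S es1) h1; move: tW; rewrite -E; lia.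
move=> s2 h2 fr2; have es2 : env s2 by apply: env_frame es1 fr2.
move: h2; rewrite !(env_n es1) !(env_S es1) h1 => h2.
apply: triple_seq.
  apply: (@qfarP W n S K p q nW S_gt0 S_le KE aP aQ aI 1 0 1 p id) => //.
  - by move=> x xn; rewrite (env_p es2).
  - exact: (ordered_p p_lt q_lt pK qK es2).
  - exact: ordered_id es2.
  - by rewrite !(env_n es2) !(env_S es2) h2; move: tW; rewrite -E; lia.
move=> s3 h3 fr3; have es3 : env s3 by apply: env_frame es2 fr3.
move: h3; rewrite !(env_n es2) !(env_S es2) h2 => h3.
apply: triple_seq.
  apply: (@qfarP W n S K p q nW S_gt0 S_le KE aP aQ aI 1 1 1 p id) => //.
  - by move=> x xn; rewrite (env_p es3).
  - exact: (ordered_p p_lt q_lt pK qK es3).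
  - exact: ordered_id es3.
  - by rewrite !(env_S es3) h3; move: tW; rewrite -E; lia.
move=> s4 h4 fr4; have es4 : env s4 by apply: env_frame es3 fr4.
move: h4; rewrite !(env_S es3) h3 => h4.
apply: triple_weaken.
  apply: (@qnearP W n S K p q) => //.
  by rewrite h4; move: tW; rewrite -E; lia.
by move=> s5 h5 _; rewrite h5 h4 -E; lia.
Qed.

Lemma keeps_tprog t : keeps (tprog t).
Proof. by case: t => [[|b1 c1] [|b2 c2] [|b3 c3]|[|b1 c1] [|b2 c2] [|b3 c3]|]. Qed.

Lemma tprog_acc t v : (v == vpos) || (v == vneg) -> ~~ wvar (tprog t) v.
Proof.
by case/orP => /eqP ->; case: t => [[|b1 c1] [|b2 c2] [|b3 c3]|[|b1 c1] [|b2 c2] [|b3 c3]|].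
Qed.

Lemma cprogP l s : env s ->
    vars s vpos + weight l * n ^ 4 < W -> vars s vneg + weight l * n ^ 4 < W ->
    weight l < 4096 ->
  triple (cprog l) s (fun s' =>
    vars s' vpos = vars s vpos + csumof n p false l /\
    vars s' vneg = vars s vneg + csumof n p true l).
Proof.
elim: l s => [|[[b k] t] l IH] s es pW nW' kW.
  by apply: triple_set; [move=> _ /=; lia|rewrite /csumof !big_nil !addn0].
have {}kW : k + weight l < 4096 by [].
apply: triple_seq; first exact: tprogP.
move=> s1 h1 fr1; have es1 := env_frame (keeps_tprog t) es fr1.
have p1 : vars s1 vpos = vars s vpos by apply: fr1.1; exact: tprog_acc.
have n1 : vars s1 vneg = vars s vneg by apply: fr1.1; exact: tprog_acc.
have tle := tcount_le n p t.
have kt : k * tcount n p t <= k * n ^ 4 by rewrite leq_mul2l tle orbT.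
move: pW nW'; rewrite weight_cons !mulnDl => pW nW'.
have evv : eval (EAdd (EVar (if b then vneg else vpos)) (EMul (ENum k) (EVar vres))) s1 =
    (if b then vars s vneg else vars s vpos) + k * tcount n p t.
  by rewrite /= h1; case: (b); rewrite ?p1 ?n1.
apply: triple_step; apply: triple_set.
  move=> _; split=> //.
    split=> //=; first by have := @nkW 0 k isT; rewrite expn0 muln1; apply; lia.
    by rewrite h1; apply: leq_ltn_trans kt _; apply: nkW => //; lia.
  move: evv; rewrite eval_Bin => ->; case: (b); lia.
rewrite evv; set s2 := setv _ _ _.
have es2 : env s2 by apply: env_setv => //; case: (b).
have p2 : vars s2 vpos = vars s vpos + (~~ b) * (k * tcount n p t).
  by rewrite /s2 /= /upd; case: (b); rewrite /= ?p1 ?mul0n ?addn0 ?mul1n.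
have n2 : vars s2 vneg = vars s vneg + b * (k * tcount n p t).
  by rewrite /s2 /= /upd; case: (b); rewrite /= ?n1 ?mul0n ?addn0 ?mul1n.
apply: triple_weaken.
  apply: IH => //; last by lia.
  - by rewrite p2; case: (b) => /=; lia.
  - by rewrite n2; case: (b) => /=; lia.
move=> s3 [p3 n3] _; rewrite p3 n3 p2 n2 /csumof !big_cons /=.
by case: (b) => /=; lia.
Qed.

End TermPrograms.

(** * The whole program *)

Definition cbrt_step (n t : nat) : nat := t + (1 - (n < t * t * t)).

Lemma cbrt_step_le n t : cbrt_step n t <= t.+1.
Proof. by rewrite -addn1 leq_add2l leq_subr. Qed.

(** One more than the integer part of the cube root of n: from 1 on, t grows as long as t^3 <= n. At
    most n rounds are needed because (n + 1)^3 > n, and a linear loop is cheap enough here. *)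
Definition strip_size (n : nat) : nat := iter n (cbrt_step n) 1.

Lemma strip_sizeP n : [/\ 0 < strip_size n, strip_size n <= n.+1,
  (strip_size n).-1 ^ 3 <= n & n < strip_size n ^ 3].
Proof.
have E t : t ^ 3 = t * t * t by rewrite !expnS expn0 muln1 mulnA.
(* The last clause says that t has either grown in every round so far or already passed the cube
   root. *)
have main i : [/\ 0 < iter i (cbrt_step n) 1, iter i (cbrt_step n) 1 <= i.+1,
    (iter i (cbrt_step n) 1).-1 ^ 3 <= n &
    iter i (cbrt_step n) 1 = i.+1 \/ n < iter i (cbrt_step n) 1 ^ 3].
  elim: i => [|i [h1 h2 h3 h4]]; first by split=> //; left.
  rewrite iterS; set t := iter i _ _ in h1 h2 h3 h4 *.
  have -> : cbrt_step n t = t + (1 - (n < t ^ 3)) by rewrite /cbrt_step E.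
  case: (ltnP n (t ^ 3)) => nt; rewrite ?subnn ?subn0 ?addn0 ?addn1.
    by split=> //; [exact: leqW|right].
  split=> //; left; case: h4 => [->//|]; by rewrite ltnNge nt.
have [h1 h2 h3 h4] := main n; split=> //.
case: h4 => // e; rewrite /strip_size e.
by rewrite -{1}[n.+1]expn1 leq_pexp2l.
Qed.

Definition init : prog :=
  PSet vu (ENum 1) ;;
  PFor vv 0 (PSet vu (EAdd (EVar vu) (ESub (ENum 1)
    (ELt (EVar 0) (EMul (EMul (EVar vu) (EVar vu)) (EVar vu)))))) ;;
  PSet 1 (EVar vu) ;;
  PSet 2 (EAdd (EDiv (EVar 0) (EVar 1)) (ENum 1)) ;;
  PFor vx 0 (PPut aQ (EGet aP (EVar vx)) (EVar vx)) ;;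
  fill aI (EVar vx) ;;
  fill aOne (ENum 1).

Definition full (l : combination) : prog :=
  init ;; cprog l ;; PSet 0 (EDiv (ESub (EVar vpos) (EVar vneg)) (ENum 12)).

(** Sets the constant temporaries: the stride 2n + 2, obtained from register 0, and the constant 1.
    The constant 0 is there already, as the other registers start at 0. *)
Definition prologue : cmd :=
  Seq (Const (tmp 2) 1)
  (Seq (Op Add (tmp 0) (var 0) (var 0))
  (Seq (Op Add (tmp 0) (tmp 0) (tmp 2)) (Op Add (tmp 0) (tmp 0) (tmp 2)))).

Definition ram (l : combination) : cmd := Seq prologue (compile 3 (full l)).

Definition start (n : nat) (p : nat -> nat) : pstate :=
  PState (fun x => if x == 0 then n else 0) (fun r i => if r == 0 then p i else 0).

Section WholeProgram.

Variables (W n : nat) (p q : nat -> nat).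
Local Notation Z := (n.*2.+2).
Local Notation triple := (triple W Z).
Local Notation bnd := (bnd W).
Local Notation esafe := (esafe W Z).
Local Notation S := (strip_size n).
Local Notation K := (n %/ S).+1.
Local Notation env := (env n S K p q).

Hypothesis (nW : 4096 * n.+1 ^ 6 <= W).
Hypothesis (p_lt : forall i, i < n -> p i < n).
Hypothesis (q_lt : forall i, i < n -> q i < n).
Hypothesis (pK : forall i, i < n -> q (p i) = i).
Hypothesis (qK : forall i, i < n -> p (q i) = i).
Hypothesis (p_out : forall i, n <= i -> p i = 0).
Hypothesis (q_out : forall i, n <= i -> q i = 0).

Let W1 : 1 < W.
Proof. by apply: leq_trans nW; rewrite (@leq_mul 2 1) // expn_gt0. Qed.

Let n2W : n.*2.+2 < W.
Proof.
apply: leq_trans nW; have : n.+1 <= n.+1 ^ 6 by rewrite -{1}[n.+1]expn1 leq_pexp2l.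
lia.
Qed.

Let n3W t : t <= n.+1 -> t * t * t < W /\ t * t < W.
Proof.
move=> tn; have h3 : n.+1 * n.+1 * n.+1 < W.
  apply: leq_trans nW; have : n.+1 ^ 3 <= n.+1 ^ 6 by rewrite leq_pexp2l.
  have := expn_gt0 n.+1 6; rewrite (_ : n.+1 ^ 3 = n.+1 * n.+1 * n.+1); first by lia.
  by rewrite !expnS expn0 muln1 mulnA.
split; apply: leq_ltn_trans h3; first by do 2!apply: leq_mul => //.
by rewrite -[t * t]muln1; do 2!apply: leq_mul => //.
Qed.

Lemma initP : triple init (start n p)
  (fun s' => [/\ env s', vars s' vpos = 0 & vars s' vneg = 0]).
Proof.
have [S0 Sn _ _] := strip_sizeP n.
apply: triple_step; apply: triple_set; first by move=> _ /=; lia.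
set s0 := setv _ _ _.
pose P i s := vars s vu = iter i (cbrt_step n) 1.
apply: triple_seq.
  apply: (@triple_for _ _ _ _ _ _ P n); [by []|by []|].
  move=> i s1 iN P1 fr1; have n1 : vars s1 0 = n by rewrite fr1.1.
  have le : iter i (cbrt_step n) 1 <= i.+1.
    by elim: (i) => // j IH; rewrite iterS; apply: leq_trans (cbrt_step_le _ _) _.
  have [t3 t2] := @n3W (iter i (cbrt_step n) 1) (leq_trans le (leqW iN)).
  set e := EMul (EMul (EVar vu) (EVar vu)) (EVar vu).
  have ev : eval e (setv s1 vv i) =
      iter i (cbrt_step n) 1 * iter i (cbrt_step n) 1 * iter i (cbrt_step n) 1.
    by rewrite /= /upd /= P1.
  have ev2 : eval (EAdd (EVar vu) (ESub (ENum 1) (ELt (EVar 0) e))) (setv s1 vv i) =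
      cbrt_step n (iter i (cbrt_step n) 1).
    by rewrite 2!eval_Bin eval_Lt ev /= /upd /= n1 P1.
  apply: triple_set.
    move=> b; split=> //.
      split; [exact: W1| |by []].
      apply: esafe_Lt => //; split=> //; last by move: ev t3 => <-.
      by split=> //=; rewrite /upd /= P1.
    have := ev2; rewrite eval_Bin => ->.
    by have := cbrt_step_le n (iter i (cbrt_step n) 1); lia.
  by rewrite ev2 /P [LHS]upd_same.
move=> s1 P1 fr1.
apply: triple_step; apply: triple_set; first by [].
rewrite [eval _ _]P1; set s2 := setv _ _ _.
have n2 : vars s2 0 = n by rewrite -[LHS]/(vars s1 0) fr1.1.
have ev3 : eval (EAdd (EDiv (EVar 0) (EVar 1)) (ENum 1)) s2 = K.
  by rewrite eval_Bin eval_Bin !evalE n2 /= addn1.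
apply: triple_step; apply: triple_set.
  move=> b; split; [by []|exact: W1|].
  have := ev3; rewrite eval_Bin => ->; have := leq_div n S; lia.
rewrite ev3; set s3 := setv _ _ _.
have a3 r i : arrs s3 r i = if r == 0 then p i else 0 by rewrite -[LHS]/(arrs s1 r i) fr1.2.
(* After m rounds the inverse is known at the values p 0, ..., p (m - 1); elsewhere the array is
   still 0. *)
pose P' m s := forall v, arrs s aQ v = if (v < n) && (q v < m) then q v else 0.
apply: triple_seq.
  apply: (@triple_for _ _ _ _ _ _ P' n); first exact: n2.
    by move=> v; rewrite a3 andbF.
  move=> i s4 iN P4 fr4.
  have eP : eval (EGet aP (EVar vx)) (setv s4 vx i) = p i.
    by rewrite eval_Get /= upd_same fr4.2 // a3.
  apply: triple_put.
    move=> b; split=> //; first by split=> //=; rewrite upd_same; lia.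
    by rewrite eP; have := p_lt iN; lia.
  rewrite eP => v /=; rewrite /upd /=; case: eqP => [->|ne].
    by rewrite p_lt // pK // ltnSn.
  rewrite P4; case: (ltnP v n) => //= vn.
  have ne' : q v != i by apply/eqP => e; apply: ne; rewrite -e qK.
  by rewrite ltnS [q v <= i]leq_eqVlt (negbTE ne').
move=> s4 P4 fr4.
have n4 : vars s4 0 = n by rewrite fr4.1.
apply: triple_seq.
  by apply: (@fillP W n W1 _ _ id); [exact: n4|move=> i s' iN si b _ _; split].
move=> s5 I5 fr5.
have n5 : vars s5 0 = n by rewrite fr5.1.
apply: triple_weaken.
  by apply: (@fillP W n W1 _ _ (fun=> 1)); [exact: n5|move=> i s' iN si b _ _; split].
move=> s6 O6 fr6.
have v6 x : x != vx -> vars s6 x = vars s3 x.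
  by move=> xx; rewrite fr6.1 ?fr5.1 ?fr4.1 //= ?orbF eq_sym.
split; last 2 first.
- by rewrite v6 // -[LHS]/(vars s1 vpos) fr1.1.
- by rewrite v6 // -[LHS]/(vars s1 vneg) fr1.1.
split=> //.
- by rewrite v6.
- by rewrite v6.
- by rewrite v6.
- by move=> i; rewrite fr6.2 // fr5.2 // fr4.2 // a3.
- move=> i; rewrite fr6.2 // fr5.2 // P4; case: (ltnP i n) => [iN|/q_out->//].
  by rewrite q_lt.
- by move=> i iN; rewrite fr6.2 // I5.
Qed.

Lemma fullP l : weight l < 4096 ->
  triple (full l) (start n p) (fun s' =>
    vars s' 0 = (csumof n p false l - csumof n p true l) %/ 12).
Proof.
move=> lW; have [S0 Sn _ _] := strip_sizeP n.
have wW : weight l * n ^ 4 < W.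
  have h : n ^ 4 <= n.+1 ^ 6.
    by apply: (@leq_trans (n.+1 ^ 4)); rewrite ?leq_exp2r ?leq_pexp2l.
  apply: leq_trans nW; apply: (@leq_ltn_trans (weight l * n.+1 ^ 6)).
    by rewrite leq_mul.
  by rewrite ltn_mul2r expn_gt0.
apply: triple_seq; first exact: initP.
move=> s1 [es1 p1 n1] _; apply: triple_seq.
  by apply: (@cprogP W n S K p q) => //; rewrite ?p1 ?n1.
move=> s2 [p2 n2] _; apply: triple_set.
  by move=> _ /=; split=> //; apply: leq_trans nW; rewrite (@leq_mul 13 1) // expn_gt0.
by rewrite /= upd_same p2 n2 p1 n1.
Qed.

End WholeProgram.

Lemma wf_rstep r f dst : f < narrs -> dst < narrs -> wf narrs true (rstep r f dst).
Proof. by move=> fn dn; case: r => [|[] []]; rewrite /= ?fn ?dn. Qed.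

Lemma wf_tprog t : wf narrs true (tprog t).
Proof. by case: t => [r1 r2 r3|r1 r2 r3|//]; rewrite /= !wf_rstep. Qed.

Lemma wf_cprog l : wf narrs true (cprog l).
Proof.
by elim: l => [//|[[b k] t] l IH] /=; rewrite wf_tprog IH; case: b.
Qed.

Lemma wf_full l : wf narrs false (full l).
Proof. by rewrite /full /= wf_weaken // wf_cprog. Qed.

(** * Running time *)

Fixpoint scost (c : prog) (f : nat -> nat) : nat :=
  match c with
  | PSet x e => ecost e f + 1
  | PPut r e1 e2 => ecost e1 f + ecost e2 f + 4
  | PSeq c1 c2 => scost c1 f + scost c2 f
  | PFor x g c => f g * (scost c f + 4) + 4
  end.

Lemma scost_seq c1 c2 f : scost (c1 ;; c2) f = scost c1 f + scost c2 f.
Proof. by []. Qed.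

Lemma cost_scost R c s : wf R true c -> cost c s = scost c (vars s).
Proof.
elim: c s => [y e|r e1 e2|c1 IH1 c2 IH2|y g c IH] s //=.
  case/andP=> w1 w2; rewrite -IH1 // -IH2 //; congr (_ + _).
  by apply: cost_ext w2 _ => x xn; rewrite run_vars // (wf_wvar w1).
by case/and3P=> _ _ /IH ->.
Qed.

Section CostBounds.

Variables (f : nat -> nat).
Hypothesis (S_gt0 : 0 < f 1).
Hypothesis (K_le : f 2 <= f 1 * f 1).

Local Notation B := ((f 0).+1 * (f 1 * f 1)).

(** Costs are combinations of these monomials with constant coefficients, so bounding each of them
    by B reduces all estimates to linear arithmetic. [K_le] puts the scans, [f 0 * f 2], on a par
    with the enumeration, [f 0 * (f 1 * f 1)]. *)
Let monomials : [/\ f 0 * (f 1 * f 1) <= B, f 0 * f 1 <= B, f 0 * f 2 <= B, f 2 <= B &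
  [/\ f 0 <= B, f 1 <= B & 1 <= B]].
Proof.
have h : f 1 <= f 1 * f 1 by rewrite leq_pmull.
have h1 : 1 <= f 1 * f 1 by rewrite muln_gt0 S_gt0.
split.
- by rewrite leq_mul2r leqnSn orbT.
- by apply: leq_mul.
- by apply: leq_mul.
- by apply: leq_trans K_le _; rewrite leq_pmull.
split.
- by rewrite -{1}[f 0]muln1; apply: leq_mul.
- by apply: leq_trans h _; rewrite leq_pmull.
- by rewrite muln_gt0.
Qed.

Ltac cost_tac :=
  rewrite /fill /scan /EDlt /ESel /EEq /EFlr /ELt /=;
  case: monomials => ? ? ? ? [? ? ?]; lia.

Lemma scost_rstep r g dst : scost (rstep r g dst) f <= 500 * B.
Proof.
rewrite /rstep; case: r => [|[] []]; rewrite ?/quad /strip_elt; cost_tac.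
Qed.

Lemma scost_qfar ra oa ob t2 t3 t4 : scost (qfar ra oa ob t2 t3 t4) f <= 500 * B.
Proof. rewrite /qfar; cost_tac. Qed.

Lemma scost_qnear : scost qnear f <= 1000 * B.
Proof.
rewrite /qnear /scatter /collect /near_w /near_c /near_u /near_v /near_b; cost_tac.
Qed.

Lemma scost_tprog t : scost (tprog t) f <= 4000 * B.
Proof.
case: monomials => ? ? ? ? [? ? ?].
case: t => [r1 r2 r3|r1 r2 r3|]; rewrite /tprog.
- have := scost_rstep r1 aOne aF1; have := scost_rstep r2 aF1 aF2.
  have := scost_rstep r3 aF2 aF3; rewrite !scost_seq [scost (PSet _ _) f]/=; lia.
- have := scost_rstep r1 aOne aF1; have := scost_rstep r2 aOne aF2.
  have := scost_rstep r3 aOne aF3; rewrite !scost_seq [scost (PSet _ _) f]/=; lia.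
have := scost_qfar aI aI aQ 0 0 0; have := scost_qfar aI aI aQ 0 1 0.
have := scost_qfar aP aQ aI 1 0 1; have := scost_qfar aP aQ aI 1 1 1.
have := scost_qnear; rewrite !scost_seq [scost (PSet _ _) f]/=; lia.
Qed.

Lemma scost_cprog l : scost (cprog l) f <= (size l).+1 * (4010 * B).
Proof.
case: monomials => ? ? ? ? [? ? ?].
elim: l => [|[[b k] t] l IH]; first by rewrite /=; lia.
have := scost_tprog t; rewrite /cprog -/cprog !scost_seq [scost (PSet _ _) f]/=.
by rewrite [size _]/=; lia.
Qed.

End CostBounds.

(** [init] assigns the bounds 1 and 2, so the static cost does not apply to it as a whole; but its
    loops use bound 0 only, which it keeps. *)
Lemma cost_init s : cost init s <= 200 * (vars s 0).+1.
Proof.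
rewrite /init; set c1 := PSet vu _; set c2 := PFor vv 0 _.
set c3 := PSet 1 _; set c4 := PSet 2 _; set c5 := PSeq (PFor vx 0 _) _.
rewrite -[cost _ s]/(cost c1 s + (cost c2 (run c1 s) +
  (cost c3 (run c2 (run c1 s)) + (cost c4 (run c3 (run c2 (run c1 s))) +
   cost c5 (run c4 (run c3 (run c2 (run c1 s)))))))).
rewrite (@cost_scost narrs c5) // (@cost_scost narrs c2) //.
have -> : scost c5 (vars (run c4 (run c3 (run c2 (run c1 s))))) =
    scost c5 (fun=> vars s 0).
  have : vars (run c4 (run c3 (run c2 (run c1 s)))) 0 = vars s 0 by rewrite !run_vars.
  by move: (vars (run c4 _)) => g g0; rewrite /c5 /= g0.
have -> : scost c2 (vars (run c1 s)) = scost c2 (fun=> vars s 0) by [].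
by rewrite /c5 /c2 /ELt /=; lia.
Qed.

Lemma cost_full n l s : vars s 0 = n -> vars (run init s) 0 = n ->
    vars (run init s) 1 = strip_size n ->
    vars (run init s) 2 = (n %/ strip_size n).+1 ->
  cost (full l) s <=
  ((size l).+1 * 4010 + 210) * (n.+1 * (strip_size n * strip_size n)).
Proof.
move=> s0 v0 v1 v2; have [S0 _ _ nS] := strip_sizeP n.
set B := n.+1 * _.
have B1 : n.+1 <= B by rewrite leq_pmulr // muln_gt0 S0.
(* From n < S^3 the quotient n / S is strictly below S^2, which absorbs the successor. *)
have K_le : (n %/ strip_size n).+1 <= strip_size n * strip_size n.
  by rewrite ltn_divLR // -mulnA; move: nS; rewrite !expnS expn0 muln1.
have := cost_init s; rewrite s0 => c1.
have c2 : cost (cprog l) (run init s) <= (size l).+1 * (4010 * B).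
  rewrite (@cost_scost narrs) ?wf_cprog //.
  have := @scost_cprog (vars (run init s)); rewrite v0 v1 v2; exact.
rewrite /full; set c3 := PSet 0 _.
rewrite -[cost _ s]/(cost init s + (cost (cprog l) (run init s) +
  cost c3 (run (cprog l) (run init s)))).
have -> : cost c3 (run (cprog l) (run init s)) = 6 by [].
rewrite mulnDl -mulnA; lia.
Qed.

(** * Execution on the word RAM *)

Definition perm_fun (n : nat) (p : 'S_n) (i : nat) : nat :=
  if insub i is Some j then val (p j) else 0.

Lemma perm_funE n (p : 'S_n) (i : 'I_n) : perm_fun p i = p i.
Proof. by rewrite /perm_fun valK. Qed.

Lemma perm_fun_out n (p : 'S_n) i : n <= i -> perm_fun p i = 0.
Proof. by move=> ni; rewrite /perm_fun insubF // ltnNge ni. Qed.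

Lemma perm_fun_lt n (p : 'S_n) i : i < n -> perm_fun p i < n.
Proof. by move=> iN; rewrite (perm_funE p (Ordinal iN)). Qed.

Lemma perm_funK n (p : 'S_n) i : i < n -> perm_fun p^-1 (perm_fun p i) = i.
Proof. by move=> iN; rewrite (perm_funE p (Ordinal iN)) perm_funE permK. Qed.

Lemma perm_funVK n (p : 'S_n) i : i < n -> perm_fun p (perm_fun p^-1 i) = i.
Proof. by move=> iN; rewrite (perm_funE _ (Ordinal iN)) perm_funE permKV. Qed.

Lemma word_bound n : 4096 * n.+1 ^ 6 <= 2 ^ (32 * (trunc_log 2 n).+1).
Proof.
set k := (trunc_log 2 n).+1; set X := 2 ^ k.
have Xn : n.+1 <= X by apply: trunc_log_ltn.
have X2 : 2 <= X by rewrite -{1}[2]expn1 leq_pexp2l.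
(* 32 = 12 + 6 + 14: X^12 covers 4096 = 2^12, the bound on the weight of a combination; X^6 covers
   (n + 1)^6, which exceeds the counts; the rest is slack. *)
have -> : 2 ^ (32 * k) = X ^ 12 * (X ^ 6 * X ^ 14) by rewrite -!expnD -expnM mulnC.
rewrite (_ : 4096 = 2 ^ 12) // leq_mul ?leq_exp2r //.
rewrite -[n.+1 ^ 6]muln1 leq_mul ?leq_exp2r //.
by rewrite expn_gt0 (leq_trans _ X2).
Qed.

Definition ram_space (n : nat) : nat := narrs * n.*2.+2.

Definition ram_time (l : combination) (n : nat) : nat :=
  4 + ((size l).+1 * 4010 + 210) * (n.+1 * (strip_size n * strip_size n)).

Lemma ramP n (p : 'S_n) l : weight l < 4096 ->
  exists (t : nat) (s' : state),
    [/\ exec (32 * (trunc_log 2 n).+1) (ram_space n) (ram l) (init_state p) t s',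
        t <= ram_time l n &
        regs s' 0 = (csumof n (perm_fun p) false l - csumof n (perm_fun p) true l) %/ 12].
Proof.
move=> lW; set w := 32 * _; set W := 2 ^ w; set Z := n.*2.+2.
have nW : 4096 * n.+1 ^ 6 <= W by exact: word_bound.
have n1 : n.+1 <= n.+1 ^ 6 by rewrite -{1}[n.+1]expn1 leq_pexp2l.
have big : 1000 * n.+1 < W by apply: leq_trans nW; lia.
pose P := perm_fun p; pose Q := perm_fun p^-1.
pose s0 := start n P.
have b0 : bnd W s0.
  split=> [x|r i] /=; first by case: eqP => _; lia.
  case: eqP => _; last by lia.
  case: (ltnP i n) => [/(perm_fun_lt p)|/(perm_fun_out p)]; rewrite -/P; lia.
have p_lt i : i < n -> P i < n by exact: perm_fun_lt.
have q_lt i : i < n -> Q i < n by exact: perm_fun_lt.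
have pK i : i < n -> Q (P i) = i by exact: perm_funK.
have qK i : i < n -> P (Q i) = i by exact: perm_funVK.
have p_out i : n <= i -> P i = 0 by exact: perm_fun_out.
have q_out i : n <= i -> Q i = 0 by exact: perm_fun_out.
have [sf res] := fullP nW p_lt q_lt pK qK p_out q_out lW b0.
have [_ [es _ _]] := initP nW p_lt q_lt pK qK q_out b0.
pose ms0 := init_state p.
pose ms1 := set_reg ms0 (tmp 2) 1.
pose ms2 := set_reg ms1 (tmp 0) (n + n).
pose ms3 := set_reg ms2 (tmp 0) (n + n + 1).
pose ms4 := set_reg ms3 (tmp 0) (n + n + 1 + 1).
have ex0 : exec w (ram_space n) prologue ms0 4 ms4.
  have a1 : n + n < W by lia.
  have a2 : n + n + 1 < W by lia.
  have a3 : n + n + 1 + 1 < W by lia.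
  apply: (@exec_seq _ _ _ _ _ 1 ms1 3); first by apply: exec_const; lia.
  apply: (@exec_seq _ _ _ _ _ 1 ms2 2).
    exact: (@exec_op _ _ Add (tmp 0) (var 0) (var 0) ms1 a1).
  apply: (@exec_seq _ _ _ _ _ 1 ms3 1).
    exact: (@exec_op _ _ Add (tmp 0) (tmp 0) (tmp 2) ms2 a2).
  exact: (@exec_op _ _ Add (tmp 0) (tmp 0) (tmp 2) ms3 a3).
have S4 : simx Z narrs xpredT s0 ms4.
  split=> //=.
  - by move=> y _; rewrite /upd !regE; case: y => [|y] //; rewrite /var doubleS.
  - by rewrite /upd /= /Z -addnn; lia.
  (* The input is array 0. Array [r.+1] starts at address Z or later, past the input, where memory
     reads 0. *)
  - move=> r i _ iZ; case: r => [|r] //=; rewrite insubF //.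
    by apply/negbTE; rewrite -leqNgt mulSn /Z; lia.
have [||||ms' [ex S' _]] :=
  @compileP w (ram_space n) Z narrs _ _ _ 3 false (full l) s0 ms4 _ S4 b0 (wf_full l) sf.
- by [].
- by rewrite /Z; lia.
- by lia.
- by [].
exists (4 + cost (full l) s0), ms'; split.
- exact: exec_seq ex.
- rewrite leq_add2l; apply: cost_full => //.
  + exact: env_n es.
  + exact: env_S es.
  + exact: env_K es.
by have [h _ _ _ _] := S'; rewrite -res -[0 in LHS]/(var 0) h.
Qed.

Notation rLL := (RDir true true).
Notation rLG := (RDir true false).
Notation rGL := (RDir false true).
Notation rGG := (RDir false false).

(** * Patterns as combinations of tree and cycle counts *)

(* Row [sigma] lists the coefficients of 12 #sigma over [basis].  The table was
   found by solving a linear system with one equation for each of the 49 order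
   types of quadruples of points, repetitions included. *)
Definition basis : seq term := [::
  TPath rGL rGL rGL; TPath REq rGG rGG; TPath rGG rGG REq; TPath REq rLG rLG;
  TPath rLG rLG REq; TPath REq rLL REq; TPath rGG rGG rGG; TPath REq rGL REq;
  TStar REq rGG rGG; TPath rLL rLL rGL; TPath rLG rLG rGG; TPath rLG REq rGL;
  TStar REq rLL rLL; TPath rGG rGG rGL; TStar rLG rGL rGL; TPath rGG rLG rLG;
  TStar rLG rLG rGL; TStar rLL rGG rGG; TPath rLG rLG rLL; TPath rGL rGL rGG;
  TStar rLL rLL rGG; TPath rGL rGG rGG; TStar rLL rLG rGL; TStar rLL rLG rGG;
  TStar rLL rGL rGG; TStar rLG rGL rGG; TPath rGG rGG rLG; TPath rLG rLL rLG;
  TPath rLL rLG rLL; TPath rGG rLG rGG; TPath rGL rLL rLG; TPath rGG rLG rLL;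
  TCycle].

Definition rows : seq (seq nat * seq int) := [::
  ([:: 0; 1; 2; 3],
   [:: 0; 0; 0; 0; 0; 0; 12; 0; 0; 0; 0; 0; 0; 0; 0; 0; 0; 0; 0; 0; 0; 0; 0;
       0; 0; 0; 0; 0; 0; 0; 0; 0; 0]%Z);
  ([:: 0; 1; 3; 2],
   [:: 0; -6; 0; 0; 0; 0; -12; 0; 0; 0; 0; 0; 0; 0; 0; 0; 0; 6; 0; 0; 0; 0;
       0; 0; 0; 0; 0; 0; 0; 0; 0; 0; 0]%Z);
  ([:: 0; 2; 1; 3],
   [:: 0; -8; 0; 0; 8; -1; -12; 4; -3; -4; 2; -4; 1; 0; 0; -6; 0; 0; -2; -10;
       0; -8; 2; 4; 4; 2; 4; -4; -6; -2; 8; -8; 3]%Z);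
  ([:: 0; 2; 3; 1],
   [:: 0; 8; -6; 0; -8; 1; 0; -4; 3; 4; -2; 4; -1; 0; 0; 6; 0; 0; 2; 10; 6;
       8; -2; -4; 8; -2; -16; 4; 6; 2; -8; 8; -3]%Z);
  ([:: 0; 3; 1; 2],
   [:: 0; 8; -6; 0; -8; 1; 0; -4; 3; 4; -2; 4; -1; -12; 0; 6; 0; 0; 2; 10; 6;
       8; -2; 8; -4; -2; -4; 4; 6; 2; -8; 8; -3]%Z);
  ([:: 0; 3; 2; 1],
   [:: 0; 2; 6; 0; 4; 1; 12; 2; -3; 4; 10; -2; -1; 0; 0; -6; 0; -6; -10; -2;
       -6; -4; -2; -4; -4; 10; 8; -8; -6; 2; 4; -4; 3]%Z);
  ([:: 1; 0; 2; 3],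
   [:: 0; 0; -6; 0; 0; 0; -12; 0; 0; 0; 0; 0; 0; 0; 0; 0; 0; 0; 0; 0; 6; 0;
       0; 0; 0; 0; 0; 0; 0; 0; 0; 0; 0]%Z);
  ([:: 1; 0; 3; 2],
   [:: 0; 8; 0; 0; 4; 4; 0; 2; 0; 4; 4; -2; -4; -12; 0; 0; 0; 0; -4; -8; 0;
       -4; 4; 8; 8; 4; -4; -8; -12; -4; 4; 8; 0]%Z);
  ([:: 1; 2; 0; 3],
   [:: 0; 2; 0; 0; -8; 1; 0; -4; 3; 4; -2; 4; -1; 0; 0; 6; 0; 6; 2; 10; 0;
       -4; -2; -4; 8; -2; -4; 4; 6; 2; -8; 8; -3]%Z);
  ([:: 1; 2; 3; 0],
   [:: 0; -2; 6; 0; 8; -1; 12; 4; -3; -4; 2; -4; 1; 0; 0; -6; 0; -6; -2; -10;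
       -6; 4; 2; 4; -8; 2; 16; -4; -6; -2; 8; -8; 3]%Z);
  ([:: 1; 3; 0; 2],
   [:: 0; -6; 6; 0; 0; -3; 12; 0; -3; -12; -6; 0; 3; 24; 0; -6; 0; -6; 6; 6;
       -6; 12; -6; -12; -12; -6; 0; 12; 18; -6; 0; -12; 3]%Z);
  ([:: 1; 3; 2; 0],
   [:: 12; -2; -6; 6; -4; -1; -12; -2; 3; -4; -10; 2; 1; 0; 0; 6; -6; 6; 10;
       14; 6; 4; 2; 4; 4; -10; -8; 8; 6; -2; -4; 4; -3]%Z);
  ([:: 2; 0; 1; 3],
   [:: 0; 2; 0; 0; -8; 1; 0; -4; 3; -8; -2; 4; -1; 0; 0; 6; 0; 6; 2; 10; 0;
       8; -2; 8; -4; -2; -4; 4; 6; 2; -8; 8; -3]%Z);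
  ([:: 2; 0; 3; 1],
   [:: 0; -6; 6; 0; 0; -3; 12; 0; -3; 0; -6; 0; 3; 12; 0; -6; 0; -6; 6; 6;
       -6; 0; -6; -12; -12; -6; 12; 12; 6; 6; 0; -12; 3]%Z);
  ([:: 2; 1; 0; 3],
   [:: 0; 2; 6; 0; 4; 1; 12; 2; -3; 4; -2; -2; -1; 0; 0; 6; 0; -6; 2; -14;
       -6; -4; 10; -4; -4; -2; 8; -8; -6; 2; 4; -4; 3]%Z);
  ([:: 2; 1; 3; 0],
   [:: 12; -2; -6; 6; -4; -1; -12; -2; 3; -4; 2; 2; 1; 0; 0; 6; -6; 6; -2;
       14; 6; 4; -10; 4; 4; 2; -8; 8; 6; -2; -4; 4; -3]%Z);
  ([:: 2; 3; 0; 1],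
   [:: 0; 4; 0; 0; 8; 2; 0; 4; 0; 8; 8; -4; -2; -12; 0; 0; 0; 0; -8; -16; 0;
       -8; 8; 4; 4; 8; 4; -16; -12; 4; 8; 4; 0]%Z);
  ([:: 2; 3; 1; 0],
   [:: -12; 0; 0; -6; 0; 0; 0; 0; 0; 0; 0; 0; 0; 0; 0; 0; 6; 0; 0; 0; 0; 0;
       0; 0; 0; 0; 0; 0; 0; 0; 0; 0; 0]%Z);
  ([:: 3; 0; 1; 2],
   [:: 0; -2; 6; 0; 8; -1; 12; 4; -3; 8; 2; -4; 1; 12; 0; -6; 0; -6; -2; -10;
       -6; -8; 2; -8; 4; 2; 4; -4; -6; -2; 8; -8; 3]%Z);
  ([:: 3; 0; 2; 1],
   [:: 12; -2; -6; 0; 2; -1; -12; -2; 3; -4; 2; 2; 1; 0; -6; 6; 0; 6; 10; 2;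
       6; 4; 2; 4; 4; -10; -8; 8; 6; -2; -4; 4; -3]%Z);
  ([:: 3; 1; 0; 2],
   [:: 12; -2; -6; 0; 2; -1; -12; -2; 3; -4; 2; 2; 1; 0; -6; -6; 0; 6; 10;
       14; 6; 4; -10; 4; 4; 2; -8; 8; 6; -2; -4; 4; -3]%Z);
  ([:: 3; 1; 2; 0],
   [:: -24; 2; 6; -6; -2; 1; 12; 2; -3; 4; -2; -2; -1; 0; 6; -6; 6; -6; -10;
       -14; -6; -4; 10; -4; -4; 10; 8; -8; -6; 2; 4; -4; 3]%Z);
  ([:: 3; 2; 0; 1],
   [:: -12; 0; 0; 0; -6; 0; 0; 0; 0; 0; 0; 0; 0; 0; 6; 0; 0; 0; 0; 0; 0; 0;
       0; 0; 0; 0; 0; 0; 0; 0; 0; 0; 0]%Z);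
  ([:: 3; 2; 1; 0],
   [:: 12; 0; 0; 0; 0; 0; 0; 0; 0; 0; 0; 0; 0; 0; 0; 0; 0; 0; 0; 0; 0; 0; 0;
       0; 0; 0; 0; 0; 0; 0; 0; 0; 0]%Z)].

(** Absolute values of the positive and negative parts, so that the integer table is applied without
    leaving the natural numbers. *)
Definition part (neg : bool) (z : int) : nat :=
  match z, neg with
  | Posz k, false => k
  | Negz k, true => k.+1
  | _, _ => 0
  end.

Definition dot (neg : bool) (z : seq int) (v : seq nat) : nat :=
  sumn [seq part neg x.1 * x.2 | x <- zip z v].

(** Zero coefficients are dropped, so no program is run for an absent term. *)
Definition combo (z : seq int) : combination :=
  [seq e <- flatten [seq [:: (false, part false x.1, x.2); (true, part true x.1, x.2)]
                    | x <- zip z basis] | e.1.2 != 0].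

Definition row_of (key : seq nat) : seq int :=
  (nth ([::], [::]) rows (index key (map fst rows))).2.

Definition occ (key : seq nat) (x0 x1 x2 x3 : point) : bool :=
  let xs := [:: x0; x1; x2; x3] in
  all (fun j => all (fun j' =>
    ((j < j') ==> ((nth x0 xs j).1 < (nth x0 xs j').1)) &&
    ((j != j') ==> (((nth x0 xs j).2 < (nth x0 xs j').2) ==
                    (nth 0 key j < nth 0 key j')))) (iota 0 4)) (iota 0 4).

(** * Summation over the 24 orderings of a quadruple *)

Section Symmetrization.

Variable (T : Type).

(** Summing over orderings makes the identities statements about unordered quadruples. Repeated
    points give repeated summands, so over all n^4 quadruples the total is exactly 24 times the
    plain sum. *)
Definition sym2 (F : T -> T -> nat) a b := F a b + F b a.
Definition sym3 (F : T -> T -> T -> nat) a b c :=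
  sym2 (F a) b c + sym2 (F b) a c + sym2 (F c) a b.
Definition sym4 (F : T -> T -> T -> T -> nat) a b c d :=
  sym3 (F a) b c d + sym3 (F b) a c d + sym3 (F c) a b d + sym3 (F d) a b c.

Lemma sym4_01 F a b c d : sym4 F a b c d = sym4 F b a c d.
Proof. rewrite /sym4 /sym3 /sym2; lia. Qed.

Lemma sym4_12 F a b c d : sym4 F a b c d = sym4 F a c b d.
Proof. rewrite /sym4 /sym3 /sym2; lia. Qed.

Lemma sym4_23 F a b c d : sym4 F a b c d = sym4 F a b d c.
Proof. rewrite /sym4 /sym3 /sym2; lia. Qed.

End Symmetrization.

Lemma sum4_sym2 n F : sum4 n (fun a b c d => sym2 (F a b) c d) = 2 * sum4 n F.
Proof. by rewrite /sym2 sum4_add [X in _ + X]sum4_23 mul2n addnn. Qed.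

Lemma sum4_sym3 n F : sum4 n (fun a b c d => sym3 (F a) b c d) = 6 * sum4 n F.
Proof.
have e1 := sum4_sym2 n F.
have e2 : sum4 n (fun a b c d => sym2 (F a c) b d) = 2 * sum4 n F.
  by rewrite sum4_12; exact: e1.
have e3 : sum4 n (fun a b c d => sym2 (F a d) b c) = 2 * sum4 n F.
  by rewrite sum4_23 sum4_12; exact: e1.
rewrite /sym3 sum4_add [X in X + _]sum4_add.
transitivity (2 * sum4 n F + 2 * sum4 n F + 2 * sum4 n F).
  by congr (_ + _ + _).
by lia.
Qed.

Lemma sum4_sym4 n F : sum4 n (fun a b c d => sym4 F a b c d) = 24 * sum4 n F.
Proof.
have e1 := sum4_sym3 n F.
have e2 : sum4 n (fun a b c d => sym3 (F b) a c d) = 6 * sum4 n F.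
  by rewrite sum4_01; exact: e1.
have e3 : sum4 n (fun a b c d => sym3 (F c) a b d) = 6 * sum4 n F.
  by rewrite sum4_12 sum4_01; exact: e1.
have e4 : sum4 n (fun a b c d => sym3 (F d) a b c) = 6 * sum4 n F.
  by rewrite sum4_23 sum4_12 sum4_01; exact: e1.
rewrite /sym4 sum4_add [X in X + _]sum4_add [X in X + _ + _]sum4_add.
transitivity (6 * sum4 n F + 6 * sum4 n F + 6 * sum4 n F + 6 * sum4 n F).
  by congr (_ + _ + _ + _).
by lia.
Qed.

(** The identity of each row at one quadruple, with the negative coefficients moved to the left to
    avoid subtraction. *)
Definition rows_ok (a b c d : point) : bool :=
  let v := [seq sym4 (tholds t) a b c d | t <- basis] in
  all (fun row => 12 * sym4 (occ row.1) a b c d + dot true row.2 v ==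
                  dot false row.2 v) rows.

(** Rank vectors are the normal forms of order types with ties; for four entries they lie in {0,
    ..., 3}, which makes the check finite. *)
Definition rank (s : seq nat) (x : nat) : nat := count (fun y => y < x) s.

Definition ranked (s : seq nat) : bool := map (rank s) s == s.

(** Any two points of a permutation satisfy this, by injectivity; it excludes configurations for
    which the table is not claimed. *)
Definition compat (x y : point) : bool := (x.1 == y.1) == (x.2 == y.2).

Definition quadruples (P : nat -> nat -> nat -> nat -> bool) : bool :=
  all (fun a => all (fun b => all (fun c => all (fun d => P a b c d)
    (iota 0 4)) (iota 0 4)) (iota 0 4)) (iota 0 4).

Definition coherent (a b c d : point) : bool :=
  [&& compat a b, compat a c, compat a d, compat b c, compat b d & compat c d].

(* The identities are invariant under permutations of the four points, so it
   suffices to check them on the rank vectors sorted by position.  The nested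
   conditionals are there because [==>] evaluates both its arguments. *)
Definition table_ok : bool :=
  quadruples (fun a b c d =>
    if ranked [:: a; b; c; d] then if sorted leq [:: a; b; c; d] then
      quadruples (fun a' b' c' d' =>
        if ranked [:: a'; b'; c'; d'] then
          if coherent (a, a') (b, b') (c, c') (d, d') then
            rows_ok (a, a') (b, b') (c, c') (d, d')
          else true
        else true)
    else true else true).

Lemma table_okP : table_ok.
Proof. by vm_compute. Qed.

Lemma rank_lt (s : seq nat) x y : x \in s -> (rank s x < rank s y) = (x < y).
Proof.
move=> xs; case: (ltnP x y) => [xy|yx]; last first.
  rewrite ltnNge; apply/negbTE; rewrite negbK.
  by apply: sub_count => z /= zy; exact: leq_trans yx.
have -> : rank s y = rank s x + count (fun z => x <= z < y) s.
  rewrite /rank -count_predUI [X in _ = _ + X](_ : _ = 0) ?addn0; last first.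
    by apply/eqP; rewrite -leqn0 leqNgt -has_count; apply/hasPn => z _ /=; lia.
  by apply: eq_count => z /=; lia.
by rewrite -[X in X < _]addn0 ltn_add2l -has_count; apply/hasP; exists x => //; lia.
Qed.

Lemma rank_eq (s : seq nat) (x y : nat) : x \in s -> y \in s ->
  (rank s x == rank s y) = (x == y).
Proof.
by move=> xs ys; have := @rank_lt s x y xs; have := @rank_lt s y x ys; lia.
Qed.

Lemma rank_size (s : seq nat) x : x \in s -> rank s x < size s.
Proof.
move=> xs; rewrite ltn_neqAle count_size andbT -all_count.
by apply/negP => /allP /(_ x xs); rewrite ltnn.
Qed.

Lemma ranked_rank (s : seq nat) : ranked (map (rank s) s).
Proof.
apply/eqP; rewrite -map_comp; apply/eq_in_map => x xs /=.
by rewrite /rank count_map; apply: eq_in_count => y ys /=; rewrite -/(rank s _) rank_lt.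
Qed.

Lemma sym4_ext (T : eqType) (F G : T -> T -> T -> T -> nat) (a b c d : T) :
  (forall x y z w, x \in [:: a; b; c; d] -> y \in [:: a; b; c; d] ->
     z \in [:: a; b; c; d] -> w \in [:: a; b; c; d] -> F x y z w = G x y z w) ->
  sym4 F a b c d = sym4 G a b c d.
Proof.
by move=> FG; rewrite /sym4 /sym3 /sym2 !FG // !inE eqxx ?orbT.
Qed.

Arguments rank : simpl never.

(** * Reduction of the identities to rank vectors *)

Section Ranks.

Variables (a b c d : point).

Let s1 := [:: a.1; b.1; c.1; d.1].
Let s2 := [:: a.2; b.2; c.2; d.2].
Let nf (x : point) : point := (rank s1 x.1, rank s2 x.2).
Let abcd := [:: a; b; c; d].

Let in1 x : x \in abcd -> x.1 \in s1.
Proof. by move=> h; apply: (map_f fst h). Qed.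

Let in2 x : x \in abcd -> x.2 \in s2.
Proof. by move=> h; apply: (map_f snd h). Qed.

Let nf1 x y : x \in abcd -> ((nf x).1 < (nf y).1) = (x.1 < y.1).
Proof. by move=> /in1 h; exact: rank_lt. Qed.

Let nf2 x y : x \in abcd -> ((nf x).2 < (nf y).2) = (x.2 < y.2).
Proof. by move=> /in2 h; exact: rank_lt. Qed.

Let rholds_nf r x y : x \in abcd -> y \in abcd -> rholds r (nf x) (nf y) = rholds r x y.
Proof.
move=> xs ys; case: r => [|bp bv]; first by apply: rank_eq; exact: in1.
by rewrite /rholds /dlt; case: bp; case: bv;
  rewrite ?(nf1 _ xs) ?(nf1 _ ys) ?(nf2 _ xs) ?(nf2 _ ys).
Qed.

Let tholds_nf t x y z w : x \in abcd -> y \in abcd -> z \in abcd -> w \in abcd ->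
  tholds t (nf x) (nf y) (nf z) (nf w) = tholds t x y z w.
Proof.
by move=> xs ys zs ws; case: t => [r1 r2 r3|r1 r2 r3|];
  rewrite /tholds ?rholds_nf ?nf1 ?nf2.
Qed.

Let occ_nf key x y z w : x \in abcd -> y \in abcd -> z \in abcd -> w \in abcd ->
  occ key (nf x) (nf y) (nf z) (nf w) = occ key x y z w.
Proof. by move=> xs ys zs ws; rewrite /occ /= !(nf1, nf2). Qed.

(** Only comparisons of coordinates enter the identities, and ranks preserve them. *)
Let rows_ok_nf : rows_ok (nf a) (nf b) (nf c) (nf d) = rows_ok a b c d.
Proof.
rewrite /rows_ok; set v := [seq _ | t <- _]; set v' := [seq _ | t <- _].
have -> : v = v'.
  apply: eq_map => t.
  apply: (@sym4_ext _ (fun x y z w => tholds t (nf x) (nf y) (nf z) (nf w))).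
  by move=> x y z w xs ys zs ws; rewrite tholds_nf.
apply: eq_all => row; congr (_ * _ + _ == _).
apply: (@sym4_ext _ (fun x y z w => occ row.1 (nf x) (nf y) (nf z) (nf w))).
by move=> x y z w xs ys zs ws; rewrite occ_nf.
Qed.

Lemma quadruplesP (P : nat -> nat -> nat -> nat -> bool) : quadruples P ->
  forall x y z w, x < 4 -> y < 4 -> z < 4 -> w < 4 -> P x y z w.
Proof.
move=> h x y z w x4 y4 z4 w4.
have m u : u < 4 -> u \in iota 0 4 by rewrite mem_iota.
by move: h => /allP/(_ x (m x x4))/allP/(_ y (m y y4))/allP/(_ z (m z z4))/allP/(_ w (m w w4)).
Qed.

Lemma sorted_rows_ok :
  a.1 <= b.1 -> b.1 <= c.1 -> c.1 <= d.1 -> coherent a b c d -> rows_ok a b c d.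
Proof.
move=> ab bc cd co; rewrite -rows_ok_nf.
have [ain bin cin din] : [/\ a \in abcd, b \in abcd, c \in abcd & d \in abcd].
  by rewrite !inE !eqxx ?orbT.
have r1 x : x \in abcd -> rank s1 x.1 < 4 by move=> /in1 /rank_size.
have r2 x : x \in abcd -> rank s2 x.2 < 4 by move=> /in2 /rank_size.
have := table_okP; rewrite /table_ok.
move/quadruplesP/(_ _ _ _ _ (r1 a ain) (r1 b bin) (r1 c cin) (r1 d din)).
rewrite (ranked_rank s1 : ranked [:: _; _; _; _]).
have -> : sorted leq [:: rank s1 a.1; rank s1 b.1; rank s1 c.1; rank s1 d.1].
  by rewrite /= andbT !(leqNgt (rank _ _)) !rank_lt ?in1 // -!leqNgt ab bc cd.
move/quadruplesP/(_ _ _ _ _ (r2 a ain) (r2 b bin) (r2 c cin) (r2 d din)).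
rewrite (ranked_rank s2 : ranked [:: _; _; _; _]).
have -> : coherent (nf a) (nf b) (nf c) (nf d) = true.
  by rewrite -co /coherent /compat /= !rank_eq ?in1 ?in2.
exact.
Qed.

End Ranks.

Lemma compatC x y : compat x y = compat y x.
Proof. by rewrite /compat [x.1 == _]eq_sym [x.2 == _]eq_sym. Qed.

Definition table_at a b c d : Prop := coherent a b c d -> rows_ok a b c d.

Lemma table_at01 a b c d : table_at b a c d -> table_at a b c d.
Proof.
move=> h co; have -> : rows_ok a b c d = rows_ok b a c d.
  rewrite /rows_ok; have -> : [seq sym4 (tholds t) a b c d | t <- basis] =
    [seq sym4 (tholds t) b a c d | t <- basis] by apply: eq_map => t; exact: sym4_01.
  by apply: eq_all => row; rewrite sym4_01.
by apply: h; case/and5P: co => h1 h2 h3 h4 /andP[h5 h6];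
  rewrite /coherent compatC h1 h2 h3 h4 h5 h6.
Qed.

Lemma table_at12 a b c d : table_at a c b d -> table_at a b c d.
Proof.
move=> h co; have -> : rows_ok a b c d = rows_ok a c b d.
  rewrite /rows_ok; have -> : [seq sym4 (tholds t) a b c d | t <- basis] =
    [seq sym4 (tholds t) a c b d | t <- basis] by apply: eq_map => t; exact: sym4_12.
  by apply: eq_all => row; rewrite sym4_12.
by apply: h; case/and5P: co => h1 h2 h3 h4 /andP[h5 h6];
  rewrite /coherent [compat c b]compatC h1 h2 h3 h4 h5 h6.
Qed.

Lemma table_at23 a b c d : table_at a b d c -> table_at a b c d.
Proof.
move=> h co; have -> : rows_ok a b c d = rows_ok a b d c.
  rewrite /rows_ok; have -> : [seq sym4 (tholds t) a b c d | t <- basis] =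
    [seq sym4 (tholds t) a b d c | t <- basis] by apply: eq_map => t; exact: sym4_23.
  by apply: eq_all => row; rewrite sym4_23.
by apply: h; case/and5P: co => h1 h2 h3 h4 /andP[h5 h6];
  rewrite /coherent [compat d c]compatC h1 h2 h3 h4 h5 h6.
Qed.

(** Insertion sort by adjacent transpositions: [st4] inserts the fourth point among three sorted
    ones, [st3] the third among two. *)
Lemma table_atP a b c d : table_at a b c d.
Proof.
have st4 x y z w : x.1 <= y.1 -> y.1 <= z.1 -> table_at x y z w.
  move=> xy yz; case: (leqP z.1 w.1) => [zw|/ltnW wz]; first exact: sorted_rows_ok.
  apply: table_at23; case: (leqP y.1 w.1) => [yw|/ltnW wy]; first exact: sorted_rows_ok.
  apply: table_at12; case: (leqP x.1 w.1) => [xw|/ltnW wx]; first exact: sorted_rows_ok.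
  by apply: table_at01; exact: sorted_rows_ok.
have st3 x y z w : x.1 <= y.1 -> table_at x y z w.
  move=> xy; case: (leqP y.1 z.1) => [yz|/ltnW zy]; first exact: st4.
  apply: table_at12; case: (leqP x.1 z.1) => [xz|/ltnW zx]; first exact: st4.
  by apply: table_at01; exact: st4.
case: (leqP a.1 b.1) => [ab|/ltnW ba]; first exact: st3.
by apply: table_at01; exact: st3.
Qed.

Lemma sum4_dot n neg z (ts : seq term) (F : term -> nat -> nat -> nat -> nat -> nat) :
  sum4 n (fun a b c d => dot neg z [seq F t a b c d | t <- ts]) =
  dot neg z [seq sum4 n (F t) | t <- ts].
Proof.
rewrite /dot; elim: ts z => [|t ts IH] [|x z] //=; rewrite ?sum4_const ?muln0 //.
by rewrite sum4_add sum4_mull IH.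
Qed.

Lemma dot_mul k neg z v : dot neg z (map (muln k) v) = k * dot neg z v.
Proof.
rewrite /dot; elim: v z => [|y v IH] [|x z] //=; rewrite ?muln0 //.
by rewrite IH mulnDr mulnCA.
Qed.

Lemma csumof_combo n p neg z :
  csumof n p neg (combo z) = dot neg z [seq tcount n p t | t <- basis].
Proof.
rewrite /csumof /combo big_filter_cond /dot.
elim: basis z => [|t ts IH] [|x z] //=; rewrite ?big_nil //.
rewrite 2!big_cons -{}IH.
by case: neg; case: x => [[|k]|k] /=; rewrite ?mul0n ?add0n.
Qed.

Lemma row_identity n (p : 'S_n) row : row \in rows ->
  12 * sum4 n (fun a b c d => occ row.1 (pt (perm_fun p) a) (pt (perm_fun p) b)
                 (pt (perm_fun p) c) (pt (perm_fun p) d)) +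
  csumof n (perm_fun p) true (combo row.2) = csumof n (perm_fun p) false (combo row.2).
Proof.
set P := perm_fun p => row_in.
pose v a b c d := [seq sym4 (tholds t) (pt P a) (pt P b) (pt P c) (pt P d) | t <- basis].
have vE neg : sum4 n (fun a b c d => dot neg row.2 (v a b c d)) =
    24 * csumof n P neg (combo row.2).
  rewrite /v sum4_dot csumof_combo -dot_mul -map_comp; congr dot; apply: eq_map => t /=.
  exact: (sum4_sym4 n (fun a b c d => tholds t (pt P a) (pt P b) (pt P c) (pt P d))).
have oE : sum4 n (fun a b c d =>
    12 * sym4 (occ row.1) (pt P a) (pt P b) (pt P c) (pt P d)) =
    12 * (24 * sum4 n (fun a b c d => occ row.1 (pt P a) (pt P b) (pt P c) (pt P d))).
  rewrite sum4_mull; congr (_ * _).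
  exact: (sum4_sym4 n (fun a b c d => occ row.1 (pt P a) (pt P b) (pt P c) (pt P d))).
(* Multiplied by 24, both sides become sums of symmetrized terms, and these agree quadruple by
   quadruple. *)
apply/eqP; rewrite -(eqn_pmul2l (isT : 0 < 24)) mulnDr mulnCA -oE -!vE -sum4_add.
apply/eqP; apply: eq_sum4 => a b c d an bn cn dn; apply/eqP.
have cmp x y : x < n -> y < n -> compat (pt P x) (pt P y).
  move=> xn yn; apply/eqP; apply/eqP/eqP => /= [->//|e].
  by rewrite -(perm_funK p xn) -/P e perm_funK.
have := @table_atP (pt P a) (pt P b) (pt P c) (pt P d).
rewrite /table_at /coherent !cmp // => /(_ isT) /allP /(_ row row_in).
exact.
Qed.

(** * From patterns to rows of the table *)

Definition pattern_key (sigma : 'S_4) : seq nat := [seq perm_fun sigma j | j <- iota 0 4].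

Lemma pattern_key_in sigma : pattern_key sigma \in map fst rows.
Proof.
(* All 256 words of length 4 over {0, ..., 3} are tried; the word of a permutation has no
   repetition. *)
have: quadruples (fun a b c d => uniq [:: a; b; c; d] ==> ([:: a; b; c; d] \in map fst rows)).
  by vm_compute.
move/quadruplesP/(_ (perm_fun sigma 0) (perm_fun sigma 1)).
move/(_ (perm_fun sigma 2) (perm_fun sigma 3)).
rewrite !perm_fun_lt // => /(_ isT isT isT isT) /implyP; apply.
rewrite -[X in uniq X]/(pattern_key sigma) map_inj_in_uniq ?iota_uniq // => i j.
by rewrite !mem_iota /= => i4 j4 e; rewrite -(perm_funK sigma i4) e perm_funK.
Qed.

(** Functions from four indices to positions correspond bijectively to quadruples; [occ] includes
    the condition that positions increase, so each occurrence is counted once. *)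
Lemma pattern_countE n (sigma : 'S_4) (p : 'S_n) : pattern_count sigma p =
  sum4 n (fun a b c d => occ (pattern_key sigma) (pt (perm_fun p) a) (pt (perm_fun p) b)
                 (pt (perm_fun p) c) (pt (perm_fun p) d)).
Proof.
pose o k : 'I_4 := inord k.
pose h (x : 'I_n * 'I_n * 'I_n * 'I_n) : {ffun 'I_4 -> 'I_n} :=
  [ffun j : 'I_4 => nth x.1.1.1 [:: x.1.1.1; x.1.1.2; x.1.2; x.2] j].
have hbij : bijective h.
  exists (fun f : {ffun 'I_4 -> 'I_n} => (f (o 0), f (o 1), f (o 2), f (o 3))).
    by move=> [[[a b] c] d]; rewrite !ffunE /o !inordK.
  move=> f; apply/ffunP => j; rewrite ffunE.
  by case: j => [[|[|[|[|//]]]] j4] /=; congr (f _); apply: val_inj; rewrite /= inordK.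
rewrite /pattern_count cardsE -sum1_card big_mkcond (reindex h) /=; last exact: onW_bij.
rewrite /sum4 pair_bigA pair_bigA pair_bigA /=.
apply: eq_bigr => -[[[a b] c] d] _ /=; rewrite unfold_in /=.
set F := h _; rewrite -[if _ then _ else _]/(nat_of_bool (occurs_at sigma p F)).
congr nat_of_bool; rewrite /occurs_at /occ; set xs := [:: _; _; _; _].
have xsE (j : 'I_4) : nth (pt (perm_fun p) a) xs j = (F j : nat, p (F j) : nat).
  rewrite -perm_funE /F ffunE.
  by case: j => [[|[|[|[|//]]]] j4].
have keyE (j : 'I_4) : nth 0 (pattern_key sigma) j = sigma j.
  by rewrite (nth_map 0) ?size_iota // nth_iota // perm_funE.
apply/andP/allP => [[/forallP h1 /forallP h2] j|hall].
  move=> jin; have j4 : j < 4 by move: jin; rewrite mem_iota.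
  apply/allP => j' j'in; have j'4 : j' < 4 by move: j'in; rewrite mem_iota.
  have := forallP (h1 (Ordinal j4)) (Ordinal j'4).
  have := forallP (h2 (Ordinal j4)) (Ordinal j'4).
  rewrite -(keyE (Ordinal j4)) -(keyE (Ordinal j'4)).
  by rewrite (xsE (Ordinal j4)) (xsE (Ordinal j'4)) => h2' h1'; apply/andP; split.
have hj (j j' : 'I_4) : ((j < j') ==> (F j < F j')) &&
    ((j != j') ==> ((p (F j) < p (F j')) == (sigma j < sigma j'))).
  have jin (i : 'I_4) : val i \in iota 0 4 by rewrite mem_iota /= ltn_ord.
  have := allP (hall _ (jin j)) _ (jin j').
  by rewrite !xsE !keyE.
by split; apply/forallP => j; apply/forallP => j'; have /andP[] := hj j j'.
Qed.

Definition pattern_combo (sigma : 'S_4) : combination := combo (row_of (pattern_key sigma)).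

Lemma row_of_in sigma : (pattern_key sigma, row_of (pattern_key sigma)) \in rows.
Proof.
have := pattern_key_in sigma; set key := pattern_key sigma => kin.
have ix : index key (map fst rows) < size rows by rewrite -(size_map fst) index_mem.
rewrite (_ : (key, _) = nth ([::], [::]) rows (index key (map fst rows))) ?mem_nth //.
rewrite [RHS]surjective_pairing -(nth_map _ [::]) //.
by rewrite nth_index.
Qed.

Lemma weight_pattern_combo sigma : weight (pattern_combo sigma) < 4096.
Proof.
have /allP/(_ _ (row_of_in sigma)) : all (fun row => weight (combo row.2) < 4096) rows.
  by vm_compute.
by [].
Qed.

Lemma pattern_combo_count n (sigma : 'S_4) (p : 'S_n) :
  (csumof n (perm_fun p) false (pattern_combo sigma) -
   csumof n (perm_fun p) true (pattern_combo sigma)) %/ 12 = pattern_count sigma p.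
Proof.
have /= <- := row_identity p (row_of_in sigma).
by rewrite addnK mulKn // pattern_countE.
Qed.

(** * Asymptotic estimates over the reals *)

Local Open Scope ring_scope.

Lemma powR_nat_ge1 (R : realType) (r : R) (n : nat) :
  0 <= r -> (0 < n)%N -> 1 <= (n%:R : R) `^ r.
Proof.
move=> r0 n0; have {1}-> : (1 : R) = 1 `^ r by rewrite powR1.
by rewrite ge0_ler_powR ?nnegrE ?ler0n ?ler01 ?ler1n.
Qed.

(** With x = n^(1/3), the cube of s - 1 is at most n, so s - 1 <= x, and 1 <= x because n >= 1. *)
Lemma strip_size_le (R : realType) (n : nat) : (0 < n)%N ->
  ((strip_size n)%:R : R) <= 2%:R * n%:R `^ (3%:R^-1).
Proof.
move=> n0; have [S0 _ S3 _] := strip_sizeP n.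
set s := strip_size n in S0 S3 *; set x := n%:R `^ _.
have x1 : 1 <= x by rewrite powR_nat_ge1 // invr_ge0 ler0n.
have sx : (s.-1%:R : R) <= x.
  have -> : (s.-1%:R : R) = ((s.-1 ^ 3)%:R : R) `^ (3%:R^-1).
    by rewrite natrX -powR_mulrn ?ler0n // -powRrM mulfV ?powRr1 ?ler0n.
  by rewrite ge0_ler_powR ?invr_ge0 ?nnegrE ?ler0n // ler_nat.
rewrite -(prednK S0) -natr1 mulr2n mulrDl mul1r; exact: lerD.
Qed.

Lemma softO_strip_time (R : realType) (A : nat) :
  softO (fun n => (4 + A * (n.+1 * (strip_size n * strip_size n)))%N)
        (fun n : nat => (n%:R : R) `^ (5%:R / 3%:R)).
Proof.
(* 8 is 2·2·2, from n + 1 <= 2n and two factors s <= 2 n^(1/3). The exponent of the logarithm is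
   0. *)
exists (4 + 8 * A%:R), 0%N; exists 1%N => // n /= n1.
rewrite expr0 mulr1; set s := strip_size n.
set x : R := n%:R `^ (3%:R^-1).
have sx : (s%:R : R) <= 2%:R * x by exact: strip_size_le.
have x0 : 0 <= x by exact: powR_ge0.
have n0 : (n%:R : R) != 0 by rewrite pnatr_eq0 -lt0n.
have -> : (n%:R : R) `^ (5%:R / 3%:R) = n%:R * (x * x).
  rewrite -[X in _ = X * _](powRr1 (ler0n R n)) /x -!powRD ?n0 ?implybT //.
  by congr (_ `^ _); field.
have n1R : (1 : R) <= n%:R by rewrite ler1n.
have x1 : 1 <= x by rewrite powR_nat_ge1 // invr_ge0 ler0n.
have P1 : 1 <= n%:R * (x * x) by rewrite !mulr_ege1.
rewrite natrD !natrM [leRHS]mulrDl; apply: lerD; first by rewrite ler_peMr.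
rewrite [8 * _]mulrC -[leRHS]mulrA ler_wpM2l ?ler0n //.
have s2 : (s%:R * s%:R : R) <= (2 * x) * (2 * x) by rewrite ler_pM.
have n2 : (n.+1%:R : R) <= 2 * n%:R by rewrite -natr1 mulr_natl mulr2n lerD2l.
apply: (le_trans (ler_pM _ _ n2 s2)); rewrite ?ler0n ?mulr_ge0 ?ler0n //.
by rewrite le_eqVlt; apply/orP; left; apply/eqP; ring.
Qed.

Lemma softO_ram_space (R : realType) : softO ram_space (fun n : nat => n%:R : R).
Proof.
(* There are 11 arrays of 2n + 2 <= 4n cells, for n >= 1. *)
exists 44, 0%N; exists 1%N => // n /= n1.
rewrite expr0 mulr1 -natrM ler_nat /ram_space; lia.
Qed.

Theorem theorem6 (R : realType) (sigma : 'S_4) :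
  exists (c : cmd) (b : nat) (time space : nat -> nat),
    [/\ computes_in c b (fun (n : nat) (p : 'S_n) => pattern_count sigma p)
          time space,
        softO time (fun n : nat => (n%:R : R) `^ (5%:R / 3%:R)) &
        softO space (fun n : nat => n%:R : R)].
Proof.
exists (ram (pattern_combo sigma)), 32%N, (ram_time (pattern_combo sigma)), ram_space.
split; [split=> // n p|exact: softO_strip_time|exact: softO_ram_space].
split; first by rewrite /ram_space; lia.
have [t [s' [ex tle res]]] := ramP p (weight_pattern_combo sigma).
by exists t, s'; split=> //; rewrite res pattern_combo_count.
Qed.
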